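(* Let $\xi=\{\gamma_1,\ldots,\gamma_r\}\subset\mathbb{Z}^2$ be a set of monomial exponents, let $X\subset\mathbb{C}^r$ be the affine toric surface it determines, and let $\mathbb{C}(x_1,x_2)$ be its field of rational functions. Let $\nu:\mathbb{C}(x_1,x_2)\rightarrow\Gamma$ be any valuation centered on $X$ such that $\nu(x_1)\neq\lambda\,\nu(x_2)$ for all $\lambda\in\mathbb{R}\setminus\mathbb{Q}$. Then a finite iteration of Nash modification gives local uniformization along $\nu$; that is, writing $X_0=X$ and letting $X_{k+1}$ be the Nash modification of $X_k$, there is $k\geq 0$ such that the center of $\nu$ on $X_k$ is non-singular.
   Context: Toric surfaces. A set of monomial exponents is a finite set $\xi=\{\gamma_1,\ldots,\gamma_r\}\subset\mathbb{Z}^2$ whose integer span $\mathbb{Z}\xi$ equals $\mathbb{Z}^2$. The affine toric surface $X$ determined by $\xi$ (not necessarily normal) is the Zariski closure in $\mathbb{C}^r$ of $\{(x^{\gamma_1},\ldots,x^{\gamma_r})\mid x=(x_1,x_2)\in(\mathbb{C}^* )^2\}$, where $x^{\gamma_k}=x_1^{\gamma_{k,1}}x_2^{\gamma_{k,2}}$ for $\gamma_k=(\gamma_{k,1},\gamma_{k,2})$; its coordinate ring is $\mathbb{C}[x^{\gamma_1},\ldots,x^{\gamma_r}]$, with fraction field $\mathbb{C}(x_1,x_2)$. Nash modification. Let $X\subset\mathbb{C}^r$ be an algebraic variety of pure dimension $m$, and let $G:X\setminus\mathrm{Sing}(X)\to G(m,r)$ be the Gauss map sending $x$ to the direction $T_xX$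 of the tangent space of $X$ at $x$, where $G(m,r)$ is the Grassmannian of $m$-dimensional vector subspaces of $\mathbb{C}^r$. Let $X^*$ be the Zariski closure of the graph of $G$ in $X\times G(m,r)$. The variety $X^*$, together with the restriction to $X^*$ of the projection $X\times G(m,r)\to X$, is the Nash modification of $X$. This map is proper and birational. For varieties covered by affine charts the construction is carried out on affine charts and glued, so it can be iterated. Valuations. $\Gamma$ is a totally ordered abelian group, written additively. A valuation $\nu$ of a field $K$ with values in $\Gamma$ is a map $\nu:K\to\Gamma\cup\{+\infty\}$ with $\nu(xy)=\nu(x)+\nu(y)$, $\nu(x+y)\geq\min(\nu(x),\nu(y))$, and $\nu(x)=+\infty$ iff $x=0$. All valuations considered are trivial on $\mathbb{C}$. The valuation ring is $V=\{x\in K\mid\nu(x)\geq 0\}$ with maximal ideal $\mathfrak{m}$. For a subring $R\subset K$, $\nu$ is centered on $R$ (or on $\mathrm{Spec}\,R$) if $R\subset V$; its center is then the prime ideal $R\cap\mathfrak{m}$. On a variety with function field $K$, the center is computed in any affine chart on which $\nu$ is centered; a valuation centered on $X$ has a center on every $X'$ admitting a proper birational morphism $X'\to X$. The center is non-singular if the local ring at it is regular. Up to isomorphism, the value group of such a valuation of $\mathbb{C}(x_1,x_2)$ is a subgroup of $\mathbb{Q}$, or $\mathbb{Z}^2$ with the lexicographic order, or $\mathbb{Z}+\beta\mathbb{Z}\subset\mathbb{R}$ with $\beta\in\mathbb{R}\setminus\mathbb{Q}$, $\beta\ge 0$. The products $\lambda\nu(x_2)$ are understood in $\mathbb{R}$,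 respectively in $\mathbb{R}^2$. *)

(* Defs.v *)
From HB Require Import structures.
From mathcomp Require Import all_boot all_order all_algebra.
From mathcomp Require Import fraction complex reals mpoly.

Set Implicit Arguments.
Unset Strict Implicit.
Unset Printing Implicit Defensive.
Import Order.TTheory GRing.Theory Num.Theory.
Local Open Scope ring_scope.

(** ** Commutative algebra inside a field

    Subrings of a field [K] and their ideals are predicates on [K]. *)

Section SubringsOfField.
Variable K : fieldType.
Implicit Types (A I P M : K -> Prop).

Definition is_ideal A I : Prop :=
  [/\ forall x, I x -> A x,
      I 0,
      forall x y, I x -> I y -> I (x + y)
    & forall a x, A a -> I x -> I (a * x)].

Definition is_prime_ideal A P : Prop :=
  [/\ is_ideal A P,
      ~ P 1
    & forall x y, A x -> A y -> P (x * y) -> P x \/ P y].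

Definition generates A (n : nat) (g : 'I_n -> K) I : Prop :=
  forall x, I x <->
    exists c : 'I_n -> K, (forall i, A (c i)) /\ x = \sum_(i < n) c i * g i.

Definition noetherian A : Prop :=
  forall I, is_ideal A I -> exists n (g : 'I_n -> K), generates A g I.

(* [P 0], ..., [P d]; the values of [P] beyond [d] are irrelevant. *)
Definition has_prime_chain A (d : nat) : Prop :=
  exists P : nat -> K -> Prop,
    (forall i, (i <= d)%N -> is_prime_ideal A (P i)) /\
    (forall i, (i < d)%N ->
       (forall x, P i x -> P i.+1 x) /\ (exists x, P i.+1 x /\ ~ P i x)).

Definition krull_dim A (d : nat) : Prop :=
  has_prime_chain A d /\ forall e, has_prime_chain A e -> (e <= d)%N.

(* [A] is meant to be a local ring with maximal ideal [M]. *)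
Definition regular_local_ring A M : Prop :=
  noetherian A /\
  exists d (g : 'I_d -> K), krull_dim A d /\ generates A g M.

Definition localization A P (x : K) : Prop :=
  exists a b, [/\ A a, A b, ~ P b & x = a / b].

Definition localization_max_ideal A P (x : K) : Prop :=
  exists a b, [/\ P a, A b, ~ P b & x = a / b].

End SubringsOfField.

(** ** Valuations; [None] stands for [+oo] *)

Definition ordered_group (Gam : porderZmodType) : Prop :=
  total (<=%R : rel Gam) /\
  forall x y z : Gam, x <= y -> x + z <= y + z.

Section Valuations.
Variables (K : fieldType) (Gam : porderZmodType).
Implicit Types (a b : option Gam).

Definition vadd a b : option Gam :=
  match a, b with Some g, Some h => Some (g + h) | _, _ => None end.

Definition vle a b : bool :=
  match a, b with
  | _, None => true
  | None, Some _ => false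
  | Some g, Some h => g <= h
  end.

Definition vlt a b : bool := vle a b && (a != b).

Definition vmin a b : option Gam := if vle a b then a else b.

Record valuation (nu : K -> option Gam) : Prop := Valuation {
  valuationM : forall x y, nu (x * y) = vadd (nu x) (nu y);
  valuationD : forall x y, vle (vmin (nu x) (nu y)) (nu (x + y));
  valuation_infty : forall x, nu x = None <-> x = 0
}.

Definition centered (nu : K -> option Gam) (A : K -> Prop) : Prop :=
  forall x, A x -> vle (Some 0) (nu x).

Definition center (nu : K -> option Gam) (A : K -> Prop) (x : K) : Prop :=
  A x /\ vlt (Some 0) (nu x).

Definition regular_at_center (nu : K -> option Gam) (A : K -> Prop) : Prop :=
  regular_local_ring (localization A (center nu A))
                     (localization_max_ideal A (center nu A)).

Definition value_group (nu : K -> option Gam) (g : Gam) : Prop :=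
  exists x, nu x = Some g.

(* [phi] identifies the value group of [nu] with a subgroup of Q, with Z^2
   ordered lexicographically, or with Z + beta Z.  To have one target for the
   three cases, R is placed in R^2 as R x {0}: this is compatible with the
   lexicographic order [*l] and with the multiplication by real numbers. *)
Definition value_group_model (R : realType) (nu : K -> option Gam)
    (phi : Gam -> R^o * R^o) : Prop :=
  let image u := exists2 g, value_group nu g & phi g = u in
  [/\ forall g h, value_group nu g -> value_group nu h ->
        phi (g + h) = phi g + phi h,
      forall g h, value_group nu g -> value_group nu h ->
        g < h -> ((phi g : R *l R) < phi h)%O
    & [\/ forall u, image u -> exists q : rat, u = (ratr q, 0),
          forall u, image u <-> exists a b : int, u = (a%:~R, b%:~R)
        | exists beta : R, [/\ irrational beta, 0 <= beta
            & forall u, image u <->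
                exists a b : int, u = (a%:~R + beta * b%:~R, 0)]]].

End Valuations.

(** ** Zariski topology and Nash modification *)

Section Nash.
Variable F : fieldType.

Definition zariski_closed n (X : 'rV[F]_n -> Prop) : Prop :=
  exists S : {mpoly F[n]} -> Prop,
    forall x, X x <-> (forall p, S p -> p.@[x 0] = 0).

Definition vanishing_ideal n (X : 'rV[F]_n -> Prop) (p : {mpoly F[n]}) : Prop :=
  forall x, X x -> p.@[x 0] = 0.

Definition zariski_closure n (X : 'rV[F]_n -> Prop) (x : 'rV[F]_n) : Prop :=
  forall p, vanishing_ideal X p -> p.@[x 0] = 0.

Definition is_tangent_space n (X : 'rV[F]_n -> Prop) (x : 'rV[F]_n)
    (T : {vspace 'rV[F]_n}) : Prop :=
  forall v : 'rV[F]_n, v \in T <->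
    (forall p, vanishing_ideal X p ->
       \sum_(i < n) v 0 i * (p^`M(i)).@[x 0] = 0).

(* For [X] of pure dimension [m], the non-singular points are those whose
   tangent space has dimension [m]. *)
Definition gauss_graph (m n : nat) (X : 'rV[F]_n -> Prop) (x : 'rV[F]_n)
    (T : {vspace 'rV[F]_n}) : Prop :=
  [/\ X x, is_tangent_space X x T & \dim T = m].

Definition row_vspace m n (B : 'M[F]_(m, n)) : {vspace 'rV[F]_n} :=
  <<[seq row i B | i : 'I_m]>>%VS.

(* The standard affine chart of G(m, n) attached to the columns [J] consists of
   the subspaces with a (unique) basis matrix [B] whose submatrix on [J] is the
   identity.  [grass_chart J Z] is the trace of [Z], a subset of
   F^n x G(m, n), on F^n times this chart, as a subset of F^(n + m * n). *)
Definition grass_chart m n (J : 'I_m -> 'I_n)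
    (Z : 'rV[F]_n -> {vspace 'rV[F]_n} -> Prop) (y : 'rV[F]_(n + m * n)) : Prop :=
  let B : 'M[F]_(m, n) := vec_mx (rsubmx y) in
  colsub J B = 1%:M /\ Z (lsubmx y) (row_vspace B).

(* Zariski closed subsets of F^n x G(m, n) *)
Definition grass_closed (m n : nat)
    (Z : 'rV[F]_n -> {vspace 'rV[F]_n} -> Prop) : Prop :=
  (forall x T, Z x T -> \dim T = m) /\
  (forall J : 'I_m -> 'I_n, zariski_closed (grass_chart J Z)).

Definition nash_modification (m n : nat) (X : 'rV[F]_n -> Prop) (x : 'rV[F]_n)
    (T : {vspace 'rV[F]_n}) : Prop :=
  forall Z, grass_closed m Z ->
    (forall y U, gauss_graph m X y U -> Z y U) -> Z x T.

End Nash.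

(** ** Toric surfaces and their iterated Nash modifications *)

Definition monomial (F : fieldType) (x : 'I_2 -> F) (g : 'rV[int]_2) : F :=
  \prod_(j < 2) x j ^ g 0 j.

Definition monomial_exponents r (gamma : 'I_r -> 'rV[int]_2) : Prop :=
  injective gamma /\
  forall v : 'rV[int]_2, exists c : 'I_r -> int,
    v = \sum_(i < r) c i *: gamma i.

Section ToricSurfaces.
Variable R : realType.
Local Notation C := R[i].

(* C(x_1, x_2) *)
Definition ratfun : fieldType := {fraction {mpoly C[2]}}.

Definition ratfunC (c : C) : ratfun := FracField.tofrac (c%:MP_[2] : {mpoly C[2]}).

Definition ratfunX (j : 'I_2) : ratfun := FracField.tofrac ('X_j : {mpoly C[2]}).

(* An affine variety in C^adim with a rational coordinate function for each
   ambient coordinate, which identifies its function field with C(x_1, x_2). *)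
Record affine_chart := AffineChart {
  adim : nat;
  points : 'rV[C]_adim -> Prop;
  coords : 'rV[ratfun]_adim
}.

Arguments points : clear implicits.
Arguments coords : clear implicits.

(* p(f) in C(x_1, x_2) *)
Definition pullback n (f : 'rV[ratfun]_n) (p : {mpoly C[n]}) : ratfun :=
  mmap ratfunC (f 0) p.

Definition coord_ring (U : affine_chart) (x : ratfun) : Prop :=
  exists p, x = pullback (coords U) p.

Definition toric_surface r (gamma : 'I_r -> 'rV[int]_2) : affine_chart :=
  AffineChart
    (zariski_closure (fun y : 'rV[C]_r =>
       exists t : 'I_2 -> C,
         (forall j, t j != 0) /\ y = \row_(i < r) monomial t (gamma i)))
    (\row_(i < r) monomial ratfunX (gamma i)).

(* The non-empty affine charts of the k-th iterated Nash modification of X.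
   The first coordinates of a chart of the Nash modification of [U] are those
   of [U], because the function fields are identified through the projection
   to [U]; the other ones, [G], are then determined by the condition that the
   polynomials vanishing on the chart be those vanishing at its coordinate
   functions, since the projection is birational.  This condition cannot hold
   for an empty chart. *)
Inductive nash_chart (X : affine_chart) : nat -> affine_chart -> Prop :=
| NashChart0 : nash_chart X 0 X
| NashChartS k (U : affine_chart) (J : 'I_2 -> 'I_(adim U))
    (G : 'M[ratfun]_(2, adim U)) :
    nash_chart X k U ->
    let X' := grass_chart J (nash_modification 2 (points U)) in
    let f' := row_mx (coords U) (mxvec G) in
    (forall p, vanishing_ideal X' p <-> pullback f' p = 0) ->
    nash_chart X k.+1 (AffineChart X' f').

Definition center_nonsingular (Gam : porderZmodType)
    (nu : ratfun -> option Gam) (X : affine_chart) (k : nat) : Prop :=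
  exists U, [/\ nash_chart X k U, centered nu (coord_ring U)
              & regular_at_center nu (coord_ring U)].

End ToricSurfaces.

(* Main.v *)
(* Every chart met is parametrized by scalar multiples of Laurent monomials, and
   its Nash modification in the chart of the Grassmannian attached to two
   independent exponents p, q is again of this kind: it adjoins the exponents
   g - p for g independent of q and g - q for g independent of p.  Following
   the valuation means choosing p, q with nu(x^p) + nu(x^q) minimal.

   The hypothesis on nu(x_1), nu(x_2) makes the sign of nu(x^g) that of (L g, M g)
   for the lexicographic order, with L, M integral and unimodular (M may be
   absent, or both).  The number L p + L q is non-increasing, hence stationary.
   If no nonzero exponent of level L = 0 ever appears, then p and q do not
   change any more, and subtracting them repeatedly shows that the exponents are
   generated by p and q as a monoid.  Otherwise L p = 0, then L q = 1, and a
   descent on the levels leads to the same conclusion modulo exponents of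
   value 0.  So the local ring of the center is that of C[u, w] at the center of
   nu, for u, w the monomials of a basis of Z^2, and it is regular. *)
Require Import Defs.
From HB Require Import structures.
From mathcomp Require Import all_boot all_order all_algebra.
From mathcomp Require Import fraction complex reals mpoly.
From mathcomp Require Import boolp ring lra zify.

Set Implicit Arguments.
Unset Strict Implicit.
Unset Printing Implicit Defensive.
Import Order.TTheory GRing.Theory Num.Theory.
Local Open Scope ring_scope.

(** * Exponents along the valuation *)

(** The Nash modification is a closure over all non-singular points, of which the torus points are
    only some. A relation between the new coordinates is known on the torus only, so it has to be
    carried to every non-singular point and then to the closure, across all charts of the
    Grassmannian; this is done for an arbitrary variety. Scalars accompany the monomials because the
    normalized basis of a tangent plane has quotients of determinants of exponents as coefficients,
    and those that vanish are the exponents that are not adjoined.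

    In the lexicographic case the base ends as (0, 1), (1, f), where nothing bounds f from below a
    priori, since every vector (1, f) is non-negative. Progress is measured instead by how negative
    the exponents of a given level m are along (0, 1): each drop of f gains m there, while m - 1
    steps lose at most m - 1.

    The center can be the generic point, a curve or a closed point, so regularity is proved in
    dimensions 0, 1 and 2, according to which residues of u and w are constants. *)

Definition subgroup (V : zmodType) (H : V -> Prop) : Prop :=
  H 0 /\ forall x y, H x -> H y -> H (x - y).

(** Phrased as an induction principle over subgroups, so that no coefficients have to be carried
    along. *)
Definition spans (V : zmodType) (s : seq V) : Prop :=
  forall H : V -> Prop, subgroup H -> (forall x, x \in s -> H x) ->
  forall x, H x.

Lemma subgroupD (V : zmodType) (H : V -> Prop) x y :
  subgroup H -> H x -> H y -> H (x + y).
Proof.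
by move=> [H0 HB] Hx Hy; rewrite -[y]opprK; apply: (HB) => //; rewrite -sub0r; apply: HB.
Qed.

Lemma subgroupN (V : zmodType) (H : V -> Prop) x : subgroup H -> H x -> H (- x).
Proof. by move=> [H0 HB] Hx; rewrite -sub0r; apply: HB. Qed.

Lemma subgroupMz (V : zmodType) (H : V -> Prop) x (n : int) :
  subgroup H -> H x -> H (x *~ n).
Proof.
move=> sH Hx.
have Hn m : H (x *+ m).
  by elim: m => [|m IH]; [rewrite mulr0n; case: sH | rewrite mulrS; apply: subgroupD].
case: n => m; first exact: Hn.
by rewrite NegzE mulrNz; apply: subgroupN => //; apply: Hn.
Qed.

Definition det2 (g h : int * int) : int := g.1 * h.2 - g.2 * h.1.

(* In a suitable basis of Z^2, the monomials of non-negative value are those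
   whose exponent satisfies [nonneg o] for one of these three modes. *)
Variant order_mode := OrderTrivial | OrderFirst | OrderLex.

Definition nonneg (o : order_mode) (g : int * int) : bool :=
  match o with
  | OrderTrivial => true
  | OrderFirst => 0 <= g.1
  | OrderLex => (0 < g.1) || ((g.1 == 0) && (0 <= g.2))
  end.

Definition null (o : order_mode) (g : int * int) : bool :=
  nonneg o g && nonneg o (- g).

Definition nash_exponents (p q : int * int) (s : seq (int * int))
    : seq (int * int) :=
  s ++ [seq g - p | g <- s & det2 g q != 0] ++ [seq g - q | g <- s & det2 p g != 0].

(* The monomials with exponents [e1], [e2] are coordinates at the center: those
   with null exponents are units there, hence can be inverted. *)
Definition smooth_exponents (o : order_mode) (s : seq (int * int)) : Prop :=
  exists e1 e2 : int * int,
  [/\ `|det2 e1 e2| = 1, nonneg o e1, nonneg o e2,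
      forall g, g \in s -> exists i j : int,
        [/\ g = e1 *~ i + e2 *~ j, 0 <= i \/ null o e1 & 0 <= j \/ null o e2]
    & forall H, subgroup H -> (forall g, g \in s -> null o g -> H g) ->
        (e1 \in s \/ H e1) /\ (e2 \in s \/ H e2)].

Lemma pairB1 (g h : int * int) : @fst int int (g - h) = g.1 - h.1. Proof. by []. Qed.
Lemma pairB2 (g h : int * int) : @snd int int (g - h) = g.2 - h.2. Proof. by []. Qed.
Lemma pairD1 (g h : int * int) : @fst int int (g + h) = g.1 + h.1. Proof. by []. Qed.
Lemma pairD2 (g h : int * int) : @snd int int (g + h) = g.2 + h.2. Proof. by []. Qed.
Lemma pairN1 (g : int * int) : @fst int int (- g) = - g.1. Proof. by []. Qed.
Lemma pairN2 (g : int * int) : @snd int int (- g) = - g.2. Proof. by []. Qed.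
Lemma pairMz1 (g : int * int) n : @fst int int (g *~ n) = g.1 * n.
Proof. by rewrite (raddfMz (@fst int int)) -mulrzr intz. Qed.
Lemma pairMz2 (g : int * int) n : @snd int int (g *~ n) = g.2 * n.
Proof. by rewrite (raddfMz (@snd int int)) -mulrzr intz. Qed.
Definition pairE := (pairB1, pairB2, pairD1, pairD2, pairN1, pairN2, pairMz1, pairMz2).

Lemma pair_eq0 (g : int * int) : (g == 0) = (g.1 == 0) && (g.2 == 0).
Proof. by case: g => a b; rewrite -[0 : int * int]/(0, 0) xpair_eqE. Qed.

Lemma pair_ext (g h : int * int) : g.1 = h.1 -> g.2 = h.2 -> g = h.
Proof. by case: g h => ? ? [? ?] /= -> ->. Qed.

Lemma nash_exponentsP p q s g :
  g \in nash_exponents p q s <->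
  [\/ g \in s, g + p \in s /\ det2 (g + p) q != 0
    | g + q \in s /\ det2 p (g + q) != 0].
Proof.
rewrite !mem_cat; split.
- case/or3P => [?|/mapP[h]|/mapP[h]]; first exact: Or31.
  + by rewrite mem_filter => /andP[d hs] ->; apply: Or32; rewrite subrK.
  + by rewrite mem_filter => /andP[d hs] ->; apply: Or33; rewrite subrK.
- case=> [->//|[gs d]|[gs d]]; apply/or3P.
  + by apply: Or32; apply/mapP; exists (g + p); rewrite ?addrK // mem_filter d.
  + by apply: Or33; apply/mapP; exists (g + q); rewrite ?addrK // mem_filter d.
Qed.

Lemma nonnegD o g h : nonneg o g -> nonneg o h -> nonneg o (g + h).
Proof. by case: o; rewrite /nonneg ?pairE //=; lia. Qed.

Lemma nonneg_total o g : nonneg o g || nonneg o (- g).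
Proof. by case: o; rewrite /nonneg ?pairE //=; lia. Qed.

Lemma spans_det_neq0 s : spans s ->
  exists p q : int * int, [/\ p \in s, q \in s & det2 p q != 0].
Proof.
move=> sp.
have [p ps pn0] : exists2 p, p \in s & p != 0.
  apply/hasP; apply/negPn/negP => /hasPn h.
  suff : ((1, 0) : int * int) = 0 by [].
  apply: (sp (fun x => x = 0)); first by split=> // x y -> ->; rewrite subr0.
  by move=> x /h; rewrite negbK => /eqP.
have [q qs d] : exists2 q, q \in s & det2 p q != 0.
  apply/hasP; apply/negPn/negP => /hasPn h.
  suff : det2 p (- p.2, p.1) = 0 by move: pn0; rewrite pair_eq0 /det2 /=; nia.
  apply: (sp (fun x => det2 p x = 0)).
    by rewrite /det2; split=> [|x y]; rewrite ?pairE /=; lia.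
  by move=> x /h; rewrite negbK => /eqP.
by exists p, q.
Qed.

(** The vector of smaller level comes first, so that a base vector of level 0 is always the first
    one. *)
Definition exponent_bases (s : seq (int * int)) : seq ((int * int) * (int * int)) :=
  [seq x <- [seq (p, q) | p <- s, q <- s] |
    (det2 x.1 x.2 != 0) && (x.1.1 <= x.2.1)].

Definition base_le o (x y : (int * int) * (int * int)) :=
  nonneg o (y.1 + y.2 - x.1 - x.2).

Definition minbase o s : (int * int) * (int * int) :=
  head ((0, 0), (0, 0)) (sort (base_le o) (exponent_bases s)).

Lemma minbaseP o s : spans s -> let x := minbase o s in
  [/\ x.1 \in s, x.2 \in s, det2 x.1 x.2 != 0, x.1.1 <= x.2.1
    & forall p q : int * int, p \in s -> q \in s -> det2 p q != 0 ->
        nonneg o (p + q - x.1 - x.2)].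
Proof.
move=> /spans_det_neq0 [p0 [q0 [p0s q0s d0]]] /=.
have tot : total (base_le o).
  move=> x y; rewrite /base_le; have := nonneg_total o (y.1 + y.2 - x.1 - x.2).
  rewrite (_ : - (y.1 + y.2 - x.1 - x.2) = x.1 + x.2 - y.1 - y.2) //; ring.
have tr : transitive (base_le o).
  move=> y x z; rewrite /base_le => h1 h2; have := nonnegD h1 h2.
  congr (nonneg _ _); ring.
have mem p q : p \in s -> q \in s -> det2 p q != 0 ->
  (p, q) \in exponent_bases s \/ (q, p) \in exponent_bases s.
  move=> ps qs d; rewrite !mem_filter /= d.
  have -> : det2 q p != 0 by move: d; rewrite /det2; lia.
  case: (lerP p.1 q.1) => h; [left|right].
    by apply/allpairsP; exists (p, q).
  by rewrite ltW //=; apply/allpairsP; exists (q, p).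
have sub : forall x, x \in sort (base_le o) (exponent_bases s) ->
   [/\ x.1 \in s, x.2 \in s, det2 x.1 x.2 != 0 & x.1.1 <= x.2.1].
  move=> x; rewrite mem_sort mem_filter => /andP[/andP[d le]].
  by move=> /allpairsP[[a b] [/= as_ bs_ xE]]; move: d le; rewrite xE.
have srt := sort_sorted tot (exponent_bases s).
rewrite /minbase; move: (mem p0 q0 p0s q0s d0).
rewrite -![_ \in exponent_bases s](mem_sort (base_le o)).
have mem' p q : p \in s -> q \in s -> det2 p q != 0 ->
  (p, q) \in sort (base_le o) (exponent_bases s) \/
  (q, p) \in sort (base_le o) (exponent_bases s).
  by rewrite ![_ \in sort _ _]mem_sort; apply: mem.
case: (sort _ _) srt sub mem' => [|x l] /= srt sub mem' h; first by case: h.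
have [xs1 xs2 xd xl] := sub x (mem_head _ _).
split => // p q ps qs d.
have all_le : forall y, y \in x :: l -> base_le o x y.
  move=> y; rewrite inE => /predU1P[->|yl].
    by rewrite /base_le (_ : _ - _ = 0) ?/nonneg; [case: (o) | ring].
  by move: srt; rewrite path_sortedE // => /andP[/allP/(_ y yl)].
case: (mem' p q ps qs d) => /all_le; rewrite /base_le //=.
by rewrite [q + p]addrC.
Qed.

(** * Exponent sets of the successive charts *)

Section NashSequence.
Variable o : order_mode.
Implicit Types (s : seq (int * int)) (g h : int * int) (k : nat).

Definition nash_step s : seq (int * int) := nash_exponents (minbase o s).1 (minbase o s).2 s.

Definition nash_seq s k : seq (int * int) := iter k nash_step s.

Definition admissible s := spans s /\ forall g, g \in s -> nonneg o g.

Lemma nash_step_admissible s : admissible s -> admissible (nash_step s).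
Proof.
move=> [sp nn]; have [ps qs d _ min] := minbaseP o sp; split.
  by move=> H sH Hs; apply: sp => // x xs; apply: Hs; apply/nash_exponentsP; apply: Or31.
move=> g /nash_exponentsP[/nn//|[gs d']|[gs d']].
- have := min _ _ gs qs d'; congr (nonneg _ _); ring.
- have := min _ _ ps gs d'; congr (nonneg _ _); ring.
Qed.

Lemma nash_seq_admissible s k : admissible s -> admissible (nash_seq s k).
Proof. by move=> h; elim: k => // k; apply: nash_step_admissible. Qed.

Lemma nash_seqS s k : nash_seq s k.+1 = nash_step (nash_seq s k).
Proof. by []. Qed.

Lemma nash_seqD s j k : nash_seq s (j + k) = nash_seq (nash_seq s k) j.
Proof. exact: iterD. Qed.

Lemma nash_seq_sub s j k g : (j <= k)%N -> g \in nash_seq s j -> g \in nash_seq s k.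
Proof.
move=> /subnK <-; elim: (k - j)%N => // n IH gs; rewrite addSn nash_seqS.
by apply/nash_exponentsP; apply: Or31; apply: IH.
Qed.

Lemma nonincreasing_int_stable (f : nat -> int) :
  (forall k, 0 <= f k) -> (forall k, f k.+1 <= f k) ->
  exists K, forall k, (K <= k)%N -> f k = f K.
Proof.
move=> f0 fd.
have anti j k : (j <= k)%N -> f k <= f j.
  move=> /subnK <-; elim: (k - j)%N => // n IH; rewrite addSn.
  exact: le_trans (fd _) IH.
suff H n : forall k, (`|f k| <= n)%N -> exists K, forall k, (K <= k)%N -> f k = f K.
  exact: (H _ 0%N (leqnn _)).
elim: n => [|n IH] k hk.
  by exists k => j /anti h; have := f0 j; have := f0 k; lia.
have [[j hj]|h] := pselect (exists j, (k <= j)%N && (f j < f k)).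
  by apply: (IH j); have := f0 j; have := f0 k; lia.
exists k => j kj; apply/eqP; rewrite eq_le anti //= leNgt; apply/negP => fj.
by apply: h; exists j; rewrite kj.
Qed.

Lemma admissible_ind s (H : int * int -> Prop) :
  admissible s -> subgroup H -> (forall g : int * int, g \in s -> H g) ->
  forall g : int * int, H g.
Proof. by move=> [sp _]; apply: sp. Qed.

(** Writing the standard basis in terms of [p] and [q] makes [det2 p q] a divisor of 1. *)
Lemma basis_of_spans (p q : int * int) :
  (forall x, exists i j : int, x = p *~ i + q *~ j) -> `|det2 p q| = 1.
Proof.
move=> h; have [i [j e1]] := h (1, 0); have [i' [j' e2]] := h (0, 1).
have /= a1 := congr1 (@fst int int) e1; have /= a2 := congr1 (@snd int int) e1.
have /= b1 := congr1 (@fst int int) e2; have /= b2 := congr1 (@snd int int) e2.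
rewrite !pairE in a1 a2 b1 b2.
have e : det2 p q * (i * j' - j * i') = 1.
  transitivity ((p.1 * i + q.1 * j) * (p.2 * i' + q.2 * j') -
                (p.2 * i + q.2 * j) * (p.1 * i' + q.1 * j')).
    by rewrite /det2; ring.
  by rewrite -a1 -a2 -b1 -b2.
have /eqP := congr1 absz e; rewrite abszM muln_eq1 => /andP[/eqP e' _].
by rewrite -abszE e'.
Qed.

Hypothesis o_nontrivial : o <> OrderTrivial.

Lemma nonneg_level g : nonneg o g -> 0 <= g.1.
Proof. by move: o_nontrivial; case: o => //=; lia. Qed.

Local Notation base1 s k := (minbase o (nash_seq s k)).1.
Local Notation base2 s k := (minbase o (nash_seq s k)).2.

Lemma nash_seq_level s k g : admissible s -> g \in nash_seq s k -> 0 <= g.1.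
Proof. by move=> /(nash_seq_admissible k) [_ h] /h /nonneg_level. Qed.

Lemma nash_seq_sub1 s k g : g \in nash_seq s k -> det2 g (base2 s k) != 0 ->
  g - base1 s k \in nash_seq s k.+1.
Proof. by move=> gs d; apply/nash_exponentsP; apply: Or32; rewrite subrK. Qed.

Lemma nash_seq_sub2 s k g : g \in nash_seq s k -> det2 (base1 s k) g != 0 ->
  g - base2 s k \in nash_seq s k.+1.
Proof. by move=> gs d; apply/nash_exponentsP; apply: Or33; rewrite subrK. Qed.

Definition base_level s k := (base1 s k).1 + (base2 s k).1.

Lemma base_level_ge0 s k : admissible s -> 0 <= base_level s k.
Proof.
move=> adm; have [ps qs _ _ _] := minbaseP o (nash_seq_admissible k adm).1.
by rewrite addr_ge0 //; apply: nash_seq_level adm _; [exact: ps|exact: qs].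
Qed.

(** The old base is still available at the next step, so it competes in the new minimization. *)
Lemma base_level_decr s k : admissible s -> base_level s k.+1 <= base_level s k.
Proof.
move=> adm; have [ps qs d _ _] := minbaseP o (nash_seq_admissible k adm).1.
have [_ _ _ _ min] := minbaseP o (nash_seq_admissible k.+1 adm).1.
have := nonneg_level (min _ _ (nash_seq_sub (leqnSn k) ps) (nash_seq_sub (leqnSn k) qs) d).
by rewrite !pairE /base_level; lia.
Qed.

(* By the Plücker relation two bases can be exchanged element by element;
   the differences are exponents of level 0. *)
Lemma minbase_constant s : admissible s ->
  (forall k, base_level s k = base_level s 0) ->
  (forall k g, g \in nash_seq s k -> g.1 = 0 -> g = 0) ->
  forall k, (base1 s k = base1 s 0 /\ base2 s k = base2 s 0) \/
            (base1 s k = base2 s 0 /\ base2 s k = base1 s 0).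
Proof.
move=> adm cst nz k.
have [p0s q0s d0 _ _] := minbaseP o (nash_seq_admissible 0 adm).1.
have [ps qs d _ _] := minbaseP o (nash_seq_admissible k adm).1.
move: (cst k); rewrite /base_level.
have {}p0s := nash_seq_sub (leq0n k) p0s; have {}q0s := nash_seq_sub (leq0n k) q0s.
have A1 := nash_seq_sub1 p0s; have A2 := nash_seq_sub2 q0s.
have B1 := nash_seq_sub1 q0s; have B2 := nash_seq_sub2 p0s.
move: d0 d A1 A2 B1 B2.
set p0 := base1 s 0; set q0 := base2 s 0; set p := base1 s k; set q := base2 s k.
move=> d0 d A1 A2 B1 B2 lev.
have lv x : x \in nash_seq s k.+1 -> 0 <= x.1 by apply: nash_seq_level.
have plucker : det2 p0 q0 * det2 p q = det2 p0 q * det2 p q0 + det2 p p0 * det2 q q0.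
  by rewrite /det2; ring.
have [e1|n1] := eqVneq (det2 p0 q * det2 p q0) 0; last first.
  left; move: n1; rewrite mulf_eq0 negb_or => /andP[/A1 a /A2 b].
  have := lv _ a; have := lv _ b; rewrite !pairE => l1 l2.
  have /(nz _ _ a)/eqP : (p0 - p).1 = 0 by rewrite pairE; lia.
  have /(nz _ _ b)/eqP : (q0 - q).1 = 0 by rewrite pairE; lia.
  by rewrite !subr_eq0 => /eqP-> /eqP->.
right; have : det2 p p0 * det2 q0 q != 0.
  have := mulf_neq0 d0 d; rewrite plucker e1 add0r !mulf_eq0.
  by rewrite [det2 q0 q](_ : _ = - det2 q q0) ?oppr_eq0 // /det2; ring.
rewrite mulf_eq0 negb_or => /andP[/B2 a /B1 b].
have := lv _ a; have := lv _ b; rewrite !pairE => l1 l2.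
have /(nz _ _ a)/eqP : (p0 - q).1 = 0 by rewrite pairE; lia.
have /(nz _ _ b)/eqP : (q0 - p).1 = 0 by rewrite pairE; lia.
by rewrite !subr_eq0 => /eqP-> /eqP->.
Qed.

(** The base vectors have positive level and never change, so subtracting them lowers the level of
    any exponent independent of one of them, and the descent stops only at 0. Every exponent is thus
    a combination of the base with natural coefficients, and spanning makes the base unimodular. *)
Lemma smooth_of_positive_levels s : admissible s ->
  (forall k, base_level s k = base_level s 0) ->
  (forall k g, g \in nash_seq s k -> g.1 = 0 -> g = 0) ->
  smooth_exponents o s.
Proof.
move=> adm cst nz; have bc := minbase_constant adm cst nz.
have [p0s q0s d0 _ _] := minbaseP o (nash_seq_admissible 0 adm).1.
have A1 k g : g \in nash_seq s k -> det2 g (base2 s 0) != 0 ->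
    g - base1 s 0 \in nash_seq s k.+1.
  move=> gs dg; case: (bc k) => [[<- e]|[e1 <-]].
    by apply: nash_seq_sub1; rewrite ?e.
  by apply: nash_seq_sub2 => //; rewrite e1; move: dg; rewrite /det2; lia.
have A2 k g : g \in nash_seq s k -> det2 (base1 s 0) g != 0 ->
    g - base2 s 0 \in nash_seq s k.+1.
  move=> gs dg; case: (bc k) => [[e <-]|[<- e2]].
    by apply: nash_seq_sub2; rewrite ?e.
  by apply: nash_seq_sub1 => //; rewrite e2; move: dg; rewrite /det2; lia.
move: d0 A1 A2 (p0s : base1 s 0 \in s) (q0s : base2 s 0 \in s).
set p := base1 s 0; set q := base2 s 0 => d A1 A2 ps qs.
have gt0 g : g \in s -> g != 0 -> 0 < g.1.
  move=> gs; rewrite lt_def (nonneg_level (adm.2 _ gs)) andbT.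
  by move=> g0; apply: contraNneq g0 => /(nz 0%N g gs) ->.
have [p0 q0] : p != 0 /\ q != 0.
  by split; rewrite pair_eq0; move: d; rewrite /det2; clear; nia.
have {p0}p_gt0 := gt0 _ ps p0; have {q0}q_gt0 := gt0 _ qs q0.
(* The step [k] stays free in the induction, because the difference is an exponent one step
   later. *)
have comb n : forall k g, g \in nash_seq s k -> g.1 < n%:Z ->
    exists i j : nat, g = p *~ i%:Z + q *~ j%:Z.
  elim: n => [|n IH] k g gs gn.
    by have := nash_seq_level adm gs; lia.
  have [dq|dq] := eqVneq (det2 g q) 0; last first.
    have [|i [j e]] := IH k.+1 _ (A1 k g gs dq); first by rewrite pairE; lia.
    by exists i.+1, j; rewrite -[g](subrK p) e intS mulrzDr mulr1z; ring.
  have [dp|dp] := eqVneq (det2 p g) 0; last first.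
    have [|i [j e]] := IH k.+1 _ (A2 k g gs dp); first by rewrite pairE; lia.
    by exists i, j.+1; rewrite -[g](subrK q) e intS mulrzDr mulr1z; ring.
  (* An exponent dependent on [p] and on [q] is 0, by Cramer's rule. *)
  exists 0%N, 0%N; rewrite !mulr0z addr0; apply/eqP; rewrite pair_eq0.
  have e1 : g.1 * det2 p q = p.1 * det2 g q + q.1 * det2 p g by rewrite /det2; ring.
  have e2 : g.2 * det2 p q = p.2 * det2 g q + q.2 * det2 p g by rewrite /det2; ring.
  move/eqP: e1; move/eqP: e2; rewrite dq dp !mulr0 addr0 !mulf_eq0 (negPf d) !orbF.
  by move=> -> ->.
have combs g : g \in s -> exists i j : nat, g = p *~ i%:Z + q *~ j%:Z.
  by move=> gs; apply: (comb (`|g.1|%N.+1) 0%N) => //; lia.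
exists p, q; split; [|exact: adm.2|exact: adm.2| |by move=> *; split; left].
- apply: basis_of_spans => x; apply: (admissible_ind (H := fun x => exists i j : int, x = p *~ i + q *~ j) adm);
    last first.
    by move=> g /combs[i [j e]]; exists i, j.
  split; first by exists 0, 0; rewrite !mulr0z addr0.
  move=> _ _ [i [j ->]] [i' [j' ->]]; exists (i - i'), (j - j').
  by rewrite !mulrzBr; ring.
- by move=> g /combs[i [j e]]; exists i, j; split; [|left|left].
Qed.

Definition stable_level s : Prop :=
  [/\ admissible s, forall k, base_level s k = base_level s 0
    & exists g, [/\ g \in s, g != 0 & g.1 = 0]].

Lemma stable_level_shift s j : stable_level s -> stable_level (nash_seq s j).
Proof.
move=> [adm cst [g [gs g0 g1]]]; split.
- exact: nash_seq_admissible.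
- by move=> k; rewrite /base_level -!nash_seqD -!/(base_level _ _) !cst.
- by exists g; split=> //; apply: (nash_seq_sub (leq0n j)).
Qed.

(** An exponent of level 0 can replace one of the two base vectors; by minimality the vector
    replaced has level 0, and the ordering inside the base then gives level 0 to the first one. *)
Lemma stable_base_in s k : stable_level s ->
  [/\ base1 s k \in nash_seq s k, base2 s k \in nash_seq s k,
      det2 (base1 s k) (base2 s k) != 0, (base1 s k).1 = 0 & 0 < (base2 s k).1].
Proof.
move=> [adm cst [g [gs g0 g1]]].
have [ps qs d le min] := minbaseP o (nash_seq_admissible k adm).1.
have {}gs := nash_seq_sub (leq0n k) gs.
have p0 : (base1 s k).1 = 0.
  have pn := nash_seq_level adm ps; have qn := nash_seq_level adm qs.
  have [dq|dq] := eqVneq (det2 g (base2 s k)) 0; last first.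
    by have := nonneg_level (min _ _ gs qs dq); rewrite !pairE g1; lia.
  have dp : det2 (base1 s k) g != 0.
    move: dq g0 d; rewrite pair_eq0 /det2 g1 eqxx mul0r sub0r mulr0 subr0 /=.
    move=> /eqP; rewrite oppr_eq0 mulf_eq0 => /orP[->//|/eqP ->] g2.
    by rewrite mulr0 subr0 !mulf_eq0 !negb_or g2 andbT => /andP[].
  by have := nonneg_level (min _ _ ps gs dp); rewrite !pairE g1; lia.
split => //; rewrite lt_def (nash_seq_level adm qs) andbT.
by move: d; rewrite /det2 p0; apply: contraNneq => ->; apply/eqP; ring.
Qed.

(** The level c of the second base vector is the same at all steps, and it can be subtracted from
    the level of any exponent of non-zero level, since such an exponent is independent of the first
    base vector. All levels are therefore multiples of c, and spanning forces c = 1. *)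
Lemma stable_base2_level s k : stable_level s -> (base2 s k).1 = 1.
Proof.
move=> st; have [adm cst _] := st.
have lev j : (base2 s j).1 = (base2 s k).1.
  have := cst j; have := cst k; rewrite /base_level.
  by case: (stable_base_in j st) (stable_base_in k st) => _ _ _ -> _ [_ _ _ -> _]; lia.
have [_ _ _ _ c_gt0] := stable_base_in k st.
set c := (base2 s k).1 in lev c_gt0 *.
have div n : forall j g, g \in nash_seq s j -> g.1 < n%:Z -> exists z, g.1 = c * z.
  elim: n => [|n IH] j g gs gn.
    by have := nash_seq_level adm gs; lia.
  have [g0|g0] := eqVneq g.1 0; first by exists 0; rewrite mulr0.
  have [_ _ d p0 _] := stable_base_in j st.
  have dp : det2 (base1 s j) g != 0.
    by move: d; rewrite /det2 p0 !mul0r !sub0r !oppr_eq0 !mulf_eq0 (negPf g0) orbF => /norP[].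
  have [|z] := IH j.+1 _ (nash_seq_sub2 gs dp); first by rewrite pairE lev; lia.
  by rewrite pairE lev => e; exists (z + 1); lia.
have [z] : exists z, ((1, 0) : int * int).1 = c * z.
  apply: (admissible_ind (H := fun x : int * int => exists z, x.1 = c * z) adm).
    split; first by exists 0; rewrite mulr0.
    by move=> x y [a ea] [b eb]; exists (a - b); rewrite pairE ea eb mulrBr.
  move=> g gs; apply: (div (`|g.1|%N.+1) 0%N); [exact: gs|lia].
move=> /(congr1 absz)/esym/eqP; rewrite abszM muln_eq1 => /andP[/eqP e _].
by move: c_gt0 e; clearbody c; clear; lia.
Qed.

(* Modulo the first base vector of level 1, every exponent of the sequence
   descends to level 0 by subtracting vectors of level 1. *)
Lemma level0_generated s : stable_level s -> exists K, forall k, (K <= k)%N ->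
  forall H, subgroup H -> (forall g, g \in nash_seq s k -> g.1 = 0 -> H g) ->
  forall g, g.1 = 0 -> H g.
Proof.
move=> st; have [adm _ _] := st.
have [n hn] : exists n : nat, forall g, g \in s -> g.1 < n%:Z.
  elim: (s) => [|x l [n IH]]; first by exists 0%N.
  exists (maxn n `|x.1|.+1) => g; rewrite inE => /predU1P[->|/IH]; lia.
(* An exponent of level m uses m steps to reach level 0, and the levels in [s] are below [n]. *)
exists n.+1 => k Kk H sH Hk g g0.
set q := base2 s 0; have q1 : q.1 = 1 by apply: stable_base2_level.
have desc m : forall j x, (m + j < k)%N -> x \in nash_seq s j -> x.1 = m%:Z ->
    H (x - q *~ m).
  elim: m => [|m IH] j x mj xs x1.
    by rewrite mulr0z subr0; apply: Hk x1; apply: nash_seq_sub xs; lia.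
  have [qjs _] : base2 s j \in nash_seq s j /\ True by case: (stable_base_in j st).
  have [_ _ d p0 _] := stable_base_in j st.
  have dx y : y.1 != 0 -> det2 (base1 s j) y != 0.
    move=> y0; move: d; rewrite /det2 p0 !mul0r !sub0r !oppr_eq0 !mulf_eq0 (negPf y0) orbF.
    by case/norP.
  have qs : q \in nash_seq s j.
    by apply: (nash_seq_sub (leq0n j)); case: (stable_base_in 0 st).
  have h1 := IH j.+1 _ _ (nash_seq_sub2 xs (dx x _)).
  have h2 := nash_seq_sub2 qs (dx q _).
  (* The vector subtracted at step [j] is [base2 s j] and not [q]; the two differ by an exponent of
     level 0, which lies in H. *)
  have -> : x - q *~ m.+1 = (x - base2 s j - q *~ m) - (q - base2 s j).
    by rewrite -addn1 PoszD mulrzDr mulr1z; ring.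
  apply: sH.2; first by apply: h1; rewrite ?pairE ?(stable_base2_level j st) ?x1; lia.
  apply: Hk; last by rewrite pairE q1 (stable_base2_level j st).
  by apply: (@nash_seq_sub s j.+1); [lia | apply: h2; rewrite q1].
suff : H (g - q *~ g.1) by rewrite g0 mulr0z subr0.
apply: (admissible_ind (H := fun g : int * int => H (g - q *~ g.1)) adm).
  split; first by rewrite mulr0z subrr; case: sH.
  move=> x y hx hy; rewrite pairE mulrzBr.
  have := sH.2 _ _ hx hy; congr (H _); ring.
move=> x xs; have x0 := nash_seq_level (k := 0) adm xs.
have e : x.1 = `|x.1|%N :> int by lia.
rewrite e; apply: (desc _ 0%N) => //; have := hn x xs; lia.
Qed.

(** Level 0 now means value 0, so the monomial of (0, 1) is a unit: it may appear with any power,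
    and it only has to be generated by the exponents of level 0. *)
Lemma smooth_of_level0_first s : o = OrderFirst -> stable_level s ->
  exists k, smooth_exponents o (nash_seq s k).
Proof.
move=> oE st; have [adm _ _] := st; have [K hK] := level0_generated st; exists K.
have q1 := stable_base2_level K st; have [_ qs _ _ _] := stable_base_in K st.
have nullE g : null o g = (g.1 == 0) by rewrite /null oE /= ?pairE; lia.
exists (0, 1), (base2 s K); split.
- by rewrite /det2 q1 /=; lia.
- by rewrite oE.
- exact: (nash_seq_admissible K adm).2 qs.
- move=> g gs; exists (g.2 - g.1 * (base2 s K).2), g.1; split.
  + by apply: pair_ext; rewrite !pairE /= ?q1; ring.
  + by right; rewrite nullE.
  + by left; apply: nash_seq_level adm gs.
- move=> H sH h; split; last by left.
  right; apply: (hK K) => // g gs g1; apply: h => //; by rewrite nullE g1.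
Qed.

Lemma nash_seqSP s k g : g \in nash_seq s k.+1 ->
  [\/ g \in nash_seq s k,
      g + base1 s k \in nash_seq s k /\ det2 (g + base1 s k) (base2 s k) != 0
    | g + base2 s k \in nash_seq s k /\ det2 (base1 s k) (g + base2 s k) != 0].
Proof. by move/nash_exponentsP. Qed.
(** New exponents arise by subtracting vectors of non-negative level, so the largest level never
    grows. *)
Lemma level_bound s : admissible s -> exists n : nat,
  forall k g, g \in nash_seq s k -> g.1 < n%:Z.
Proof.
move=> adm.
have [n hn] : exists n : nat, forall g, g \in s -> g.1 < n%:Z.
  elim: (s) => [|x l [n IH]]; first by exists 0%N.
  exists (maxn n `|x.1|.+1) => g; rewrite inE => /predU1P[->|/IH]; lia.
exists n; elim=> [|k IH] g; first exact: hn.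
have [ps qs _ _ _] := minbaseP o (nash_seq_admissible k adm).1.
have := nash_seq_level adm ps; have := nash_seq_level adm qs => q0 p0.
case/nash_seqSP => [/IH//|[/IH + _]|[/IH + _]]; rewrite pairE; lia.
Qed.

Hypothesis o_lex : o = OrderLex.

(** Euclid's algorithm inside level 0: the height of the first base vector is the least positive one
    there and never increases; once constant, it divides the heights of all exponents of level 0. As
    these generate level 0, it is 1. *)
Lemma lex_unit_base s : stable_level s -> exists K, forall k, (K <= k)%N ->
  base1 s k = (0, 1).
Proof.
move=> st; have [adm cst _] := st.
pose mu k := (base1 s k).2.
have lex_level0 g : nonneg o g -> g.1 = 0 -> 0 <= g.2 by rewrite o_lex /=; lia.
have mu_gt0 k : 0 < mu k.
  have [ps _ d p0 _] := stable_base_in k st.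
  have := lex_level0 _ ((nash_seq_admissible k adm).2 _ ps) p0; rewrite le_eqVlt.
  case/predU1P => // e; move: d; rewrite /det2 p0 -e.
  by rewrite !mul0r subrr eqxx.
have det_level0 k g : g.1 = 0 -> g.2 != 0 -> det2 g (base2 s k) != 0.
  by move=> g1 g2; rewrite /det2 g1 mul0r sub0r (stable_base2_level k st) mulr1 oppr_eq0.
have mu_min k g : g \in nash_seq s k -> g.1 = 0 -> g.2 != 0 -> mu k <= g.2.
  move=> gs g1 g2; have [ps qs d _ min] := minbaseP o (nash_seq_admissible k adm).1.
  have := lex_level0 _ (min _ _ gs qs (det_level0 k g g1 g2)); rewrite !pairE g1.
  have [_ _ _ -> _] := stable_base_in k st; rewrite /mu; lia.
have [|k|K hK] := @nonincreasing_int_stable mu; first by move=> k; apply/ltW.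
  have [ps _ _ p0 _] := stable_base_in k st.
  by apply: mu_min; [apply: nash_seq_sub ps | | rewrite gt_eqF // mu_gt0].
have div n : forall k g, (K <= k)%N -> g \in nash_seq s k -> g.1 = 0 -> g.2 < n%:Z ->
    exists z, g.2 = mu K * z.
  elim: n => [|n IH] k g Kk gs g1 gn.
    by have := lex_level0 _ ((nash_seq_admissible k adm).2 _ gs) g1; lia.
  have [g0|g0] := eqVneq g.2 0; first by exists 0; rewrite mulr0.
  have [_ _ _ p0 _] := stable_base_in k st.
  have [||z] := IH k.+1 _ (leqW Kk) (nash_seq_sub1 gs (det_level0 k g g1 g0)).
  - by rewrite pairE g1 p0.
  - by rewrite pairE -/(mu k); have := mu_gt0 k; lia.
  - by rewrite pairE -/(mu k) hK // => e; exists (z + 1); lia.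
have [K' hK'] := level0_generated st.
have [z] : exists z, ((0, 1) : int * int).2 = mu K * z.
  apply: (hK' (maxn K K') _ (fun x : int * int => exists z, x.2 = mu K * z)) => //.
  - exact: leq_maxr.
  - split; first by exists 0; rewrite mulr0.
    by move=> x y [a ea] [b eb]; exists (a - b); rewrite pairE ea eb mulrBr.
  - move=> g gs g1; apply: (div (`|g.2|%N.+1) (maxn K K')) => //; first exact: leq_maxl.
    by lia.
move=> /(congr1 absz)/esym/eqP; rewrite abszM muln_eq1 => /andP[/eqP e _].
exists K => k Kk; have [_ _ _ p0 _] := stable_base_in k st.
apply: pair_ext => //=; rewrite -/(mu k).
by move: (hK k Kk) (mu_gt0 k) e; clear; lia.
Qed.

(** * Lexicographic order: descent on the levels *)

Section LexDescent.
Variable s : seq (int * int).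
Hypotheses (st : stable_level s) (unit_base : forall k, base1 s k = (0, 1)).

Let adm : admissible s. Proof. by case: st. Qed.

Let f k := (base2 s k).2.

(* coordinate of [g] along (0, 1) in the basis [base1 s k], [base2 s k] *)
Let b k (g : int * int) := g.2 - g.1 * f k.

Let base2E k : base2 s k = (1, f k).
Proof. by apply: pair_ext => //=; apply: stable_base2_level. Qed.

Let f_min k g : g \in nash_seq s k -> g.1 = 1 -> f k <= g.2.
Proof.
move=> gs g1; have [ps qs _ _ min] := minbaseP o (nash_seq_admissible k adm).1.
have := min _ _ ps gs; rewrite unit_base base2E /det2 /= g1 mul0r mul1r => /(_ isT).
by rewrite o_lex /nonneg !pairE /= g1; lia.
Qed.

Let f_decr k j : (k <= j)%N -> f j <= f k.
Proof.
move=> kj; have [_ qs _ _ _] := stable_base_in k st.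
by apply: (f_min (nash_seq_sub kj qs)); rewrite stable_base2_level.
Qed.

Let sub_base2 k g : g \in nash_seq s k -> g.1 != 0 -> g - (1, f k) \in nash_seq s k.+1.
Proof.
move=> gs g1; rewrite -base2E; apply: nash_seq_sub2 => //.
by rewrite unit_base /det2 /= mul0r mul1r sub0r oppr_eq0.
Qed.

Let nextP k g : g \in nash_seq s k.+1 ->
  [\/ g \in nash_seq s k,
      g + (0, 1) \in nash_seq s k /\ b k (g + (0, 1)) != 0
    | g + (1, f k) \in nash_seq s k].
Proof.
move/nash_seqSP; rewrite unit_base base2E /b /det2 !pairE /=.
case=> [h|[h d]|[h _]]; [exact: Or31| |exact: Or33].
by apply: Or32; split=> //; move: d; lia.
Qed.

Section Level.
Variables (m : nat) (K : nat).
Hypotheses (m_gt1 : (1 < m)%N)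
  (above : forall k g, (K <= k)%N -> g \in nash_seq s k -> m.+1%:Z <= g.1 -> 0 <= b k g).

Let above_sub k g : (K <= k)%N -> g + (1, f k) \in nash_seq s k -> g.1 = m%:Z ->
  0 <= b k g.
Proof.
by move=> Kk gs g1; have := above Kk gs; rewrite /b !pairE /= g1; lia.
Qed.

(** A new exponent of level m comes either from level m by subtracting (0, 1), which happens only
    where [b] is non-zero and so keeps it non-negative, or from level m + 1 by subtracting (1, f k),
    which does not change [b]. A drop of [f] only increases [b]. *)
Lemma nonneg_persists k : (K <= k)%N ->
  (forall g, g \in nash_seq s k -> g.1 = m%:Z -> 0 <= b k g) ->
  forall j g, g \in nash_seq s (j + k) -> g.1 = m%:Z -> 0 <= b (j + k) g.
Proof.
move=> Kk h; elim=> [|j IH] g gs g1; first exact: h.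
have drop := f_decr (leqnSn (j + k)).
suff : 0 <= b (j + k) g by rewrite /b addSn g1; nia.
case/(@nextP (j + k)): gs => [gs|[gs]|gs]; first exact: IH.
  by have := IH _ gs; rewrite /b !pairE /= addr0 g1; lia.
by apply: above_sub => //; lia.
Qed.

(** A step costs at most 1 in [b], through the subtraction of (0, 1), while a drop of [f] by delta
    raises [b] by m * delta at level m. The first alternative accounts for the exponents that come
    down from level m + 1. *)
Lemma deficit_bound k (c : nat) : (K <= k)%N ->
  (forall g, g \in nash_seq s k -> g.1 = m%:Z -> - c%:Z <= b k g) ->
  forall j g, g \in nash_seq s (j + k) -> g.1 = m%:Z ->
    0 <= b (j + k) g \/ m%:Z * (f k - f (j + k)) - c%:Z - j%:Z <= b (j + k) g.
Proof.
move=> Kk h; elim=> [|j IH] g gs g1.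
  by right; rewrite subrr mulr0 sub0r subr0; apply: h.
have drop := f_decr (leqnSn (j + k)).
have bE : b (j.+1 + k) g = b (j + k) g + m%:Z * (f (j + k) - f (j.+1 + k)).
  by rewrite /b g1; ring.
suff : 0 <= b (j + k) g \/ m%:Z * (f k - f (j + k)) - c%:Z - j.+1%:Z <= b (j + k) g.
  rewrite bE addSn; set x := b _ _; set y := f k; set z := f (j + k) in drop *.
  set t := f _ in drop *; clearbody x y z t; clear -drop => -[h|h]; [left|right]; nia.
case/(@nextP (j + k)): gs => [gs|[gs]|gs].
- by case: (IH _ gs g1) => ?; [left|right]; lia.
- by have := IH _ gs; rewrite /b !pairE /= addr0 g1; lia.
- by left; apply: above_sub => //; lia.
Qed.

(* If [f] did not drop, [m - 1] subtractions of (1, f k) would bring [g] to an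
   exponent of level 1 below the minimum. *)
Lemma deficit_forces_drop k g : g \in nash_seq s k -> g.1 = m%:Z -> b k g < 0 ->
  f (m.-1 + k) < f k.
Proof.
move=> gs g1 bneg; rewrite ltNge; apply/negP => nodrop.
have cst i : (i < m)%N -> f (i + k) = f k.
  move=> im; apply/eqP; rewrite eq_le f_decr ?leq_addl //=.
  by apply: le_trans nodrop _; apply: f_decr; lia.
have desc i : (i < m)%N -> g - (1, f k) *~ i \in nash_seq s (i + k).
  elim: i => [|i IH] im; first by rewrite mulr0z subr0.
  have := sub_base2 (IH (ltnW im)); rewrite cst; last exact: ltnW.
  rewrite (_ : _ - _ - _ = g - (1, f k) *~ i.+1); last first.
    by rewrite -addn1 PoszD mulrzDr mulr1z; ring.
  by apply; rewrite !pairE /= g1; lia.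
have m1 : (m.-1 < m)%N by lia.
have := f_min (desc _ m1); rewrite !pairE /= cst // g1.
by move: bneg; rewrite /b g1; nia.
Qed.

(** Induction on the deficit c: as long as some exponent of level m is negative, [f] drops within m
    - 1 steps, which gains at least m against a loss of at most m - 1. *)
Lemma level_eventually_nonneg : exists K', (K <= K')%N /\
  forall k g, (K' <= k)%N -> g \in nash_seq s k -> g.1 = m%:Z -> 0 <= b k g.
Proof.
have [c hc] : exists c : nat, forall g, g \in nash_seq s K -> g.1 = m%:Z -> - c%:Z <= b K g.
  elim: (nash_seq s K) => [|x l [c IH]]; first by exists 0%N.
  exists (maxn c `|b K x|) => g; rewrite inE => /predU1P[->|/IH h g1]; first by lia.
  by have := h g1; lia.
suff H k : (K <= k)%N ->
    (forall g, g \in nash_seq s k -> g.1 = m%:Z -> - c%:Z <= b k g) ->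
    exists K', (K <= K')%N /\
    (forall k g, (K' <= k)%N -> g \in nash_seq s k -> g.1 = m%:Z -> 0 <= b k g).
  exact: (H K (leqnn K) hc).
clear hc; elim: c k => [|c IH] k Kk hk.
  exists k; split=> // j g kj; rewrite -(subnK kj); apply: nonneg_persists => //.
have [[g [gs g1 bneg]]|nneg] :=
  pselect (exists g, [/\ g \in nash_seq s k, g.1 = m%:Z & b k g < 0]); last first.
  apply: (IH k) => // g gs g1; have [|h] := leP 0 (b k g); first lia.
  by case: nneg; exists g.
have drop := deficit_forces_drop gs g1 bneg.
apply: (IH (m.-1 + k)%N) => [|h hs h1]; first by lia.
case: (deficit_bound Kk hk hs h1); first by lia.
by move: m_gt1; nia.
Qed.
End Level.

(** Descending induction on the level, starting above the uniform bound. Level 0 is settled by the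
    order itself and level 1 by the minimality of [f]. *)
Lemma lex_eventually_nonneg : exists k, forall g, g \in nash_seq s k -> 0 <= b k g.
Proof.
have [n hn] := level_bound adm.
have H (d : nat) : exists K, forall k g, (K <= k)%N -> g \in nash_seq s k ->
    n%:Z - d%:Z <= g.1 -> 0 <= b k g.
  elim: d => [|d [K hK]].
    by exists 0%N => k g _ /hn; lia.
  have [m_le1|m_gt1] := leqP (n - d.+1)%N 1; last first.
    have [|K' [KK' hK']] := @level_eventually_nonneg (n - d.+1)%N K m_gt1.
      by move=> k g Kk gs h; apply: hK => //; lia.
    exists K' => k g Kk gs gn.
    have [e|e] := eqVneq g.1 (n - d.+1)%N; first exact: hK'.
    by apply: hK => //; lia.
  exists K => k g Kk gs gn; have g0 := nash_seq_level adm gs.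
  have [g1|g1] := eqVneq g.1 0.
    by have := (nash_seq_admissible k adm).2 _ gs; rewrite o_lex /b /= g1; lia.
  have [g2|g2] := eqVneq g.1 1.
    by have := f_min gs g2; rewrite /b g2; lia.
  by apply: hK => //; lia.
have [K hK] := H n; exists K => g gs; apply: (hK K) => //.
by have := nash_seq_level adm gs; lia.
Qed.

Lemma smooth_of_level0_lex : exists k, smooth_exponents o (nash_seq s k).
Proof.
have [k hk] := lex_eventually_nonneg; exists k.
have [ps qs d _ _] := stable_base_in k st.
have [_ nn] := nash_seq_admissible k adm.
exists (base1 s k), (base2 s k); split.
- by rewrite unit_base base2E /det2 /=; lia.
- exact: nn.
- exact: nn.
- move=> g gs; exists (b k g), g.1; split.
  + by rewrite unit_base base2E; apply: pair_ext; rewrite !pairE /= /b; ring.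
  + by left; apply: hk.
  + by left; apply: nash_seq_level adm gs.
- by move=> *; split; left.
Qed.
End LexDescent.
End NashSequence.

(** Once the base level is constant, either a non-zero exponent of level 0 appears at some step, and
    the hypothesis applies from there on, or none ever does and the exponents are already smooth. *)
Lemma smooth_of_stable o s : o <> OrderTrivial ->
  (forall s', stable_level o s' -> exists k, smooth_exponents o (nash_seq o s' k)) ->
  admissible o s -> exists k, smooth_exponents o (nash_seq o s k).
Proof.
move=> oN h adm.
have [K hK] := nonincreasing_int_stable
  (fun k => base_level_ge0 oN k adm) (fun k => base_level_decr oN k adm).
have admK := nash_seq_admissible K adm.
have cst k : base_level o (nash_seq o s K) k = base_level o (nash_seq o s K) 0.
  by rewrite /base_level -!nash_seqD -!/(base_level _ _ _) !hK // leq_addl.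
have [[j [g [gs g0 g1]]]|nz] := pselect (exists k g,
    [/\ g \in nash_seq o (nash_seq o s K) k, g != 0 & g.1 = 0]).
  have [|k hk] := h (nash_seq o (nash_seq o s K) j).
    split; first exact: nash_seq_admissible.
      by move=> k; rewrite /base_level -!nash_seqD -!/(base_level _ _ _) !hK //; lia.
    by exists g.
  by exists (k + (j + K))%N; rewrite !nash_seqD.
exists K; apply: smooth_of_positive_levels => // k g gs g1.
by apply/eqP/negPn/negP => g0; case: nz; exists k, g.
Qed.

Theorem nash_seq_smooth o s : admissible o s ->
  exists k, smooth_exponents o (nash_seq o s k).
Proof.
case oE : o => adm.
(* All monomials have value 0 here, so any basis of Z^2 works, and H is everything by spanning. *)
- exists 0%N, (1, 0), (0, 1); split=> //.
    move=> g _; exists g.1, g.2; split; [|by right|by right].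
    by apply: pair_ext; rewrite !pairE /=; ring.
  by move=> H sH h; split; right; apply: (admissible_ind (H := H) adm) => // g gs; apply: h.
- by apply: smooth_of_stable => // s' st; apply: smooth_of_level0_first.
- apply: smooth_of_stable => // s' st; have oN : OrderLex <> OrderTrivial by [].
  have [K hK] := lex_unit_base oN erefl st.
  have [|k hk] := smooth_of_level0_lex oN erefl (stable_level_shift K st).
    by move=> k; rewrite -nash_seqD hK // leq_addl.
  by exists (k + K)%N; rewrite nash_seqD.
Qed.

(** * Subrings of a field, Noetherianity and regularity *)

Section Subrings.
Variable K : fieldType.
Implicit Types (A B I : K -> Prop) (s : seq K) (p q : {poly K}).

Definition subring A : Prop :=
  [/\ A 1, forall x y, A x -> A y -> A (x - y) & forall x y, A x -> A y -> A (x * y)].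

Lemma subring0 A : subring A -> A 0.
Proof. by move=> [A1 AB _]; rewrite -(subrr 1); apply: AB. Qed.

Lemma subringN A x : subring A -> A x -> A (- x).
Proof. by move=> rA Ax; rewrite -sub0r; case: (rA) => _ AB _; apply: AB => //; apply: subring0. Qed.

Lemma subringD A x y : subring A -> A x -> A y -> A (x + y).
Proof. by move=> rA Ax Ay; rewrite -[y]opprK; case: (rA) => _ AB _; apply: AB => //; apply: subringN. Qed.

Lemma subringX A x n : subring A -> A x -> A (x ^+ n).
Proof. by move=> [A1 _ AM] Ax; elim: n => // n IH; rewrite exprS; apply: AM. Qed.

Lemma subring_sum A (J : Type) (r : seq J) (F : J -> K) :
  subring A -> (forall i, A (F i)) -> A (\sum_(i <- r) F i).
Proof.
move=> rA AF; elim: r => [|i r IH]; first by rewrite big_nil; apply: subring0.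
by rewrite big_cons; apply: subringD.
Qed.

(** The A-submodule generated by [s], as an intersection, so that induction on membership is a mere
    application. *)
Definition span A s (x : K) : Prop :=
  forall J : K -> Prop, J 0 -> (forall y z, J y -> J z -> J (y + z)) ->
  (forall a y, A a -> J y -> J (a * y)) -> (forall g, g \in s -> J g) -> J x.

Lemma span_mem A s x : x \in s -> span A s x.
Proof. by move=> xs J _ _ _; apply. Qed.

Lemma span0 A s : span A s 0.
Proof. by move=> J. Qed.

Lemma spanD A s x y : span A s x -> span A s y -> span A s (x + y).
Proof. by move=> sx sy J J0 JD JM Js; apply: (JD); [apply: sx | apply: sy]. Qed.

Lemma spanM A s a x : A a -> span A s x -> span A s (a * x).
Proof. by move=> Aa sx J J0 JD JM Js; apply: (JM) => //; apply: sx. Qed.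

Lemma span_sub A s s' x : {subset s <= s'} -> span A s x -> span A s' x.
Proof. by move=> sub sx J J0 JD JM Js; apply: sx => // g /sub/Js. Qed.

Lemma span_ring A B s x : (forall a, A a -> B a) -> span A s x -> span B s x.
Proof. by move=> sub sx J J0 JD JM Js; apply: sx => // a y /sub; apply: JM. Qed.

Lemma span_sum A s x : subring A -> span A s x ->
  exists c : 'I_(size s) -> K, (forall i, A (c i)) /\ x = \sum_(i < size s) c i * s`_i.
Proof.
move=> rA sx; apply: (sx (fun x => exists c : 'I_(size s) -> K,
  (forall i, A (c i)) /\ x = \sum_(i < size s) c i * s`_i)) => {x sx}.
- by exists (fun => 0); split=> [_|]; [apply: subring0 | rewrite big1 // => i _; rewrite mul0r].
- move=> _ _ [c [Ac ->]] [c' [Ac' ->]]; exists (fun i => c i + c' i); split.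
    by move=> i; apply: subringD.
  by rewrite -big_split; apply: eq_bigr => i _; rewrite mulrDl.
- move=> a _ Aa [c [Ac ->]]; exists (fun i => a * c i); split.
    by case: rA => _ _ AM i; apply: AM.
  by rewrite mulr_sumr; apply: eq_bigr => i _; rewrite mulrA.
- move=> g gs; have gi : (index g s < size s)%N by rewrite index_mem.
  exists (fun i => (i == Ordinal gi)%:R); split.
    by move=> i; case: eqP => _; [case: rA | apply: subring0].
  rewrite (bigD1 (Ordinal gi)) //= eqxx mul1r nth_index // big1 ?addr0 // => i /negPf ->.
  by rewrite mul0r.
Qed.

Definition finitely_generated A I : Prop :=
  exists s, (forall g, g \in s -> I g) /\ forall x, I x -> span A s x.

Lemma is_ideal_sum A I (J : Type) (r : seq J) (F : J -> K) :
  is_ideal A I -> (forall i, I (F i)) -> I (\sum_(i <- r) F i).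
Proof.
move=> [_ I0 ID _] IF; elim: r => [|i r IH]; first by rewrite big_nil.
by rewrite big_cons; apply: ID.
Qed.

Lemma noetherianP A : subring A ->
  noetherian A <-> forall I, is_ideal A I -> finitely_generated A I.
Proof.
move=> rA; split=> h I iI.
  have [n [g gen]] := h I iI; exists [seq g i | i : 'I_n]; split.
    move=> _ /mapP[i _ ->]; apply/gen; exists (fun j => (j == i)%:R); split.
      by move=> j; case: eqP => _; [case: rA | apply: subring0].
    by rewrite (bigD1 i) //= eqxx mul1r big1 ?addr0 // => j /negPf ->; rewrite mul0r.
  move=> x /gen[c [Ac ->]]; elim/big_ind: _ => [|*|i _]; [exact: span0 | exact: spanD |].
  by apply: spanM => //; apply: span_mem; rewrite map_f // mem_enum.
have [s [Is gen]] := h I iI; exists (size s), (fun i => s`_i) => x; split.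
  by move=> /gen/(span_sum rA).
move=> [c [Ac ->]]; apply: (is_ideal_sum _ iI) => i.
by case: iI => _ _ _; apply=> //; apply: Is; rewrite mem_nth.
Qed.

Definition coefs_in A p : Prop := forall i, A p`_i.

(** The ring A[t] inside K; when [t] is algebraic over A an element comes from several
    polynomials. *)
Definition adjoin A t x : Prop := exists p, coefs_in A p /\ x = p.[t].

Lemma coefs_inD A p q : subring A -> coefs_in A p -> coefs_in A q -> coefs_in A (p + q).
Proof. by move=> rA hp hq i; rewrite coefD; apply: subringD. Qed.

Lemma coefs_inB A p q : subring A -> coefs_in A p -> coefs_in A q -> coefs_in A (p - q).
Proof. by move=> [_ AB _] hp hq i; rewrite coefB; apply: AB. Qed.

Lemma coefs_inM A p q : subring A -> coefs_in A p -> coefs_in A q -> coefs_in A (p * q).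
Proof.
move=> rA hp hq i; rewrite coefM; apply: subring_sum => // j.
by case: rA => _ _; apply.
Qed.

Lemma coefs_inC A a : subring A -> A a -> coefs_in A a%:P.
Proof. by move=> rA Aa i; rewrite coefC; case: eqP => // _; apply: subring0. Qed.

Lemma coefs_inXn A n : subring A -> coefs_in A 'X^n.
Proof. by move=> rA i; rewrite coefXn; case: eqP => // _; [case: rA | apply: subring0]. Qed.

Lemma coefs_inZ A a p : subring A -> A a -> coefs_in A p -> coefs_in A (a *: p).
Proof. by move=> [_ _ AM] Aa hp i; rewrite coefZ; apply: AM. Qed.

Lemma adjoin_subring A t : subring A -> subring (adjoin A t).
Proof.
move=> rA; split.
- by exists 1%:P; rewrite hornerC; split=> //; apply: coefs_inC => //; case: rA.
- move=> _ _ [p [hp ->]] [q [hq ->]]; exists (p - q).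
  by rewrite hornerD hornerN; split=> //; apply: coefs_inB.
- move=> _ _ [p [hp ->]] [q [hq ->]]; exists (p * q).
  by rewrite hornerM; split=> //; apply: coefs_inM.
Qed.

Lemma adjoin_base A t x : subring A -> A x -> adjoin A t x.
Proof. by move=> rA Ax; exists x%:P; rewrite hornerC; split=> //; apply: coefs_inC. Qed.

Lemma adjoin_gen A t : subring A -> adjoin A t t.
Proof. by move=> rA; exists 'X; rewrite hornerX -['X]expr1; split=> //; apply: coefs_inXn. Qed.

Lemma adjoin_min A B t : subring B -> (forall x, A x -> B x) -> B t ->
  forall x, adjoin A t x -> B x.
Proof.
move=> rB AB Bt _ [p [hp ->]]; rewrite horner_coef; apply: subring_sum => // i.
by case: (rB) => _ _ BM; apply: BM; [apply: AB | apply: subringX].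
Qed.

(** Hilbert's argument on leading coefficients, run on the polynomials whose value at [t] lies in I,
    because an element of A[t] has no degree of its own. *)
Lemma hilbert_basis A t : subring A -> noetherian A -> noetherian (adjoin A t).
Proof.
move=> rA nA; have rAt := adjoin_subring t rA.
apply/(noetherianP rAt) => I [IA I0 ID IM].
have At := adjoin_base t rA.
pose good p := coefs_in A p /\ I p.[t].
have good0 : good 0 by split; [move=> i; rewrite coef0; apply: subring0 | rewrite horner0].
have goodD p q : good p -> good q -> good (p + q).
  by move=> [? ?] [? ?]; split; [apply: coefs_inD | rewrite hornerD; apply: ID].
have goodZ a p : A a -> good p -> good (a *: p).
  by move=> Aa [? ?]; split; [apply: coefs_inZ | rewrite hornerZ; apply: IM => //; apply: At].
have goodB p q : good p -> good q -> good (p - q).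
  move=> gp gq; apply: goodD => //; rewrite -scaleN1r; apply: goodZ => //.
  by apply: subringN => //; case: rA.
have goodXn n p : good p -> good (p * 'X^n).
  move=> [hp Ip]; split; first by apply: coefs_inM => //; apply: coefs_inXn.
  rewrite hornerM hornerXn mulrC; apply: IM => //; apply: subringX => //.
  exact: adjoin_gen.
(* Bounding the size instead of fixing it puts 0 into [L d] and makes it an ideal. *)
pose L d a := exists p, [/\ good p, (size p <= d.+1)%N & p`_d = a].
have L_ideal d : is_ideal A (L d).
  split.
  - by move=> _ [p [[hp _] _ <-]].
  - by exists 0; rewrite size_poly0 coef0.
  - move=> _ _ [p [gp sp <-]] [q [gq sq <-]]; exists (p + q); rewrite coefD; split=> //.
      exact: goodD.
    by rewrite (leq_trans (size_polyD _ _)) // geq_max sp.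
  - move=> a _ Aa [p [gp sp <-]]; exists (a *: p); rewrite coefZ; split=> //.
      exact: goodZ.
    exact: leq_trans (size_scale_leq _ _) sp.
have L_shift n d a : L d a -> L (d + n)%N a.
  move=> [p [gp sp <-]]; exists (p * 'X^n); rewrite coefMXn ltnNge leq_addl addnK.
  split=> //; first exact: goodXn.
  rewrite (leq_trans (size_polyMleq _ _)) // size_polyXn addnS /= -addSn.
  by rewrite leq_add2r.
have L_le d d' a : (d <= d')%N -> L d a -> L d' a.
  by move=> /subnKC <-; apply: L_shift.
have [N L_stable] : exists N, forall d a, L d a -> L N a.
  have Linf : is_ideal A (fun a => exists d, L d a).
    split.
    - by move=> a [d]; case: (L_ideal d) => LA _ _ _ /LA.
    - by exists 0%N; case: (L_ideal 0%N).
    - move=> x y [d Lx] [d' Ly]; exists (maxn d d').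
      case: (L_ideal (maxn d d')) => _ _ LD _; apply: LD.
        exact: L_le (leq_maxl _ _) Lx.
      exact: L_le (leq_maxr _ _) Ly.
    - by move=> a x Aa [d Lx]; exists d; case: (L_ideal d) => _ _ _; apply.
  have [s [Ls gen]] := (noetherianP rA).1 nA _ Linf.
  have [N hN] : exists N, forall g, g \in s -> L N g.
    elim: s Ls {gen} => [|x s IH] Ls; first by exists 0%N.
    have [d Lx] := Ls x (mem_head _ _).
    have [|N hN] := IH; first by move=> g gs; apply: Ls; rewrite inE gs orbT.
    exists (maxn d N) => g; rewrite inE => /predU1P[->|/hN].
      exact: L_le (leq_maxl _ _) Lx.
    exact: L_le (leq_maxr _ _).
  exists N => d a La; have := gen a (ex_intro _ d La); case: (L_ideal N) => _ L0 LD LM.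
  by apply.
(* Low degrees are treated one at a time, each adding generators for one ideal [L d]. *)
have upto d : exists s, (forall g, g \in s -> I g) /\
    forall p, good p -> (size p <= d)%N -> span (adjoin A t) s p.[t].
  elim: d => [|d [s [Is hs]]].
    exists [::]; split=> // p _; rewrite leqn0 size_poly_eq0 => /eqP ->.
    by rewrite horner0; apply: span0.
  have [l [Ll gen]] := (noetherianP rA).1 nA _ (L_ideal d).
  have [G [IG hG]] : exists G : seq K, (forall g, g \in G -> I g) /\ forall a, a \in l ->
      exists p, [/\ good p, (size p <= d.+1)%N, p`_d = a & p.[t] \in G].
    elim: l Ll {gen} => [|a l IH] Ll; first by exists [::].
    have [|G [IG hG]] := IH; first by move=> g gl; apply: Ll; rewrite inE gl orbT.
    have [p [gp sp pa]] := Ll a (mem_head _ _); exists (p.[t] :: G); split.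
      by move=> g; rewrite inE => /predU1P[->|/IG//]; case: gp.
    move=> b; rewrite inE => /predU1P[->|/hG[q [gq sq qb qG]]].
      by exists p; rewrite mem_head.
    by exists q; rewrite inE qG orbT.
  exists (s ++ G); split; first by move=> g; rewrite mem_cat => /orP[/Is|/IG].
  move=> p gp sp.
  have [q [gq sq qd qG]] : exists q,
      [/\ good q, (size q <= d.+1)%N, q`_d = p`_d & span (adjoin A t) G q.[t]].
    apply: (gen p`_d (ex_intro _ p (And3 gp sp erefl)) (fun a => exists q,
      [/\ good q, (size q <= d.+1)%N, q`_d = a & span (adjoin A t) G q.[t]])).
    - by exists 0; rewrite coef0 horner0 size_poly0; split=> //; apply: span0.
    - move=> _ _ [q [gq sq <- qG]] [r [gr sr <- rG]]; exists (q + r).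
      rewrite coefD hornerD; split=> //; [exact: goodD | | exact: spanD].
      by rewrite (leq_trans (size_polyD _ _)) // geq_max sq.
    - move=> a _ Aa [q [gq sq <- qG]]; exists (a *: q); rewrite coefZ hornerZ.
      split=> //; [exact: goodZ | | by apply: spanM => //; apply: At].
      exact: leq_trans (size_scale_leq _ _) sq.
    - by move=> a /hG[q [gq sq qa qG]]; exists q; split=> //; apply: span_mem.
  rewrite -[p](subrK q) hornerD; apply: spanD; last first.
    by apply: span_sub qG => g; rewrite mem_cat orbC => ->.
  apply: (@span_sub _ s) => [g|]; first by rewrite mem_cat => ->.
  apply: hs; first exact: goodB.
  apply/leq_sizeP => j; rewrite leq_eqVlt coefB => /predU1P[<-|dj]; first by rewrite qd subrr.
  by rewrite (leq_sizeP _ _ sp) // (leq_sizeP _ _ sq) // subrr.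
have [s [Is hs]] := upto N.+1; exists s; split=> //.
suff all_deg n p : good p -> (size p <= n)%N -> span (adjoin A t) s p.[t].
  move=> x Ix; have [p [hp px]] := IA x Ix; rewrite px.
  by apply: (all_deg (size p)) => //; split=> //; rewrite -px.
elim: n p => [|n IH] p gp sp; first by apply: hs => //; apply: leq_trans sp _.
have [pN|Np] := leqP (size p) N.+1; first exact: hs.
have Nn : (N <= n)%N by rewrite -ltnS (leq_trans (ltnW Np)).
(* Above degree N the leading term is cancelled by a shifted polynomial of degree at most N with the
   same coefficient. *)
have [q [gq sq qN]] := L_stable n p`_n (ex_intro _ p (And3 gp sp erefl)).
rewrite -[p](subrK (q * 'X^(n - N))) hornerD; apply: spanD; last first.
  rewrite hornerM hornerXn mulrC; apply: spanM; last exact: hs.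
  by apply: subringX => //; apply: adjoin_gen.
apply: IH; first by apply: goodB => //; apply: goodXn.
apply/leq_sizeP => j; rewrite leq_eqVlt coefB coefMXn.
move=> /predU1P[<-|nj]; first by rewrite ltnNge leq_subr subKn // qN subrr.
rewrite (leq_sizeP _ _ sp) // sub0r ltnNge (leq_trans (leq_subr _ _) (ltnW nj)) /=.
by rewrite (leq_sizeP _ _ sq) ?oppr0 //; lia.
Qed.

Definition fractions B (U : K -> Prop) (x : K) : Prop :=
  exists a b, [/\ B a, B b, U b & x = a / b].

(** An ideal of the fractions is generated by its elements in B: multiply by a denominator. *)
Lemma noetherian_fractions B (U : K -> Prop) :
  subring B -> (forall b, U b -> b != 0) -> U 1 ->
  subring (fractions B U) -> noetherian B -> noetherian (fractions B U).
Proof.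
move=> rB U0 U1 rO nB; apply/(noetherianP rO) => I [IO I0 ID IM].
have BO x : B x -> fractions B U x.
  by move=> Bx; exists x, 1; rewrite divr1; split=> //; case: rB.
have [s [Is gen]] : finitely_generated B (fun x => B x /\ I x).
  apply: (noetherianP rB).1 => //; split.
  - by move=> x [].
  - by split=> //; apply: subring0.
  - by move=> x y [? ?] [? ?]; split; [apply: subringD | apply: ID].
  - move=> a x Ba [Bx Ix]; split; first by case: rB => _ _; apply.
    by apply: IM => //; apply: BO.
exists s; split=> [g /Is[]//|x Ix]; have [a [b [Ba Bb Ub xE]]] := IO x Ix.
have b0 := U0 b Ub; rewrite {1}xE mulrC; apply: spanM.
  by exists 1, b; rewrite div1r; split=> //; case: rB.
apply: (span_ring BO); apply: gen; split=> //.
have -> : a = b * x by rewrite xE mulrC divfK.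
by apply: IM => //; apply: BO.
Qed.

(** The variable is divided out of [p] until the constant term is non-zero; as [a] is outside the
    prime Q, each division keeps the value in Q. *)
Lemma prime_step A (T : idomainType) (h : {rmorphism T -> K}) (Q : K -> Prop) a
    (p : {poly T}) :
  subring A -> (forall c, A (h c)) -> is_prime_ideal A Q -> A a -> ~ Q a ->
  p != 0 -> Q (map_poly h p).[a] ->
  exists c y, [/\ c != 0, A y & Q (h c + a * y)].
Proof.
move=> rA Ah [[QA Q0 QD QM] _ Qp] Aa Qa.
have Ap (q : {poly T}) : A (map_poly h q).[a].
  rewrite horner_coef; apply: subring_sum => // i; rewrite coef_map.
  by case: (rA) => _ _ AM; apply: AM; [apply: Ah | apply: subringX].
elim/poly_ind: p => [|p c IH]; first by rewrite eqxx.
have [->|c0] := eqVneq c 0; last first.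
  move=> _; rewrite rmorphD rmorphM /= map_polyX map_polyC hornerD hornerM hornerX hornerC.
  by rewrite addrC mulrC => h0; exists c, (map_poly h p).[a]; split.
rewrite addr0 rmorphM /= map_polyX hornerM hornerX => pX.
case/(Qp _ _ (Ap p) Aa) => // Qpa; apply: IH => //.
by apply: contraNneq pX => ->; rewrite mul0r.
Qed.

(** * Upper bound for the Krull dimension *)

Section Dimension.
Variables (F : fieldType) (h : {rmorphism F -> K}).

Definition eval1 a : {poly F} -> K := horner_eval a \o map_poly h.
HB.instance Definition _ a := GRing.RMorphism.on (eval1 a).
Definition eval2 a b : {poly {poly F}} -> K := horner_eval b \o map_poly (eval1 a).
HB.instance Definition _ a b := GRing.RMorphism.on (eval2 a b).
Definition eval3 a b c : {poly {poly {poly F}}} -> K :=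
  horner_eval c \o map_poly (eval2 a b).

Lemma eval1B a : {morph eval1 a : p q / p - q}.
Proof. by move=> p q; rewrite /eval1 /= /horner_eval rmorphB hornerD hornerN. Qed.

Lemma eval2B a b : {morph eval2 a b : p q / p - q}.
Proof.
by move=> p q; rewrite /eval2 /= /horner_eval [map_poly _ _]rmorphB hornerD hornerN.
Qed.

Lemma eval1C a c : eval1 a c%:P = h c.
Proof. by rewrite /eval1 /= /horner_eval map_polyC hornerC. Qed.

Lemma eval1X a : eval1 a 'X = a.
Proof. by rewrite /eval1 /= /horner_eval map_polyX hornerX. Qed.

Lemma eval2C a b c : eval2 a b c%:P = eval1 a c.
Proof. by rewrite /eval2 /= /horner_eval map_polyC hornerC. Qed.

Lemma eval2X a b : eval2 a b 'X = b.
Proof. by rewrite /eval2 /= /horner_eval map_polyX hornerX. Qed.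

(* The lowest monomial of an algebraic relation [P(a, b, c) = 0], divided out
   one variable at a time along the chain of primes, ends in a unit. *)
Lemma dim_le2 A : subring A -> (forall c, A (h c)) ->
  (forall a b c, exists P : {poly {poly {poly F}}}, P != 0 /\ eval3 a b c P = 0) ->
  forall e, has_prime_chain A e -> (e <= 2)%N.
Proof.
move=> rA Ah dep e [Q [Qprime Qchain]]; rewrite leqNgt; apply/negP => e3.
have prime i : (i <= 3)%N -> is_prime_ideal A (Q i).
  by move=> i3; apply: Qprime; apply: leq_trans i3 e3.
have next i : (i < 3)%N -> exists x, [/\ A x, Q i.+1 x & ~ Q i x].
  move=> i3; have [_ [x [Qx nQx]]] := Qchain i (leq_trans i3 e3).
  by exists x; split=> //; case: (prime i.+1 i3) => -[QA _ _ _] _ _; apply: QA.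
have sub i x : (i < 3)%N -> Q i x -> Q i.+1 x.
  by move=> i3; case: (Qchain i (leq_trans i3 e3)) => H _; apply: H.
have cancel i x y z : (i <= 3)%N -> A y -> Q i x -> Q i (z + x * y) -> Q i z.
  move=> i3 Ay Qx Qz; have [[QA Q0 QD QM] _ _] := prime i i3.
  rewrite -[z](addrK (x * y)); apply: QD => //.
  by rewrite -mulrN mulrC; apply: QM => //; apply: subringN.
(* Each of c, b, a is new to its prime of the chain. The outermost variable, c, is eliminated first:
   the multiple of c left over is absorbed by the next prime, and likewise for b and a. *)
have [c [Ac Qc nQc]] := next 0%N isT.
have [b [Ab Qb nQb]] := next 1%N isT.
have [a [Aa Qa nQa]] := next 2%N isT.
have A1 (p : {poly F}) : A (eval1 a p).
  rewrite /eval1 /= /horner_eval horner_coef; apply: subring_sum => // i.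
  by rewrite coef_map; case: (rA) => _ _ AM; apply: AM; [apply: Ah | apply: subringX].
have A2 (p : {poly {poly F}}) : A (eval2 a b p).
  rewrite /eval2 /= /horner_eval horner_coef; apply: subring_sum => // i.
  by rewrite coef_map; case: (rA) => _ _ AM; apply: AM; [apply: A1 | apply: subringX].
have [P [P0 PE]] := dep a b c.
have [] := @prime_step A _ (eval2 a b) (Q 0%N) c P rA A2 (prime 0%N isT) Ac nQc P0.
  by rewrite -[_.[_]]/(eval3 a b c P) PE; case: (prime 0%N isT) => -[].
move=> P1 [y [P10 Ay /(sub 0%N _ isT) h1]].
have {h1 Ay y} h1 := cancel 1%N _ _ _ isT Ay Qc h1.
have [P2 [y [P20 Ay]]] := @prime_step A _ (eval1 a) (Q 1%N) b P1 rA A1 (prime 1%N isT) Ab nQb P10 h1.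
move=> /(sub 1%N _ isT) h2; have {h2 Ay y} h2 := cancel 2%N _ _ _ isT Ay Qb h2.
have [d [y [d0 Ay]]] := @prime_step A _ h (Q 2%N) a P2 rA Ah (prime 2%N isT) Aa nQa P20 h2.
move=> /(sub 2%N _ isT) h3; have {h3 Ay y} h3 := cancel 3%N _ _ _ isT Ay Qa h3.
have [[_ _ _ QM] nQ1 _] := prime 3%N isT; apply: nQ1.
have := QM _ _ (Ah d^-1) h3; by rewrite -rmorphM mulVf // rmorph1.
Qed.
End Dimension.

(** * Local rings dominated by a fixed local ring V of K *)

Definition local_pair (V P : K -> Prop) : Prop :=
  [/\ subring V, is_ideal V P, ~ P 1 & forall x, V x -> ~ P x -> V x^-1].

Section Local.
Variables (V P : K -> Prop).
Hypothesis VP : local_pair V P.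

Definition unit_of x : Prop := V x /\ ~ P x.
(** For B inside V, this is the localization of B at the prime cut out by P. *)
Definition local_ring B : K -> Prop := fractions B unit_of.
Definition local_max B x : Prop := local_ring B x /\ P x.

Let rV : subring V. Proof. by case: VP. Qed.
Let PM a x : V a -> P x -> P (a * x). Proof. by case: VP => _ [_ _ _ PM] _ _; apply: PM. Qed.
Let PD x y : P x -> P y -> P (x + y). Proof. by case: VP => _ [_ _ PD _] _ _; apply: PD. Qed.
Let P0 : P 0. Proof. by case: VP => _ []. Qed.
Let PV x : P x -> V x. Proof. by case: VP => _ [PV _ _ _] _ _; apply: PV. Qed.
Let nP1 : ~ P 1. Proof. by case: VP. Qed.
Let VM x y : V x -> V y -> V (x * y). Proof. by case: rV => _ _; apply. Qed.

Lemma unit_neq0 x : unit_of x -> x != 0.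
Proof. by move=> [_ nPx]; apply/eqP => x0; apply: nPx; rewrite x0. Qed.

Lemma unit_inv x : unit_of x -> unit_of x^-1.
Proof.
move=> Ux; have x0 := unit_neq0 Ux; have [Vx nPx] := Ux; case: VP => _ _ _ Vinv.
by split; [apply: Vinv | move=> /(PM Vx); rewrite divff].
Qed.

Lemma unitM x y : unit_of x -> unit_of y -> unit_of (x * y).
Proof.
move=> Ux Uy; have [Vx _] := Ux; have [Vy nPy] := Uy; split; first exact: VM.
have [Vx' _] := unit_inv Ux.
by move=> /(PM Vx'); rewrite mulKf // unit_neq0.
Qed.

Lemma unit1 : unit_of 1.
Proof. by split=> //; case: rV. Qed.

Section LocalRing.
Variable B : K -> Prop.
Hypotheses (rB : subring B) (BV : forall x, B x -> V x).

Let BM x y : B x -> B y -> B (x * y). Proof. by case: rB => _ _; apply. Qed.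

Lemma local_ring_base x : B x -> local_ring B x.
Proof. by move=> Bx; exists x, 1; rewrite divr1; split=> //; [case: rB | apply: unit1]. Qed.

Lemma local_ring_subring : subring (local_ring B).
Proof.
split; first by apply: local_ring_base; case: rB.
  move=> _ _ [a [b [Ba Bb Ub ->]]] [c [d [Bc Bd Ud ->]]].
  exists (a * d - c * b), (b * d); split; [|exact: BM|exact: unitM|].
    by case: rB => _ BB _; apply: BB; apply: BM.
  by field; rewrite !unit_neq0.
move=> _ _ [a [b [Ba Bb Ub ->]]] [c [d [Bc Bd Ud ->]]].
exists (a * c), (b * d); split; [exact: BM|exact: BM|exact: unitM|].
by field; rewrite !unit_neq0.
Qed.

Lemma local_ring_V x : local_ring B x -> V x.
Proof. by move=> [a [b [Ba Bb /unit_inv[Vb _] ->]]]; apply: VM => //; apply: BV. Qed.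

Lemma local_ring_inv x : local_ring B x -> ~ P x -> local_ring B x^-1.
Proof.
move=> Ox nPx; have Ux : unit_of x by split=> //; apply: local_ring_V.
move: Ox Ux => [a [b [Ba Bb Ub ->]]] Uab; exists b, a; split=> //; last by rewrite invf_div.
by rewrite -[a](divfK (unit_neq0 Ub)); apply: unitM.
Qed.

Lemma local_prime_sub (Q : K -> Prop) x : is_prime_ideal (local_ring B) Q -> Q x -> P x.
Proof.
move=> [[QO _ _ QM] Q1 _] Qx; apply: contrapT => nPx; apply: Q1.
have x0 : x != 0 by apply/eqP => x0; apply: nPx; rewrite x0.
by rewrite -(mulVf x0); apply: QM => //; apply: local_ring_inv => //; apply: QO.
Qed.

Lemma local_max_prime : is_prime_ideal (local_ring B) (local_max B).
Proof.
have rO := local_ring_subring; split.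
- split.
  + by move=> x [].
  + by split=> //; apply: subring0.
  + by move=> x y [? ?] [? ?]; split; [apply: subringD | apply: PD].
  + move=> a x Oa [Ox Px]; split; first by case: rO => _ _; apply.
    by apply: PM => //; apply: local_ring_V.
- by case.
- move=> x y Ox Oy [Oxy Pxy]; have [Px|nPx] := pselect (P x); first by left.
  right; split=> //; have x0 : x != 0 by apply/eqP => x0; apply: nPx; rewrite x0.
  by rewrite -(mulKf x0 y); apply: PM => //; apply/local_ring_V/local_ring_inv.
Qed.

Lemma zero_prime A : subring A -> is_prime_ideal A (fun x => x = 0).
Proof.
move=> rA; split.
- split=> //.
  + by move=> x ->; apply: subring0.
  + by move=> x y -> ->; rewrite addr0.
  + by move=> a x _ ->; rewrite mulr0.
- by move/eqP; rewrite oner_eq0.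
- by move=> x y _ _ /eqP; rewrite mulf_eq0 => /orP[/eqP|/eqP]; [left|right].
Qed.

Lemma noetherian_local_ring : noetherian B -> noetherian (local_ring B).
Proof.
by apply: noetherian_fractions => //; [apply: unit_neq0|apply: unit1|apply: local_ring_subring].
Qed.

(** Case of a center at the generic point: every prime of the local ring lies in P, hence is 0. *)
Lemma regular_field : noetherian B -> (forall x, local_ring B x -> P x -> x = 0) ->
  regular_local_ring (local_ring B) (local_max B).
Proof.
move=> nB M0; have rO := local_ring_subring.
split; first exact: noetherian_local_ring.
exists 0%N, (fun=> 0); split; last first.
  move=> x; split; first by move=> [Ox Px]; exists (fun=> 0); rewrite big_ord0; split=> [[]|]; [|apply: M0].
  by move=> [c [_ ->]]; rewrite big_ord0; split=> //; apply: subring0.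
split; first by exists (fun=> fun x => x = 0); split=> [i _|//]; apply: zero_prime.
case=> // e [Q [Qp Qc]]; have [_ [x [Qx nQx]]] := Qc 0%N isT; case: nQx.
have Px := local_prime_sub (Qp 1%N isT) Qx.
have [[QO _ _ _] _ _] := Qp 1%N isT; have [[_ Q0 _ _] _ _] := Qp 0%N isT.
by rewrite (M0 x (QO x Qx) Px).
Qed.
End LocalRing.

Lemma local_ring_trans B1 B2 : subring B2 -> (forall x, B2 x -> V x) ->
  (forall x, B1 x -> local_ring B2 x) -> forall x, local_ring B1 x -> local_ring B2 x.
Proof.
move=> r2 B2V h _ [a [b [/h Oa /h Ob Ub ->]]].
have [_ _ OM] := local_ring_subring r2; apply: OM => //.
by apply: local_ring_inv => //; case: Ub.
Qed.

(** * Localizations of F0[w] for a field F0 inside V *)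

Section PolynomialsOverField.
Variables (F0 : K -> Prop) (w : K).
Hypotheses (rF : subring F0) (F_inv : forall x, F0 x -> F0 x^-1).
Hypotheses (F_unit : forall x, F0 x -> x != 0 -> unit_of x) (Vw : V w).

Let B := adjoin F0 w.

Let F0V x : F0 x -> V x.
Proof.
have [->|x0] := eqVneq x 0; first by move=> _; apply: subring0.
by move=> Fx; case: (F_unit Fx x0).
Qed.

Let rB : subring B. Proof. exact: adjoin_subring. Qed.

Let BV x : B x -> V x. Proof. exact: adjoin_min. Qed.

Lemma noetherian_field A : subring A -> (forall x, A x -> A x^-1) -> noetherian A.
Proof.
move=> rA Ainv; apply/(noetherianP rA) => I [IA I0 ID IM].
have [[x [Ix x0]]|n0] := pselect (exists x, I x /\ x != 0).
  exists [:: x]; split=> [g|y Iy]; first by rewrite inE => /eqP ->.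
  rewrite -(divfK x0 y); apply: spanM; last by apply: span_mem; rewrite inE.
  by case: rA => _ _; apply; [apply: IA | apply: Ainv; apply: IA].
exists [::]; split=> // x Ix; have [->|x0] := eqVneq x 0; first exact: span0.
by case: n0; exists x.
Qed.

Let nB : noetherian B.
Proof. by apply: hilbert_basis => //; apply: noetherian_field. Qed.

Let in_max p := coefs_in F0 p /\ P p.[w].

(* A polynomial of least degree in the maximal ideal, made monic, divides all
   the others. *)
Lemma max_generator : (exists p, in_max p /\ p.[w] != 0) ->
  exists t, [/\ coefs_in F0 t, P t.[w], t.[w] != 0
    & forall p, in_max p -> exists q, [/\ coefs_in F0 q,
        p.[w] = t.[w] * q.[w] & (size q <= (size p).-1)%N]].
Proof.
move=> [p0 [hp0 p00]].
pose has_size n := `[< exists p, [/\ in_max p, p.[w] != 0 & size p = n] >].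
have ex_size : exists n, has_size n by exists (size p0); apply/asboolP; exists p0.
have [n /asboolP[t1 [[t1F Pt1] t10 t1n]] min] := ex_minnP ex_size.
have small p : in_max p -> (size p < n)%N -> p.[w] = 0.
  move=> hp; have [//|p_0] := eqVneq p.[w] 0; rewrite ltnNge min //.
  by apply/asboolP; exists p.
pose t := (lead_coef t1)^-1 *: t1.
have lc0 : lead_coef t1 != 0 by rewrite lead_coef_eq0; apply: contraNneq t10 => ->; rewrite horner0.
have lcF : F0 (lead_coef t1)^-1 by apply: F_inv; apply: t1F.
have tF : coefs_in F0 t by apply: coefs_inZ.
have st : size t = n by rewrite size_scale ?invr_eq0.
have lt : t`_n.-1 = 1 by rewrite coefZ -t1n mulVf.
(* A non-zero constant is a unit, whereas the value of [t] lies in P. *)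
have n2 : (1 < n)%N.
  rewrite ltnNge; apply/negP => n1.
  have tw : t.[w] = t`_0 by rewrite (size1_polyC (_ : (size t <= 1)%N)) ?st // hornerC coefC.
  have t00 : t.[w] != 0 by rewrite hornerZ mulf_neq0 ?invr_eq0.
  have [_ []] : unit_of t.[w] by apply: F_unit => //; rewrite tw.
  by rewrite hornerZ; apply: PM => //; apply: F0V.
exists t; split=> //.
- by rewrite hornerZ; apply: PM => //; apply: F0V.
- by rewrite hornerZ mulf_neq0 ?invr_eq0.
move=> p; move: {2}(size p) (leqnn (size p)) => m.
elim: m p => [|m IH] p sp hp.
  exists 0; rewrite horner0 mulr0 size_poly0; split=> // [i|].
    by rewrite coef0; apply: subring0.
  by move: sp; rewrite leqn0 size_poly_eq0 => /eqP ->; rewrite horner0.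
have [pn|np] := ltnP (size p) n.
  exists 0; rewrite horner0 mulr0 size_poly0; split=> // [i|]; last exact: small.
  by rewrite coef0; apply: subring0.
have [hpF Pp] := hp; set k := (size p - n)%N.
have lF : F0 (lead_coef p) by apply: hpF.
have XF : coefs_in F0 (lead_coef p *: 'X^k) by apply: coefs_inZ => //; apply: coefs_inXn.
pose p' := p - t * (lead_coef p *: 'X^k).
have sp' : (size p' < size p)%N.
  have sp0 : (0 < size p)%N by rewrite (leq_trans _ np) // ltnW.
  rewrite -(prednK sp0) ltnS; apply/leq_sizeP => j.
  rewrite coefB -scalerAr coefZ coefMXn leq_eqVlt => /predU1P[<-|pj].
    have -> : ((size p).-1 < k)%N = false by rewrite /k; lia.
    have -> : ((size p).-1 - k)%N = n.-1 by rewrite /k; lia.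
    by rewrite lt mulr1 subrr.
  have -> : (j < k)%N = false by rewrite /k; lia.
  have -> : t`_(j - k) = 0 by rewrite nth_default // st /k; lia.
  have -> : p`_j = 0 by rewrite nth_default // -(prednK sp0).
  by rewrite mulr0 subrr.
have [||q [hq qE sq]] := IH p'; first by rewrite -ltnS; apply: leq_trans sp' sp.
  split; first by apply: coefs_inB => //; apply: coefs_inM.
  rewrite hornerD hornerN; apply: PD => //.
  rewrite hornerM mulrC -mulNr; apply: PM; last by rewrite hornerZ; apply: PM => //; apply: F0V.
  by apply: subringN => //; apply: BV; exists (lead_coef p *: 'X^k).
exists (lead_coef p *: 'X^k + q); split.
- exact: coefs_inD.
- by rewrite hornerD mulrDr -qE -hornerM -hornerD [_ + p']addrC subrK.
- rewrite (leq_trans (size_polyD _ _)) // geq_max; apply/andP; split.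
    rewrite (leq_trans (size_scale_leq _ _)) // size_polyXn /k.
    by have := n2; have := np; lia.
  by have := sp'; lia.
Qed.

(** The maximal ideal is 0 or generated by one element, so the local ring is a field or a discrete
    valuation ring. *)
Lemma regular_adjoin_field : regular_local_ring (local_ring B) (local_max B).
Proof.
have rO := local_ring_subring rB.
have [|no_max] := pselect (exists p, in_max p /\ p.[w] != 0); last first.
  apply: regular_field => // x [a [b [[p [pF ->]] Bb Ub ->]]] Px.
  have pw : p.[w] = p.[w] / b * b by rewrite divfK ?unit_neq0.
  have [->|p0] := eqVneq p.[w] 0; first by rewrite mul0r.
  case: no_max; exists p; split=> //; split=> //.
  by rewrite pw mulrC; apply: PM => //; case: Ub.
move=> /max_generator[t [tF Pt t0 div]].
have Bt : B t.[w] by exists t.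
have Ot := local_ring_base rB Bt.
have gen x : local_max B x -> exists y, local_ring B y /\ x = y * t.[w].
  move=> [[a [b [[p [pF ->]] Bb Ub ->]]] Px].
  have [|q [qF pE _]] := div p.
    split=> //; rewrite -[p.[w]](divfK (unit_neq0 Ub)) mulrC.
    by apply: PM => //; case: Ub.
  exists (q.[w] / b); split; first by exists q.[w], b; split=> //; exists q.
  by rewrite pE; ring.
split; first exact: noetherian_local_ring.
exists 1%N, (fun=> t.[w]); split; last first.
  move=> x; split.
    by move=> /gen[y [Oy ->]]; exists (fun=> y); rewrite big_ord1.
  move=> [c [Oc ->]]; rewrite big_ord1; split; first by case: rO => _ _; apply.
  by apply: PM => //; apply: local_ring_V (Oc _).
split.
  exists (fun i => if i is 0%N then fun x => x = 0 else local_max B); split.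
    by case=> [|i] _; [apply: zero_prime | apply: local_max_prime].
  case=> // _; split; first by move=> x ->; split; [apply: subring0|].
  by exists t.[w]; split; [split | apply/eqP].
case=> [|[|e]] // [Q [Qp Qc]]; exfalso.
have [_ [x [Q1x nQ0x]]] := Qc 0%N isT; have [_ [y [Q2y nQ1y]]] := Qc 1%N isT.
have [[Q1O Q10 _ Q1M] _ Q1p] := Qp 1%N isT.
have [[_ Q00 _ _] _ _] := Qp 0%N isT; have [[Q2O _ _ _] _ _] := Qp 2%N isT.
have x0 : x != 0 by apply/eqP => x0; apply: nQ0x; rewrite x0.
suff Q1t : Q 1%N t.[w].
  have [|z [Oz yE]] := gen y; last by apply: nQ1y; rewrite yE; apply: Q1M.
  by split; [apply: Q2O | apply: local_prime_sub (Qp 2%N isT) Q2y].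
have [a [b [[p [pF pE]] Bb Ub xE]]] := Q1O x Q1x.
have {pE} Q1p0 : Q 1%N p.[w] /\ p.[w] != 0.
  rewrite -pE (_ : a = b * x); last by rewrite xE mulrC divfK ?unit_neq0.
  split; last by rewrite mulf_neq0 // unit_neq0.
  by apply: Q1M => //; apply: local_ring_base.
(* A non-zero prime contains the generator: a polynomial with value in it is the generator times one
   of smaller size, and the prime contains one of the two factors. *)
move: {2}(size p) (leqnn (size p)) Q1p0 pF => n.
elim: n p {xE} => [|n IH] p sp [Q1pw p0] pF.
  by move: sp p0; rewrite leqn0 size_poly_eq0 => /eqP ->; rewrite horner0 eqxx.
have [|q [qF qE sq]] := div p.
  by split=> //; apply: local_prime_sub (Qp 1%N isT) Q1pw.
have Oq : local_ring B q.[w] by apply: local_ring_base => //; exists q.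
have : Q 1%N (t.[w] * q.[w]) by rewrite -qE.
move=> /(Q1p _ _ Ot Oq)[//|Q1q]; apply: (IH q) => //; first by have := sp; lia.
by split=> //; apply: contraNneq p0 => q0; rewrite qE q0 mulr0.
Qed.
End PolynomialsOverField.

(** * Localizations of F[u, w] *)

Section Bivariate.
Variables (F : fieldType) (h : {rmorphism F -> K}).
Hypothesis Vh : forall c, V (h c).

Definition splitting : Prop :=
  forall p : {poly F}, exists r, p = lead_coef p *: \prod_(z <- r) ('X - z%:P).

Definition constants x : Prop := exists c, x = h c.

Lemma constants_subring : subring constants.
Proof.
split; first by exists 1; rewrite rmorph1.
  by move=> _ _ [c ->] [d ->]; exists (c - d); rewrite rmorphB.
by move=> _ _ [c ->] [d ->]; exists (c * d); rewrite rmorphM.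
Qed.

Lemma unit_const c : c != 0 -> unit_of (h c).
Proof.
move=> c0; split=> // Pc; apply: nP1; rewrite -(rmorph1 h) -(mulVf c0) rmorphM.
exact: PM.
Qed.

Lemma adjoin_constantsP u x : adjoin constants u x <-> exists p : {poly F}, x = eval1 h u p.
Proof.
split=> [[p [/choice[f fE] ->]]|[p ->]].
  exists (\poly_(i < size p) f i); rewrite /eval1 /= /horner_eval; congr (_.[_]).
  apply/polyP => i; rewrite coef_map coef_poly; case: ltnP => // ip.
  by rewrite nth_default //; apply/esym/rmorph0.
by exists (map_poly h p); split=> // i; exists p`_i; rewrite coef_map.
Qed.

Lemma adjoin2_constantsP u w x :
  adjoin (adjoin constants u) w x <-> exists p : {poly {poly F}}, x = eval2 h u w p.
Proof.
split=> [[p [pE ->]]|[p ->]].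
  have /choice[f fE] : forall i, exists q : {poly F}, p`_i = eval1 h u q.
    by move=> i; apply/adjoin_constantsP.
  exists (\poly_(i < size p) f i); rewrite /eval2 /= /horner_eval; congr (_.[_]).
  apply/polyP => i; rewrite coef_map coef_poly; case: ltnP => // ip.
  by rewrite nth_default //; apply/esym/rmorph0.
exists (map_poly (eval1 h u) p); split=> // i; apply/adjoin_constantsP.
by exists p`_i; rewrite coef_map.
Qed.

Definition bivariate u w : K -> Prop := adjoin (adjoin constants u) w.

Lemma bivariate_subring u w : subring (bivariate u w).
Proof. by do 2!apply: adjoin_subring; apply: constants_subring. Qed.

Lemma bivariate_min S u w : subring S -> (forall c, S (h c)) -> S u -> S w ->
  forall x, bivariate u w x -> S x.
Proof.
by move=> rS Sh Su Sw; apply: adjoin_min => //; apply: adjoin_min => // _ [c ->].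
Qed.

Lemma bivariate_const u w c : bivariate u w (h c).
Proof. by do 2!(apply: adjoin_base; [by do ?apply: adjoin_subring; apply: constants_subring|]); exists c. Qed.

Lemma bivariate_fst u w : bivariate u w u.
Proof.
apply: adjoin_base; first by apply: adjoin_subring; apply: constants_subring.
by apply: adjoin_gen; apply: constants_subring.
Qed.

Lemma bivariate_snd u w : bivariate u w w.
Proof. by apply: adjoin_gen; apply: adjoin_subring; apply: constants_subring. Qed.

Lemma bivariate_sym u w : bivariate u w = bivariate w u.
Proof.
by apply/funext => x; apply/propext; split; apply: bivariate_min;
  by [apply: bivariate_subring|apply: bivariate_const|apply: bivariate_fst|apply: bivariate_snd].
Qed.

Lemma noetherian_bivariate u w : noetherian (bivariate u w).
Proof.
do 2!(apply: hilbert_basis; first by do ?apply: adjoin_subring; apply: constants_subring).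
apply: noetherian_field; first exact: constants_subring.
by move=> _ [c ->]; exists c^-1; rewrite fmorphV.
Qed.

(* [u] is transcendental over the residue field, so C(u) is contained in the
   local ring. *)
Lemma regular_transcendental u w : V u -> V w -> splitting -> (forall a, ~ P (u - h a)) ->
  regular_local_ring (local_ring (bivariate u w)) (local_max (bivariate u w)).
Proof.
move=> Vu Vw split_F ntr; set B := bivariate u w; set C := adjoin constants u.
have rC : subring C by apply: adjoin_subring; apply: constants_subring.
have rB : subring B := bivariate_subring u w.
have BV x : B x -> V x by apply: bivariate_min.
have unitC x : C x -> x != 0 -> unit_of x.
  move=> /adjoin_constantsP[p ->] p0.
  have {p0} p0 : p != 0 by apply: contraNneq p0 => ->; rewrite rmorph0.
  have [r ->] := split_F p; rewrite -mul_polyC rmorphM /= eval1C.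
  apply: unitM; first by apply: unit_const; rewrite lead_coef_eq0.
  rewrite rmorph_prod /=; elim/big_ind: _ => [|*|a _]; [exact: unit1|exact: unitM|].
  rewrite eval1B eval1X eval1C.
  by split; [case: rV => _ VB _; apply: VB | apply: ntr].
pose F0 := fractions C (fun x => x != 0).
have rF : subring F0.
  split; first by exists 1, 1; rewrite divr1; split; rewrite ?oner_eq0 //; case: rC.
    move=> _ _ [a [b [Ca Cb b0 ->]]] [c [d [Cc Cd d0 ->]]].
    exists (a * d - c * b), (b * d); have [_ CB CM] := rC.
    split; [by apply: CB; apply: CM|exact: CM|by rewrite mulf_neq0|].
    by field; rewrite b0 d0.
  move=> _ _ [a [b [Ca Cb b0 ->]]] [c [d [Cc Cd d0 ->]]].
  exists (a * c), (b * d); have [_ CB CM] := rC.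
  by split; [exact: CM|exact: CM|by rewrite mulf_neq0|field; rewrite b0 d0].
have F_inv x : F0 x -> F0 x^-1.
  move=> [a [b [Ca Cb b0 ->]]]; have [->|a0] := eqVneq a 0.
    by rewrite mul0r invr0; apply: subring0.
  by exists b, a; rewrite invf_div.
have F_unit x : F0 x -> x != 0 -> unit_of x.
  move=> [a [b [Ca Cb b0 ->]]]; rewrite mulf_eq0 invr_eq0 (negPf b0) orbF => a0.
  by apply: unitM; [apply: unitC | apply: unit_inv; apply: unitC].
have CF x : C x -> F0 x.
  by move=> Cx; exists x, 1; rewrite divr1; split; rewrite ?oner_eq0 //; case: rC.
have rFw : subring (adjoin F0 w) by apply: adjoin_subring.
have sub x : local_ring (adjoin F0 w) x <-> local_ring B x.
  split; apply: local_ring_trans => //.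
  - apply: adjoin_min; first exact: local_ring_subring.
      move=> _ [a [b [Ca Cb b0 ->]]]; exists a, b; split=> //.
      + by apply: adjoin_base.
      + by apply: adjoin_base.
      + exact: unitC.
    by apply: local_ring_base => //; apply: bivariate_snd.
  - apply: adjoin_min => // y Fy; have [->|y0] := eqVneq y 0; first exact: subring0.
    by case: (F_unit y Fy y0).
  - move=> y [p [pC ->]]; apply: local_ring_base => //; exists p; split=> // i.
    exact: CF (pC i).
have e1 : local_ring B = local_ring (adjoin F0 w).
  by apply/funext => x; apply/propext; split=> /sub.
rewrite [local_max B](_ : _ = local_max (adjoin F0 w)) /local_max e1 //.
exact: regular_adjoin_field.
Qed.

(** * Center at a closed point (a, b) *)

Section Point.
Variables (u w : K) (a b : F).
Hypotheses (Pu : P (u - h a)) (Pw : P (w - h b)).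
Hypothesis indep : forall p : {poly {poly F}}, eval2 h u w p = 0 -> p = 0.
Hypothesis dependent : forall x y z : K,
  exists p : {poly {poly {poly F}}}, p != 0 /\ eval3 h x y z p = 0.

Let B := bivariate u w.
Let rB : subring B := bivariate_subring u w.
Let Vu : V u. Proof. by rewrite -[u](subrK (h a)); apply: subringD => //; apply: PV. Qed.
Let Vw : V w. Proof. by rewrite -[w](subrK (h b)); apply: subringD => //; apply: PV. Qed.
Let BV x : B x -> V x. Proof. exact: bivariate_min. Qed.
Let BM x y : B x -> B y -> B (x * y). Proof. by case: rB => _ _; apply. Qed.
Let Bh c : B (h c). Proof. exact: bivariate_const. Qed.
Let Bu : B (u - h a). Proof. by case: rB => _ BB _; apply: BB => //; apply: bivariate_fst. Qed.
Let Bw : B (w - h b). Proof. by case: rB => _ BB _; apply: BB => //; apply: bivariate_snd. Qed.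

(** First-order Taylor expansion at the point (a, b): the elements that admit one form a subring
    containing the generators. *)
Lemma point_decomposition x : B x -> exists c y z,
  [/\ B y, B z & x = h c + y * (u - h a) + z * (w - h b)].
Proof.
have B0 : B 0 := subring0 rB; have B1 : B 1 by case: rB.
move: x; apply: bivariate_min.
- split.
  + by exists 1, 0, 0; split=> //; rewrite !mul0r !addr0 rmorph1.
  + move=> _ _ [c [y [z [By Bz ->]]]] [c' [y' [z' [By' Bz' ->]]]].
    have [_ BB _] := rB.
    exists (c - c'), (y - y'), (z - z'); split; [exact: BB|exact: BB|].
    by rewrite rmorphB; ring.
  + move=> _ _ [c [y [z [By Bz ->]]]] [c' [y' [z' [By' Bz' ->]]]].
    exists (c * c'), (h c * y' + y * (h c' + y' * (u - h a) + z' * (w - h b))),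
      (h c * z' + z * (h c' + y' * (u - h a) + z' * (w - h b))); split.
    * by do ?[apply: subringD => // | apply: BM => //].
    * by do ?[apply: subringD => // | apply: BM => //].
    * by rewrite rmorphM; ring.
- by move=> c; exists c, 0, 0; split=> //; rewrite !mul0r !addr0.
- by exists a, 1, 0; split=> //; ring.
- by exists b, 0, 1; split=> //; ring.
Qed.

(* restriction of a polynomial to the line u = a *)
Let restr : {poly {poly F}} -> {poly F} := map_poly (horner_eval a).
HB.instance Definition _ := GRing.RMorphism.on restr.

Let restr0_P (p : {poly {poly F}}) : restr p = 0 -> P (eval2 h u w p).
Proof.
move=> rp; rewrite /eval2 /= /horner_eval horner_coef.
elim/big_ind: _ => // i _; rewrite coef_map /= mulrC; apply: PM; first exact: subringX.
have /factor_theorem[q qE] : root p`_i a.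
  by rewrite /root -[_.[a]]/(horner_eval a p`_i) -coef_map -/(restr p) rp coef0.
rewrite qE rmorphM /=; apply: PM.
  apply: BV; apply: adjoin_base; first exact: adjoin_subring constants_subring.
  by apply/adjoin_constantsP; exists q.
by rewrite eval1B eval1X eval1C.
Qed.

(** The maximal ideal has the two generators u - a and w - b, and the primes of the whole plane, of
    the line u = a and of the point form a chain of the greatest length allowed. *)
Lemma regular_point : regular_local_ring (local_ring B) (local_max B).
Proof.
have rO := local_ring_subring rB; have [_ _ OM] := rO.
have Ob := local_ring_base rB.
split; first by apply: noetherian_local_ring => //; apply: noetherian_bivariate.
exists 2%N, (fun i => if i == 0 then u - h a else w - h b); split; last first.
  move=> x; split; last first.
    move=> [c [Oc ->]]; rewrite big_ord_recl big_ord1 /=; split.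
      by apply: subringD => //; apply: OM => //; apply: Ob.
    by apply: PD; apply: PM => //; apply: (local_ring_V BV).
  move=> [[y [z [By Bz Uz ->]]] Pyz].
  have [c [y1 [y2 [By1 By2 yE]]]] := point_decomposition By.
  (* A non-zero constant would be a unit, while everything else in the expansion lies in P. *)
  have c0 : c = 0.
    apply/eqP/negPn/negP => /unit_const[_]; apply.
    have -> : h c = y / z * z - (y1 * (u - h a) + y2 * (w - h b)).
      by rewrite divfK ?unit_neq0 // yE; ring.
    rewrite -mulN1r; apply: PD; first by rewrite mulrC; apply: PM => //; case: Uz.
    apply: PM; first by apply: subringN => //; case: rV.
    by apply: PD; apply: PM => //; apply: BV.
  exists (fun i => if i == 0 then y1 / z else y2 / z); split.
    by move=> i; case: ifP => _; [exists y1, z | exists y2, z].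
  by rewrite big_ord_recl big_ord1 /= yE c0 rmorph0; ring.
split; last first.
  by apply: (@dim_le2 _ h) => // c; apply: Ob.
(* The prime of the line u = a. By independence of u and w the polynomials are determined by their
   values, so restricting them to the line makes sense. *)
pose Q x := exists p q : {poly {poly F}}, [/\ x = eval2 h u w p / eval2 h u w q,
  unit_of (eval2 h u w q) & restr p = 0].
have ev_B (p : {poly {poly F}}) : B (eval2 h u w p) by apply/adjoin2_constantsP; exists p.
have B_ev x : B x -> exists p : {poly {poly F}}, x = eval2 h u w p by move/adjoin2_constantsP.
have ev_inj (p q : {poly {poly F}}) : eval2 h u w p = eval2 h u w q -> p = q.
  by move=> e; apply/eqP; rewrite -subr_eq0; apply/eqP/indep; rewrite eval2B e subrr.
have restr_unit (q : {poly {poly F}}) : unit_of (eval2 h u w q) -> restr q != 0.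
  by move=> [_ nP]; apply/eqP => /restr0_P.
have QO x : Q x -> local_ring B x.
  by move=> [p [q [-> Uq _]]]; exists (eval2 h u w p), (eval2 h u w q).
have Q_of (p : {poly {poly F}}) : restr p = 0 -> Q (eval2 h u w p).
  by move=> rp; exists p, 1; rewrite rmorph1 divr1; split=> //; apply: unit1.
have Q_prime : is_prime_ideal (local_ring B) Q.
  split.
  - split=> //.
    + by rewrite -(rmorph0 (eval2 h u w)); apply: Q_of; rewrite rmorph0.
    + move=> _ _ [p [q [-> Uq rp]]] [p' [q' [-> Uq' rp']]].
      exists (p * q' + p' * q), (q * q'); rewrite !rmorphD !rmorphM /= rp rp'.
      split; [by field; rewrite !unit_neq0|exact: unitM|ring].
    + move=> _ _ [y [z [/B_ev[p yE] /B_ev[q zE] Uq ->]]] [p' [q' [-> Uq' rp']]].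
      rewrite yE zE in Uq *.
      exists (p * p'), (q * q'); rewrite !rmorphM /= rp' mulr0.
      by split=> //; [field; rewrite !unit_neq0|exact: unitM].
  - move=> [p [q [e Uq rp]]]; have := restr_unit q Uq; rewrite -(ev_inj p q) ?rp ?eqxx //.
    by rewrite -[LHS](divfK (unit_neq0 Uq)) -e mul1r.
  - move=> ? ? [y [z [/B_ev[p yE] /B_ev[q zE] Uq ->]]].
    move=> [y' [z' [/B_ev[p' y'E] /B_ev[q' z'E] Uq' ->]]] [p2 [q2 [e Uq2 rp2]]].
    rewrite yE zE y'E z'E in Uq Uq' e *.
    have /(congr1 restr) : p * p' * q2 = p2 * (q * q').
      apply: ev_inj; rewrite !rmorphM /=.
      have := congr1 (fun x => x * (eval2 h u w q * eval2 h u w q' * eval2 h u w q2)) e.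
      have := unit_neq0 Uq; have := unit_neq0 Uq'; have := unit_neq0 Uq2.
      move=> n2 n' n {}e; apply: etrans (etrans e _); by field; rewrite ?n2 ?n' ?n.
    rewrite !rmorphM /= rp2 mul0r => /eqP; rewrite !mulf_eq0 (negPf (restr_unit q2 Uq2)) orbF.
    by case/orP => /eqP ?; [left; exists p, q | right; exists p', q'].
have ev_u : u - h a = eval2 h u w (('X - a%:P)%:P).
  by rewrite eval2C eval1B eval1X eval1C.
have ev_w : w - h b = eval2 h u w ('X - (b%:P)%:P).
  by rewrite eval2B eval2X eval2C eval1C.
exists (fun i => match i with 0 => fun x => x = 0 | 1 => Q | _ => local_max B end); split.
  case=> [|[|i]] _; [exact: zero_prime|exact: Q_prime|exact: local_max_prime].
case=> [|[|//]] _; split.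
- by move=> x ->; rewrite -(rmorph0 (eval2 h u w)); apply: Q_of; rewrite rmorph0.
- exists (u - h a); split.
    rewrite ev_u; apply: Q_of; rewrite /restr map_polyC /= /horner_eval.
    by rewrite hornerD hornerN hornerX hornerC subrr.
  rewrite ev_u => /indep/eqP; rewrite polyC_eq0 => /eqP e.
  by have := polyXsubC_eq0 a; rewrite e eqxx.
- move=> x Qx; split; [exact: QO|exact: (local_prime_sub BV Q_prime Qx)].
- exists (w - h b); split; first by split=> //; apply: Ob.
  move=> [p [q [e Uq rp]]]; have q0 := unit_neq0 Uq.
  have /(congr1 restr) : ('X - (b%:P)%:P) * q = p.
    by apply: ev_inj; rewrite rmorphM /= -ev_w e divfK.
  rewrite rmorphM /= rp => /eqP; rewrite mulf_eq0 (negPf (restr_unit q Uq)) orbF.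
  rewrite rmorphB /= /restr map_polyX map_polyC /= /horner_eval hornerC.
  by rewrite polyXsubC_eq0.
Qed.
End Point.

(** Over an algebraically closed field a residue that is not a constant is transcendental. So either
    u or w has transcendental residue, or the center is a closed point. *)
Theorem regular_bivariate u w : splitting -> V u -> V w ->
  (forall p : {poly {poly F}}, eval2 h u w p = 0 -> p = 0) ->
  (forall x y z : K, exists p : {poly {poly {poly F}}}, p != 0 /\ eval3 h x y z p = 0) ->
  regular_local_ring (local_ring (bivariate u w)) (local_max (bivariate u w)).
Proof.
move=> split_F Vu Vw indep dep.
have [[a Pu]|nu] := pselect (exists a, P (u - h a)); last first.
  by apply: regular_transcendental => // a Pa; apply: nu; exists a.
have [[b Pw]|nw] := pselect (exists b, P (w - h b)); last first.
  by rewrite bivariate_sym; apply: regular_transcendental => // b Pb; apply: nw; exists b.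
exact: regular_point Pu Pw indep dep.
Qed.
End Bivariate.
End Local.
End Subrings.

(** * Algebraic dependence in C(x_1, x_2) *)

Lemma linear_dependence (F : fieldType) (T : finType) n (v : T -> 'rV[F]_n) :
  (n < #|T|)%N -> exists c : T -> F, (exists t, c t != 0) /\ \sum_t c t *: v t = 0.
Proof.
move=> nT; pose A : 'M[F]_(#|T|, n) := \matrix_i v (enum_val i).
have /rowV0Pn[u /sub_kermxP uA u0] : kermx A != 0.
  rewrite -mxrank_eq0 mxrank_ker subn_eq0 -ltnNge.
  exact: leq_ltn_trans (rank_leq_col A) nT.
exists (fun t => u 0 (enum_rank t)); split.
  have /existsP[i ui] : [exists i, u 0 i != 0].
    apply: contraNT u0; rewrite negb_exists => /forallP h.
    by apply/eqP/rowP => i; rewrite mxE; apply/eqP; rewrite -[_ == _]negbK.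
  by exists (enum_val i); rewrite enum_valK.
apply: etrans uA; rewrite mulmx_sum_row [RHS](reindex (@enum_rank T)) /=; last exact/onW_bij/enum_rank_bij.
by apply: eq_bigr => t _; rewrite rowK enum_rankK.
Qed.

Section Fractions.

Lemma fractionP (A : idomainType) (x : {fraction A}) :
  exists n d : A, d != 0 /\ x = FracField.tofrac n / FracField.tofrac d.
Proof.
elim/quotW: x => r; exists (frac r).1, (frac r).2.
have d0 := denom_ratioP r; split=> //.
have d0' : FracField.tofrac (frac r).2 != 0 by rewrite tofrac_eq0.
apply: (mulIf d0'); rewrite divfK //; unlock FracField.tofrac.
rewrite -[LHS]FracField.pi_mul; apply/eqmodP; rewrite /= FracField.equivfE /FracField.mulf.
by rewrite !numden_Ratio ?mulf_neq0 ?oner_eq0 //= !mulr1 mulrC.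
Qed.

End Fractions.

Lemma complementary_exponent N i j k : (i < N)%N -> (j < N)%N -> (k < N)%N ->
  (i + j + k + (3 * N - i - j - k) = 3 * N)%N.
Proof. lia. Qed.

Lemma expand_fraction (L : fieldType) (a b c d : L) :
  c != 0 -> d != 0 -> b != 0 -> a / b = a * c * d / (b * c * d).
Proof. by move=> c0 d0 b0; field; rewrite b0 c0 d0. Qed.

Lemma clear_denominators (L : fieldType) (a b c d : L) u v w n : d != 0 ->
  (a / d) ^+ u * (b / d) ^+ v * (c / d) ^+ w * (d ^+ u * d ^+ v * d ^+ w * d ^+ n) =
  a ^+ u * b ^+ v * c ^+ w * d ^+ n.
Proof. by move=> d0; rewrite !expr_div_n; field; rewrite !expf_neq0. Qed.

Section AlgebraicDependence.
Variable F : fieldType.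
Notation A := {mpoly F[2]}.
Notation tofrac := (@FracField.tofrac A).

Definition deg_le d (p : A) := (msize p <= d.+1)%N.

Lemma deg_leM d e p q : deg_le d p -> deg_le e q -> deg_le (d + e) (p * q).
Proof.
rewrite /deg_le => hp hq; have [->|p0] := eqVneq p 0; first by rewrite mul0r msize0.
have [->|q0] := eqVneq q 0; first by rewrite mulr0 msize0.
by rewrite msizeM //; move: (msize p) (msize q) hp hq => m n; lia.
Qed.

Lemma deg_leX d k p : deg_le d p -> deg_le (k * d) (p ^+ k).
Proof.
move=> hp; elim: k => [|k IH]; first by rewrite expr0 /deg_le msize1.
by rewrite exprS mulSn; apply: deg_leM.
Qed.

Lemma deg_le_coef d (p : A) : deg_le d p ->
  (forall i j : 'I_d.+1, p@_[multinom (if k == ord0 then i : nat else j) | k < 2] = 0) -> p = 0.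
Proof.
move=> hp h; apply/mpolyP => m; rewrite mcoeff0.
have [md|dm] := leqP (mdeg m) d; last first.
  by apply/eqP; rewrite mcoeff_eq0 msize_mdeg_ge // (leq_trans hp).
move: md; rewrite mdegE big_ord_recl big_ord1 => md.
have i0 : (m ord0 < d.+1)%N by lia.
have i1 : (m (lift ord0 ord0) < d.+1)%N by move: md; lia.
rewrite -(h (Ordinal i0) (Ordinal i1)); congr (_@__); apply/mnmP => k; rewrite mnmE.
case: eqP => [->//|/eqP]; case: (unliftP ord0 k) => [j ->|->]; last by rewrite eqxx.
by rewrite ord1.
Qed.

(** Dimension count: over a common denominator the N^3 monomials in x, y, z with exponents below N
    become polynomials in two variables of degree linear in N, and these form a space of dimension
    of order N^2. *)
Lemma algebraic_dependence (x y z : {fraction A}) :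
  exists c : nat -> nat -> nat -> F, exists N,
  (exists i j k, [/\ (i < N)%N, (j < N)%N, (k < N)%N & c i j k != 0]) /\
  \sum_(k < N) \sum_(j < N) \sum_(i < N)
    tofrac (c i j k)%:MP * x ^+ i * y ^+ j * z ^+ k = 0.
Proof.
have [f [f' [f'0 ->]]] := fractionP x; have [g [g' [g'0 ->]]] := fractionP y.
have [e [e' [e'0 ->]]] := fractionP z; clear x y z.
pose d := f' * g' * e'; pose a := f * g' * e'; pose b := g * f' * e'; pose c := e * f' * g'.
have d0 : d != 0 by rewrite !mulf_neq0.
pose D := (msize a + msize b + msize c + msize d)%N.
have [ha hb hc hd] : [/\ deg_le D a, deg_le D b, deg_le D c & deg_le D d].
  by rewrite /deg_le /D; split; move: (msize a) (msize b) (msize c) (msize d) => *; lia.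
(* Since M + 1 is at most N(9D + 1), taking N above (9D + 1)^2 makes N^3 exceed (M + 1)^2. The
   exponent E bounds i + j + k, so d^E clears all denominators. *)
pose N := ((9 * D).+1 ^ 2).+1; pose E := (3 * N)%N.
pose M := (E * (3 * D))%N.
pose T := ('I_N * ('I_N * 'I_N))%type.
pose W (t : T) : A := a ^+ t.2.2 * b ^+ t.2.1 * c ^+ t.1 * d ^+ (E - t.2.2 - t.2.1 - t.1).
have degW t : deg_le M (W t).
  have := deg_leX t.2.2 ha; have := deg_leX t.2.1 hb; have := deg_leX t.1 hc.
  have := deg_leX (E - t.2.2 - t.2.1 - t.1) hd => hd' hc' hb' ha'.
  have := deg_leM (deg_leM (deg_leM ha' hb') hc') hd'; rewrite /deg_le => h.
  apply: leq_trans h _; rewrite ltnS -!mulnDl /M mulnA leq_mul2r; apply/orP; right.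
  rewrite /E.
  by rewrite complementary_exponent // leq_pmulr.
pose v (t : T) : 'rV[F]_(M.+1 * M.+1) := mxvec (\matrix_(i < M.+1, j < M.+1)
  (W t)@_[multinom (if k == ord0 then i : nat else j) | k < 2]).
have [|co [[t0 ct0] co0]] := @linear_dependence F T _ v.
  rewrite !card_prod !card_ord.
  have M1 : (M.+1 <= N * (9 * D).+1)%N by rewrite /M /E mulnS; nia.
  apply: leq_ltn_trans (leq_mul M1 M1) _; rewrite mulnACA [(N * (N * N))%N]mulnA ltn_mul2l muln_gt0 /=.
  by rewrite mulnn ltnS.
(* The coefficients [co] as a function of three naturals, 0 out of range. *)
pose cf i j k := if [pick t : T | [&& t.2.2 == i :> nat, t.2.1 == j :> nat & t.1 == k :> nat]]
  is Some t then co t else 0.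
have cfE (t : T) : cf t.2.2 t.2.1 t.1 = co t.
  rewrite /cf; case: pickP => [[k [j i]] /and3P[/= ei ej ek]|/(_ t)]; last by rewrite !eqxx.
  by congr co; case: t ei ej ek => [k' [j' i']] /= /eqP/val_inj-> /eqP/val_inj-> /eqP/val_inj->.
exists cf, N; split; first by exists t0.2.2, t0.2.1, t0.1; rewrite cfE.
have W0 : \sum_t co t *: W t = 0.
  apply: (deg_le_coef (d := M)).
    rewrite /deg_le; elim/big_ind: _ => [|p q hp hq|t _]; first by rewrite msize0.
      by rewrite (leq_trans (msizeD_le _ _)) // geq_max hp.
    by apply: leq_trans (msizeZ_le _ _) _; apply: degW.
  move=> i j; rewrite linear_sum /=.
  have /rowP/(_ (mxvec_index i j)) := co0; rewrite mxE summxE => coE.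
  rewrite -[RHS]coE; apply: eq_bigr => t _.
  by rewrite mxE mxvecE mxE mcoeffZ.
have d0' : tofrac d != 0 by rewrite tofrac_eq0.
have -> : tofrac f / tofrac f' = tofrac a / tofrac d.
  by rewrite /a /d !tofracM; apply: expand_fraction; rewrite tofrac_eq0.
have -> : tofrac g / tofrac g' = tofrac b / tofrac d.
  rewrite /b /d !tofracM [tofrac f' * _]mulrC.
  by apply: expand_fraction; rewrite tofrac_eq0.
have -> : tofrac e / tofrac e' = tofrac c / tofrac d.
  rewrite /c /d !tofracM [tofrac f' * _ * tofrac e']mulrC mulrA.
  by apply: expand_fraction; rewrite tofrac_eq0.
clearbody a b c d; apply: (mulIf (expf_neq0 E d0')); rewrite mul0r.
transitivity (\sum_t tofrac (co t *: W t)); last by rewrite -rmorph_sum W0 rmorph0.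
rewrite mulr_suml; under eq_bigr do rewrite mulr_suml.
under eq_bigr do under eq_bigr do rewrite mulr_suml.
under eq_bigr do rewrite pair_bigA.
rewrite pair_bigA /=; apply: eq_bigr => -[k [j i]] _ /=.
rewrite (cfE (k, (j, i))) -mul_mpolyC /W /= !tofracM !tofracXn.
have -> : tofrac d ^+ E = tofrac d ^+ i * tofrac d ^+ j * tofrac d ^+ k *
    tofrac d ^+ (E - i - j - k).
  by rewrite -!exprD complementary_exponent.
by rewrite -!(mulrA (tofrac _%:MP)) clear_denominators.
Qed.
End AlgebraicDependence.

Lemma horner_map_poly (T : idomainType) (S : fieldType) (f : {rmorphism T -> S}) N (E : nat -> T) x :
  (map_poly f (\poly_(i < N) E i)).[x] = \sum_(i < N) f (E i) * x ^+ i.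
Proof.
rewrite (@horner_coef_wide _ N).
  by apply: eq_bigr => i _; rewrite coef_map coef_poly ltn_ord.
by rewrite (leq_trans (size_poly _ _)) // size_poly.
Qed.

Lemma eval3_poly (K F : fieldType) (h : {rmorphism F -> K}) x y z
    (c : nat -> nat -> nat -> F) N :
  eval3 h x y z (\poly_(k < N) \poly_(j < N) \poly_(i < N) c i j k) =
  \sum_(k < N) \sum_(j < N) \sum_(i < N) h (c i j k) * x ^+ i * y ^+ j * z ^+ k.
Proof.
rewrite /eval3 /= /horner_eval horner_map_poly; apply: eq_bigr => k _.
rewrite /= /eval2 /= /horner_eval horner_map_poly mulr_suml; apply: eq_bigr => j _.
by rewrite /= /eval1 /= /horner_eval horner_map_poly !mulr_suml.
Qed.

Lemma eval3_dependence (F : fieldType) (h : {rmorphism F -> {fraction {mpoly F[2]}}}) :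
  (forall c, h c = FracField.tofrac c%:MP) ->
  forall x y z, exists p : {poly {poly {poly F}}}, p != 0 /\ eval3 h x y z p = 0.
Proof.
move=> hE x y z; have [c [N [[i [j [k [iN jN kN cn0]]]] c0]]] := algebraic_dependence x y z.
exists (\poly_(k < N) \poly_(j < N) \poly_(i < N) c i j k); split.
  apply: contraNneq cn0 => /polyP/(_ k); rewrite coef0 coef_poly kN.
  by move=> /polyP/(_ j); rewrite coef0 coef_poly jN => /polyP/(_ i); rewrite coef0 coef_poly iN => ->.
rewrite eval3_poly -[RHS]c0; apply: eq_bigr => k' _; apply: eq_bigr => j' _.
by apply: eq_bigr => i' _; rewrite hE.
Qed.

(** * Laurent monomials *)

Notation Z2 := 'rV[int]_2.

Lemma ord2P (j : 'I_2) : j = 0 \/ j = 1.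
Proof. by case: j => [[|[|//]] h]; [left|right]; apply/val_inj. Qed.

Section Monomials.
Variables (L : fieldType) (x : 'I_2 -> L).
Hypothesis x0 : forall j, x j != 0.

Lemma monomialD g h : monomial x (g + h) = monomial x g * monomial x h.
Proof. by rewrite /monomial -big_split; apply: eq_bigr => j _; rewrite mxE expfzDr. Qed.

Lemma monomial0 : monomial x 0 = 1.
Proof. by rewrite /monomial big1 // => j _; rewrite mxE expr0z. Qed.

Lemma monomial_neq0 g : monomial x g != 0.
Proof. by apply/prodf_neq0 => j _; rewrite expfz_neq0. Qed.

Lemma monomialN g : monomial x (- g) = (monomial x g)^-1.
Proof.
by apply: (mulIf (monomial_neq0 g)); rewrite -monomialD addNr monomial0 mulVf ?monomial_neq0.
Qed.

Lemma monomialB g h : monomial x (g - h) = monomial x g / monomial x h.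
Proof. by rewrite monomialD monomialN. Qed.

Lemma monomialMn g n : monomial x (g *+ n) = monomial x g ^+ n.
Proof. by elim: n => [|n IH]; rewrite ?mulr0n ?monomial0 // mulrS exprS monomialD IH. Qed.

Lemma monomialMz g (n : int) : monomial x (g *~ n) = monomial x g ^ n.
Proof.
by case: n => n; rewrite ?NegzE ?mulrNz ?monomialN -?pmulrn ?monomialMn ?exprnN.
Qed.

Lemma monomial_sum (I : Type) (r : seq I) (E : I -> Z2) :
  monomial x (\sum_(i <- r) E i) = \prod_(i <- r) monomial x (E i).
Proof. by elim: r => [|i r IH]; rewrite ?big_nil ?monomial0 // !big_cons monomialD IH. Qed.
End Monomials.

Section Laurent.
Variable R : realType.
Local Notation C := R[i].
Local Notation K := (ratfun R).
Local Notation X := (@ratfunX R).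

Lemma ratfunC_zmod : zmod_morphism (@ratfunC R).
Proof. by move=> a b; rewrite /ratfunC mpolyCB tofracB. Qed.
Lemma ratfunC_monoid : monoid_morphism (@ratfunC R).
Proof. by split=> [|a b]; rewrite /ratfunC ?mpolyCM ?tofracM // mpolyC1 tofrac1. Qed.
HB.instance Definition _ := GRing.isZmodMorphism.Build C K (@ratfunC R) ratfunC_zmod.
HB.instance Definition _ := GRing.isMonoidMorphism.Build C K (@ratfunC R) ratfunC_monoid.

Lemma ratfunX_neq0 j : X j != 0.
Proof.
rewrite tofrac_eq0; apply/eqP => /(congr1 (mcoeff U_(j)%MM)).
by rewrite mcoeffX eqxx mcoeff0 => /eqP; rewrite oner_eq0.
Qed.

Definition torus (t : 'I_2 -> C) : Prop := forall j, t j != 0.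

Lemma poly_eq0_nonzero (p : {poly C}) : (forall z, z != 0 -> p.[z] = 0) -> p = 0.
Proof.
move=> h; apply/eqP/negPn/negP => p0.
have := @max_poly_roots _ p [seq i.+1%:R | i <- iota 0 (size p)] p0.
rewrite size_map size_iota ltnn map_inj_uniq ?iota_uniq; last first.
  by move=> i j /eqP; rewrite eqr_nat => /eqP [].
move=> H; suff : false by []; apply: H => //; apply/allP => _ /mapP[i _ ->]; apply/rootP/h.
by rewrite pnatr_eq0.
Qed.

(* Kronecker's substitution t = (z, z ^ N) separates the exponents. *)
Lemma laurent_torus0 (I : eqType) (r : seq I) (a : I -> C) (e : I -> Z2) :
  (forall t, torus t -> \sum_(i <- r) a i * monomial t (e i) = 0) ->
  forall g, \sum_(i <- r | e i == g) a i = 0.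
Proof.
move=> h g; pose sz (f : Z2) : nat := addn (absz (f 0 0)) (absz (f 0 1)).
pose B := \max_(f <- g :: map e r) sz f.
have hB f : f \in g :: map e r -> (sz f <= B)%N.
  by move=> fs; apply: (leq_bigmax_seq (F := sz)).
have eB i : i \in r -> (sz (e i) <= B)%N by move=> ir; apply: hB; rewrite inE map_f ?orbT.
have gB : (sz g <= B)%N by apply: hB; rewrite mem_head.
(* Both coordinates are shifted by B, hence lie between 0 and 2B, and are read as digits in base
   N. *)
pose N := (B + B).+1%:Z; pose nu (f : Z2) : int := f 0 0 + N * f 0 1 + N * B%:Z + B%:Z.
have nu_ge0 f : (sz f <= B)%N -> 0 <= nu f.
  rewrite /sz /nu /N; move: (f 0 0) (f 0 1) (B) => u v b; clear; nia.
have nu_inj (f f' : Z2) : (sz f <= B)%N -> (sz f' <= B)%N -> nu f = nu f' -> f = f'.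
  move=> fB f'B E; apply/rowP => j.
  have e1 : f 0 1 = f' 0 1.
    move: fB f'B E; rewrite /sz /nu /N.
    move: (f 0 0) (f 0 1) (f' 0 0) (f' 0 1) (B) => u v u' v' b; clear => h h' E.
    have [d|d|//] := ltgtP v v'.
      have : ((b + b).+1%:Z * (v' - v) <= (b + b)%:Z) by lia.
      have d1 : 1 <= v' - v by lia.
      by nia.
    have : ((b + b).+1%:Z * (v - v') <= (b + b)%:Z) by lia.
    have d1 : 1 <= v - v' by lia.
    by nia.
  have e0 : f 0 0 = f' 0 0 by move: E; rewrite /nu e1; lia.
  by case: (ord2P j) => ->.
pose p := \sum_(i <- r) a i *: 'X^(`|nu (e i)|).
have p0 : p = 0.
  apply: poly_eq0_nonzero => z z0; pose t (j : 'I_2) : C := if j == 0 then z else z ^ N.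
  have tt : torus t by move=> j; rewrite /t; case: (j == 0) => //; apply: expfz_neq0.
  have tE f : (sz f <= B)%N -> z ^+ `|nu f| = monomial t f * z ^ (N * B%:Z + B%:Z).
    move=> fB; rewrite exprnP gez0_abs ?nu_ge0 // /nu -addrA expfzDr //.
    rewrite expfzDr // /monomial big_ord_recl big_ord1 /t /= exprz_exp; congr (_ * _ ^ (_ * _) * _).
    by congr (f 0 _); apply/val_inj.
  rewrite /p horner_sum -[RHS](mul0r (z ^ (N * B%:Z + B%:Z))) -[in RHS](h t tt) mulr_suml.
  apply: eq_big_seq => i ir; rewrite hornerZ hornerXn tE ?mulrA //; exact: eB.
have := congr1 (fun q : {poly C} => q`_`|nu g|) p0; rewrite coef0 coef_sum => {2}<-.
rewrite big_mkcond /=; apply: eq_big_seq => i ir; rewrite coefZ coefXn.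
have -> : (`|nu g|%N == `|nu (e i)|%N) = (e i == g).
  apply/eqP/eqP => [E|->//]; apply: nu_inj => //; first exact: eB.
  by have := nu_ge0 _ gB; have := nu_ge0 _ (eB i ir); lia.
by case: eqP; rewrite ?mulr1 ?mulr0.
Qed.

(** Terms of equal exponent are collected, so psi may be any function of the exponent: the monomial
    itself, or its image under a derivation of the torus. *)
Lemma laurent_group (L : fieldType) (I : eqType) (r : seq I) (a : I -> L) (e : I -> Z2)
    (psi : Z2 -> L) :
  (forall g, \sum_(i <- r | e i == g) a i = 0) -> \sum_(i <- r) a i * psi (e i) = 0.
Proof.
move=> h; transitivity (\sum_(g <- undup (map e r)) \sum_(i <- r | e i == g) a i * psi (e i)).
  rewrite (exchange_big_dep predT) //=; apply: eq_big_seq => i ir.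
  rewrite (eq_bigl (fun g => g == e i)); last by move=> g; rewrite eq_sym.
  by rewrite -big_filter filter_pred1_uniq ?undup_uniq ?mem_undup ?map_f // big_seq1.
apply: big1 => g _; rewrite (eq_bigr (fun i => a i * psi g)); last by move=> i /eqP ->.
by rewrite -mulr_suml h mul0r.
Qed.

(** Multiplication by a large monomial clears the negative exponents and leaves a polynomial
    identity, which can be evaluated at t. *)
Lemma laurent_ratfun0 (I : eqType) (r : seq I) (a : I -> C) (e : I -> Z2) :
  \sum_(i <- r) ratfunC (a i) * monomial X (e i) = 0 ->
  forall t, torus t -> \sum_(i <- r) a i * monomial t (e i) = 0.
Proof.
move=> h t tt.
pose sz (f : Z2) : nat := addn (absz (f 0 0)) (absz (f 0 1)).
pose B := \max_(f <- map e r) sz f; pose w : Z2 := const_mx B%:Z.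
have hB i j : i \in r -> (0 <= (w + e i) 0 j).
  move=> ir; have : (sz (e i) <= B)%N.
    by apply: (leq_bigmax_seq (F := sz)) => //; apply: map_f.
  by rewrite /sz !mxE; case: (ord2P j) => ->; move: (e i 0 0) (e i 0 1) (B) => u v b; clear; lia.
pose m i : 'X_{1..2} := [multinom absz ((w + e i)%R ord0 j) | j < 2].
have mE (L : fieldType) (y : 'I_2 -> L) i : i \in r -> (forall j, y j != 0) ->
    \prod_(j < 2) y j ^+ m i j = monomial y w * monomial y (e i).
  move=> ir y0; rewrite -monomialD //; apply: eq_bigr => j _.
  by rewrite mnmE exprnP gez0_abs // hB.
have q0 : \sum_(i <- r) a i *: 'X_[m i] = 0 :> {mpoly C[2]}.
  apply/eqP; rewrite -tofrac_eq0 rmorph_sum /=.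
  have /eqP := congr1 (fun z => monomial X w * z) h; rewrite mulr0 mulr_sumr.
  congr (_ == _); apply: eq_big_seq => i ir; rewrite -mul_mpolyC tofracM mulrCA.
  congr (_ * _); rewrite -mE //; last exact: ratfunX_neq0.
  by rewrite mpolyXE_id rmorph_prod; apply: eq_bigr => j _; rewrite rmorphXn.
have := congr1 (meval t) q0; rewrite meval0 raddf_sum /=.
move=> e0; apply: (mulfI (monomial_neq0 tt w)); rewrite mulr0 mulr_sumr; apply: etrans e0.
by apply: eq_big_seq => i ir; rewrite mevalZ mevalX mE // mulrCA.
Qed.
End Laurent.

(** * Toric charts *)

(** The Euler operator x_k d/dx_k multiplies a monomial by its exponent in x_k, which avoids the
    lowered exponents of the plain derivative. *)
Lemma mderiv_eval (C L : fieldType) (phi : {rmorphism C -> L}) n (v : 'I_n -> L)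
    (p : {mpoly C[n]}) k :
  v k * mmap phi v (p^`M(k)) = \sum_(m <- msupp p) phi p@_m * (m k)%:R * mmap1 v m.
Proof.
rewrite {1}[p]mpolyE linear_sum /= raddf_sum mulr_sumr /=; apply: eq_bigr => m _.
rewrite linearZ /= mmapZ mulrCA -mulrA; congr (_ * _).
rewrite mderivX mmapZ mmapX rmorph_nat mulrCA.
have [m0|m0] := posnP (m k); first by rewrite m0 !mul0r.
congr (_ * _); have lekm : (U_(k) <= m)%MM.
  by apply/mnm_lepP => i; rewrite mnm1E; case: eqP => // <-.
by rewrite -{2}(submK lekm) commr_mmap1_M ?mmap1U 1?mulrC // => i x; apply: mulrC.
Qed.

Section ToricData.
Variables (R : realType) (n : nat).
Local Notation C := R[i].
Local Notation K := (ratfun R).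
Local Notation X := (@ratfunX R).
Variable d : 'rV[C * Z2]_n.

Definition toric_coord (L : fieldType) (phi : C -> L) (y : 'I_2 -> L) (z : C * Z2) : L :=
  phi z.1 * monomial y z.2.

(** Coordinates with scalar 0 do occur after a Nash step; the exponent recorded with them is
    meaningless and is discarded. *)
Definition support (g : Z2) : Prop := exists k, (d 0 k).1 != 0 /\ (d 0 k).2 = g.

Definition spanning : Prop :=
  forall H : Z2 -> Prop, subgroup H -> (forall g, support g -> H g) -> forall g, H g.

Definition mweight (p : {mpoly C[n]}) (m : 'X_{1..n}) : C :=
  p@_m * \prod_k (d 0 k).1 ^+ m k.

Definition mexponent (m : 'X_{1..n}) : Z2 := \sum_k (d 0 k).2 *+ m k.

Lemma mmap1_toric (L : fieldType) (phi : {rmorphism C -> L}) (y : 'I_2 -> L) m :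
  (forall j, y j != 0) ->
  mmap1 (map_mx (toric_coord phi y) d 0) m =
  phi (\prod_k (d 0 k).1 ^+ m k) * monomial y (mexponent m).
Proof.
move=> y0; rewrite /mmap1 monomial_sum // rmorph_prod -big_split; apply: eq_bigr => k _ /=.
by rewrite mxE exprMn monomialMn // rmorphXn.
Qed.

Lemma mmap_toric (L : fieldType) (phi : {rmorphism C -> L}) (y : 'I_2 -> L) p :
  (forall j, y j != 0) ->
  mmap phi (map_mx (toric_coord phi y) d 0) p =
  \sum_(m <- msupp p) phi (mweight p m) * monomial y (mexponent m).
Proof.
by move=> y0; apply: eq_bigr => m _; rewrite mmap1_toric // mulrA -rmorphM.
Qed.

Lemma ratfun_weights p : pullback (map_mx (toric_coord (@ratfunC R) X) d) p = 0 ->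
  forall g, \sum_(m <- msupp p | mexponent m == g) mweight p m = 0.
Proof.
rewrite /pullback mmap_toric; last exact: ratfunX_neq0.
by move=> /laurent_ratfun0 h; apply: laurent_torus0.
Qed.

Lemma weights_eval (L : fieldType) (phi : {rmorphism C -> L}) (y : 'I_2 -> L) p :
  (forall j, y j != 0) ->
  (forall g, \sum_(m <- msupp p | mexponent m == g) mweight p m = 0) ->
  mmap phi (map_mx (toric_coord phi y) d 0) p = 0.
Proof.
move=> y0 h; rewrite mmap_toric //; apply: laurent_group => g.
by rewrite -rmorph_sum h rmorph0.
Qed.

(** Both sides mean that the weights of each exponent sum to 0. *)
Lemma pullback_torus p :
  pullback (map_mx (toric_coord (@ratfunC R) X) d) p = 0 <->
  forall t, torus t -> p.@[map_mx (toric_coord idfun t) d 0] = 0.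
Proof.
split=> [/ratfun_weights h t tt|h].
  exact: (@weights_eval C idfun).
apply: (@weights_eval K (@ratfunC R)); first exact: ratfunX_neq0.
by apply: laurent_torus0 => t tt; apply: etrans (h t tt); rewrite /meval mmap_toric.
Qed.

(* The derivations x_b d/dx_b of the torus preserve the ideal of the surface. *)
Lemma euler_relation (L : fieldType) (phi : {rmorphism C -> L}) (y : 'I_2 -> L) p b :
  (forall j, y j != 0) ->
  pullback (map_mx (toric_coord (@ratfunC R) X) d) p = 0 ->
  let f := map_mx (toric_coord phi y) d in
  \sum_k ((d 0 k).2 0 b)%:~R * f 0 k * mmap phi (f 0) (p^`M(k)) = 0.
Proof.
move=> y0 /ratfun_weights h /=.
have := @laurent_group L _ (msupp p) (fun m => phi (mweight p m)) mexponent
  (fun g => (g 0 b)%:~R * monomial y g).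
move=> H; apply: etrans (H _); last first.
  by move=> g; rewrite -rmorph_sum h rmorph0.
under eq_bigr do rewrite -mulrA mderiv_eval mulr_sumr.
rewrite exchange_big /=; apply: eq_bigr => m _.
set f := map_mx _ d; rewrite (eq_bigr (fun k => phi p@_m * mmap1 (f 0) m *
  (((d 0 k).2 0 b)%:~R * (m k)%:R))); last by move=> k _; ring.
rewrite -mulr_sumr mmap1_toric // /mweight rmorphM /=.
have -> : (mexponent m 0 b)%:~R = \sum_k ((d 0 k).2 0 b)%:~R * (m k)%:R :> L.
  rewrite /mexponent summxE rmorph_sum; apply: eq_bigr => k _ /=.
  by rewrite mulmxnE rmorphMn mulr_natr.
by ring.
Qed.

(** * Tangent vectors at torus points *)

Section Tangent.
Hypothesis span_d : spanning.
Variable t : 'I_2 -> C.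
Hypothesis tt : torus t.

Let f : 'rV[C]_n := map_mx (toric_coord idfun t) d.

Let f0 k : (d 0 k).1 != 0 -> f 0 k != 0.
Proof. by move=> c0; rewrite mxE mulf_neq0 // monomial_neq0. Qed.

Lemma spanning_combination (g : Z2) : exists m : 'I_n -> int,
  (forall k, (d 0 k).1 = 0 -> m k = 0) /\ g = \sum_k (d 0 k).2 *~ m k.
Proof.
apply: (span_d (H := fun g => exists m : 'I_n -> int,
  (forall k, (d 0 k).1 = 0 -> m k = 0) /\ g = \sum_k (d 0 k).2 *~ m k)).
  split; first by exists (fun=> 0); split=> //; rewrite big1 // => k _; rewrite mulr0z.
  move=> _ _ [m [m0 ->]] [m' [m0' ->]]; exists (fun k => m k - m' k); split.
    by move=> k ck; rewrite m0 // m0' // subrr.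
  by rewrite -sumrB; apply: eq_bigr => k _; rewrite mulrzBr.
move=> _ [k [ck <-]]; exists (fun k' => (k' == k)%:Z); split.
  by move=> k' ck'; case: eqP => // e; move: ck; rewrite -e ck' eqxx.
by rewrite (bigD1 k) //= eqxx mulr1z big1 ?addr0 // => k' /negPf ->; rewrite mulr0z.
Qed.

Variable v : 'rV[C]_n.
Hypothesis tangent : forall p, pullback (map_mx (toric_coord (@ratfunC R) X) d) p = 0 ->
  \sum_k v 0 k * (p^`M(k)).@[f 0] = 0.

Let v0 k : (d 0 k).1 = 0 -> v 0 k = 0.
Proof.
move=> ck; have := tangent (p := 'X_k); rewrite /pullback mmapX mmap1U mxE.
rewrite /toric_coord ck rmorph0 mul0r => /(_ erefl).
rewrite (bigD1 k) //= mderivX mnm1E eqxx scale1r (_ : U_(k) - U_(k) = 0)%MM; last first.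
  by apply/mnmP => i; rewrite mnmBE subnn mnm0E.
rewrite mpolyX0 meval1 mulr1.
rewrite big1 ?addr0 // => k' k'k; rewrite mderivX mnm1E eq_sym (negPf k'k) scale0r.
by rewrite meval0 mulr0.
Qed.

(** Logarithmic coordinates of the tangent vector; where f vanishes so does v, and division by 0
    gives the right value 0. *)
Let u k := v 0 k / f 0 k.

Let vE k : v 0 k = f 0 k * u k.
Proof.
rewrite /u; have [ck|ck] := eqVneq (d 0 k).1 0; first by rewrite v0 // mul0r mulr0.
by rewrite mulrC divfK // f0.
Qed.

Let deriv_monomial (m : 'X_{1..n}) :
  \sum_k v 0 k * ('X_[m]^`M(k)).@[f 0] = (\sum_k u k * (m k)%:R) * \prod_k f 0 k ^+ m k.
Proof.
rewrite mulr_suml; apply: eq_bigr => k _; rewrite vE [f 0 k * _]mulrC -!mulrA; congr (_ * _).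
have := @mderiv_eval C C idfun n (f 0) 'X_[m] k; rewrite -[mmap _ _ _]/(_.@[_]) => ->.
by rewrite msuppX big_seq1 mcoeffX eqxx mul1r.
Qed.

(* Each relation between the exponents gives a binomial in the ideal. *)
Lemma relation_tangent (m : 'I_n -> int) : (forall k, (d 0 k).1 = 0 -> m k = 0) ->
  \sum_k (d 0 k).2 *~ m k = 0 -> \sum_k u k * (m k)%:~R = 0.
Proof.
move=> m0 rel.
pose a : 'X_{1..n} := [multinom if (0 <= m k)%R then absz (m k) else 0%N | k < n].
pose b : 'X_{1..n} := [multinom if (0 <= m k)%R then 0%N else absz (m k) | k < n].
have mE k : m k = (a k)%:Z - (b k)%:Z by rewrite !mnmE; case: ifP; lia.
pose c (m : 'X_{1..n}) : C := \prod_k (d 0 k).1 ^+ m k.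
have c_neq0 (m' : 'X_{1..n}) : (forall k, m k = 0 -> m' k = 0%N) -> c m' != 0.
  move=> h; apply/prodf_neq0 => k _; have [ck|ck] := eqVneq (d 0 k).1 0.
    by rewrite h ?expr0 ?oner_eq0 // m0.
  by rewrite expf_neq0.
have ca : c a != 0 by apply: c_neq0 => k mk; rewrite mnmE mk.
have cb : c b != 0 by apply: c_neq0 => k mk; rewrite mnmE mk.
have ab : mexponent a = mexponent b.
  apply/eqP; rewrite -subr_eq0 -rel -sumrB; apply/eqP/eq_bigr => k _.
  by rewrite mE mulrzBr -!pmulrn.
(* The binomial is scaled so that its two terms pull back to the same monomial. *)
have := tangent (p := (c a)^-1 *: 'X_[a] - (c b)^-1 *: 'X_[b]).
rewrite /pullback mmapB !mmapZ !mmapX !mmap1_toric; try exact: ratfunX_neq0.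
rewrite ab !mulrA -!rmorphM /= !mulVf // subrr => /(_ erefl).
rewrite (eq_bigr (fun k => (c a)^-1 * (v 0 k * ('X_[a]^`M(k)).@[f 0]) -
    (c b)^-1 * (v 0 k * ('X_[b]^`M(k)).@[f 0]))); last first.
  by move=> k _; rewrite mderivB !mderivZ mevalB !mevalZ; ring.
rewrite sumrB -!mulr_sumr !deriv_monomial.
have fE m' : c m' != 0 -> \prod_k f 0 k ^+ m' k = c m' * monomial t (mexponent m').
  by move=> _; have := @mmap1_toric C idfun t m' tt; rewrite -/f /mmap1.
have cancel (z x y : C) : z != 0 -> z^-1 * (x * (z * y)) = x * y by move=> z0; field.
rewrite !fE // ab !cancel // -mulrBl.
move/eqP; rewrite mulf_eq0 (negPf (monomial_neq0 tt _)) orbF -sumrB => /eqP e.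
by apply: etrans e; apply: eq_bigr => k _; rewrite mE rmorphB /= mulrBr.
Qed.

(** The logarithmic coordinates respect all relations between the exponents, so they depend linearly
    on the exponent; [w] records their values on the standard basis. Tangent vectors thus come from
    the Lie algebra of the torus. *)
Lemma tangent_weights : exists w : 'I_2 -> C,
  forall k, v 0 k = f 0 k * \sum_b ((d 0 k).2 0 b)%:~R * w b.
Proof.
have [M /all_and2[M0 ME]] := choice (fun b : 'I_2 => spanning_combination (delta_mx 0 b)).
exists (fun b => \sum_k u k * (M b k)%:~R) => k; rewrite vE.
have [ck|ck] := eqVneq (d 0 k).1 0.
  by rewrite /u v0 // /f mxE /toric_coord ck !mul0r.
congr (_ * _); apply/eqP; rewrite -subr_eq0; apply/eqP.
(* The relation that expands the exponent of index [k] in the standard basis, whose vectors are the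
   combinations [M b] of the exponents. *)
have h := @relation_tangent (fun k' => (k' == k)%:Z - \sum_b (d 0 k).2 0 b * M b k').
apply: etrans (h _ _).
- rewrite (eq_bigr (fun k' => u k' * (k' == k)%:R -
      \sum_b ((d 0 k).2 0 b)%:~R * (u k' * (M b k')%:~R))); last first.
    move=> k' _; rewrite rmorphB rmorph_sum /= mulrBr mulr_sumr; congr (_ - _).
    by apply: eq_bigr => b _; rewrite rmorphM /= mulrCA.
  rewrite sumrB (bigD1 k) //= eqxx mulr1 [X in _ + X - _]big1 ?addr0;
    last by move=> k' /negPf ->; rewrite mulr0.
  by congr (_ - _); rewrite exchange_big /=; apply: eq_bigr => b _; rewrite mulr_sumr.
- move=> k' ck'; case: eqP => [e|_]; first by move: ck; rewrite -e ck' eqxx.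
  by rewrite big1 ?subrr // => b _; rewrite M0 // mulr0.
- rewrite (eq_bigr (fun k' => (d 0 k').2 *~ (k' == k)%:Z -
      \sum_b ((d 0 k').2 *~ M b k') *~ (d 0 k).2 0 b)); last first.
    move=> k' _; rewrite mulrzBr mulrz_sumr; congr (_ - _).
    by apply: eq_bigr => b _; rewrite mulrC mulrzA.
  rewrite sumrB (bigD1 k) //= eqxx mulr1z [X in _ + X - _]big1 ?addr0;
    last by move=> k' /negPf ->; rewrite mulr0z.
  rewrite exchange_big /= [X in _ - X](_ : _ = (d 0 k).2) ?subrr //.
  rewrite [RHS]row_sum_delta; apply: eq_bigr => b _; rewrite -mulrz_suml -ME.
  by rewrite -scaler_int intz.
Qed.
End Tangent.
End ToricData.

(** * Nash modification in a chart of the Grassmannian *)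

Section RowSpaces.
Variables (F : fieldType) (m n : nat).
Implicit Types (B : 'M[F]_(m, n)) (v : 'rV[F]_n).

Lemma row_vspaceP B v : v \in row_vspace B <-> exists w : 'rV[F]_m, v = w *m B.
Proof.
rewrite /row_vspace; set s := [seq row i B | i : 'I_m]; split.
  move=> /(@coord_span _ _ _ (in_tuple s)) ->.
  have ms : size s = m by rewrite size_map size_enum_ord.
  exists (\row_i coord (in_tuple s) (cast_ord (esym ms) i) v).
  rewrite mulmx_sum_row (reindex (cast_ord (esym ms))) /=; last first.
    by apply: onW_bij; exists (cast_ord ms) => i; rewrite ?cast_ordK ?cast_ordKV.
  apply: eq_bigr => i _; rewrite mxE; congr (_ *: _).
  rewrite (nth_map i) ?size_enum_ord //; congr (row _ B).
  by apply/val_inj; rewrite /= nth_enum_ord.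
move=> [w ->]; rewrite mulmx_sum_row; apply: memv_suml => i _.
by apply/memvZ/memv_span/map_f; rewrite mem_enum.
Qed.

Lemma dim_row_vspace B (J : 'I_m -> 'I_n) : colsub J B = 1%:M -> \dim (row_vspace B) = m.
Proof.
move=> BJ; pose s := [tuple row i B | i < m].
have -> : row_vspace B = <<s>>%VS by congr <<_>>%VS; rewrite /= val_ord_tuple.
suff /eqP -> : free s by rewrite size_tuple.
apply/freeP => c c0 i; pose w := \row_i c i.
have wB : w *m B = 0.
  rewrite -[RHS]c0 mulmx_sum_row; apply: eq_bigr => k _.
  by rewrite mxE -tnth_nth tnth_mktuple.
have : w *m colsub J B = 0.
  by apply/rowP => k; have /rowP/(_ (J k)) := wB; rewrite !mxE => e; rewrite -[RHS]e;
    apply: eq_bigr => l _; rewrite !mxE.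
by rewrite BJ mulmx1 => /rowP/(_ i); rewrite !mxE.
Qed.

Lemma row_vspace_mul (W : 'M[F]_m) B : W \in unitmx -> row_vspace (W *m B) = row_vspace B.
Proof.
move=> uW; apply/vspaceP => v; apply/idP/idP => /row_vspaceP[w ->]; apply/row_vspaceP.
  by exists (w *m W); rewrite mulmxA.
by exists (w *m invmx W); rewrite mulmxA mulmxKV.
Qed.

Lemma row_vspace_sub B B' : row_vspace B = row_vspace B' ->
  exists W : 'M[F]_m, B = W *m B'.
Proof.
move=> BB'; have /choice[w wE] : forall i, exists w : 'rV_m, row i B = w *m B'.
  move=> i; apply/row_vspaceP; rewrite -BB'; apply/row_vspaceP.
  by exists (delta_mx 0 i); rewrite -rowE.
exists (\matrix_i w i); apply/row_matrixP => i; rewrite wE row_mul rowK //.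
Qed.

Lemma colsub_mul (J : 'I_m -> 'I_n) (W : 'M[F]_m) B : colsub J (W *m B) = W *m colsub J B.
Proof. by apply/matrixP => i j; rewrite !mxE; apply: eq_bigr => k _; rewrite mxE. Qed.

Lemma subspace_matrix (D : 'rV[F]_n -> Prop) : D 0 ->
  (forall a x y, D x -> D y -> D (a *: x + y)) ->
  exists A : 'M[F]_n, forall z, D z <-> (z <= A)%MS.
Proof.
move=> D0 DL; pose inD (A : 'M[F]_n) := forall z : 'rV_n, (z <= A)%MS -> D z.
pose has_rank r := `[< exists A, inD A /\ \rank A = r >].
have ex0 : exists r, has_rank r.
  exists 0%N; apply/asboolP; exists 0; rewrite mxrank0; split=> // z.
  by rewrite submx0 => /eqP ->.
have bound r : has_rank r -> (r <= n)%N.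
  by move=> /asboolP[A [_ <-]]; apply: rank_leq_row.
have [r /asboolP[A [AD Ar]] rmax] := ex_maxnP ex0 bound.
exists A => z; split; last exact: AD.
move=> Dz; apply: contraT => zA; exfalso.
have : has_rank (\rank (A + z)%MS).
  apply/asboolP; exists (A + z)%MS; split=> // y /sub_addsmxP[[u v] /= ->].
  rewrite addrC (mx11_scalar v) mul_scalar_mx; apply: DL => //.
  by apply: AD; apply: submxMl.
move=> /rmax; rewrite -Ar leqNgt => /negP; apply.
have : (A < A + z)%MS.
  by rewrite /ltmx addsmxSl /=; apply: contra zA; apply: submx_trans; apply: addsmxSr.
by rewrite ltmxErank => /andP[].
Qed.

(** Serves to find a polynomial of the ideal with a prescribed gradient, D being the space of
    gradients at a point. *)
Lemma double_orthogonal (D : 'rV[F]_n -> Prop) z : D 0 ->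
  (forall a x y, D x -> D y -> D (a *: x + y)) ->
  (forall v, (forall g, D g -> g *m v^T = 0) -> z *m v^T = 0) -> D z.
Proof.
move=> D0 DL h; have [A DA] := subspace_matrix D0 DL; apply/DA; rewrite submxE.
apply/eqP/matrixP => i j; rewrite [RHS]mxE.
have := h (col j (cokermx A))^T; rewrite trmxK => hj.
have : z *m col j (cokermx A) = 0.
  apply: hj => g /DA gA; rewrite colE mulmxA.
  by move: gA; rewrite submxE => /eqP ->; rewrite mul0mx.
by rewrite colE mulmxA -colE => /matrixP/(_ i 0); rewrite !mxE.
Qed.
End RowSpaces.

(** The numerator of p at the fractions num i / den, over the denominator den^(msize p). *)
Definition homogenization (C : fieldType) n m (num : 'I_n -> {mpoly C[m]}) den
    (p : {mpoly C[n]}) : {mpoly C[m]} :=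
  \sum_(k <- msupp p) p@_k *: \prod_i num i ^+ k i * den ^+ (msize p - mdeg k).

Lemma homogenizationE (C L : fieldType) (phi : {rmorphism C -> L}) n m
    (num : 'I_n -> {mpoly C[m]}) den (p : {mpoly C[n]}) (y : 'I_m -> L) (z : 'I_n -> L) :
  (forall i, mmap phi y (num i) = z i * mmap phi y den) ->
  mmap phi y (homogenization num den p) = mmap phi y den ^+ msize p * mmap phi z p.
Proof.
move=> zE; rewrite raddf_sum [mmap phi z p]/mmap mulr_sumr /=.
apply: eq_big_seq => k kp; rewrite -scalerAl mmapZ rmorphM rmorph_prod rmorphXn /=.
rewrite [RHS]mulrCA; congr (_ * _); rewrite -[in RHS](@subnK (mdeg k) (msize p)); last first.
  by apply/ltnW/msize_mdeg_lt.
rewrite exprD -mulrA mulrC; congr (_ * _).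
rewrite mdegE expr_sum -big_split; apply: eq_bigr => i _ /=.
by rewrite rmorphXn /= zE exprMn mulrC.
Qed.

HB.instance Definition _ (R : realType) n (f : 'rV[ratfun R]_n) :=
  GRing.RMorphism.copy (pullback f) (mmap (@ratfunC R) (f 0)).

(** * Relations that hold on a chart of the Nash modification *)

Section NashChart.
Variables (R : realType) (n : nat).
Local Notation C := R[i].
Local Notation K := (ratfun R).
Variables (X : 'rV[C]_n -> Prop) (f : 'rV[K]_n) (J : 'I_2 -> 'I_n) (G : 'M[K]_(2, n)).
Hypothesis vanishE : forall p, vanishing_ideal X p <-> pullback f p = 0.
Hypothesis tangentG : forall p, pullback f p = 0 ->
  forall a, \sum_k G a k * pullback f (p^`M(k)) = 0.
Hypothesis GJ : colsub J G = 1%:M.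

Local Notation f' := (row_mx f (mxvec G)).

(* Near a non-singular point the tangent spaces are cut out by polynomials
   [h k] of the ideal whose Jacobian matrix at the point is normalized; the
   generic tangent space is then given by Cramer's rule, with a denominator
   equal to 1 at the point. *)
Lemma gauss_specialize (x : 'rV[C]_n) (B : 'M[C]_(2, n)) :
  X x -> is_tangent_space X x (row_vspace B) -> colsub J B = 1%:M ->
  forall p, pullback f' p = 0 -> p.@[row_mx x (mxvec B) 0] = 0.
Proof.
move=> Xx tan BJ p fp.
pose grad (q : {mpoly C[n]}) : 'rV[C]_n := \row_k (q^`M(k)).@[x 0].
(* The prescribed gradient is the linear form v_k minus the sum of the B a k v_(J a); it vanishes on
   the tangent space because B is normalized on J. *)
have /choice[h hP] : forall k, exists q, vanishing_ideal X q /\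
    grad q = \row_l ((l == k)%:R - \sum_a B a k * (l == J a)%:R).
  move=> k; set z := \row_l _.
  apply: (@double_orthogonal _ _ (fun z => exists q, vanishing_ideal X q /\ grad q = z)).
  - exists 0; split; first by move=> y _; rewrite meval0.
    by apply/rowP => l; rewrite !mxE linear0 meval0.
  - move=> a _ _ [q [vq <-]] [q' [vq' <-]]; exists (a *: q + q'); split.
      by move=> y Xy; rewrite mevalD mevalZ vq // vq' // mulr0 addr0.
    by apply/rowP => l; rewrite !mxE mderivD mderivZ mevalD mevalZ.
  - move=> v hv; have /row_vspaceP[w vE] : v \in row_vspace B.
      apply/tan => q vq.
      have := hv (grad q) (ex_intro _ q (conj vq erefl)).
      move=> /matrixP/(_ 0 0); rewrite !mxE => e; apply: etrans e.
      by apply: eq_bigr => l _; rewrite !mxE mulrC.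
    have vJ a : v 0 (J a) = w 0 a.
      have : (w *m colsub J B) 0 a = w 0 a by rewrite BJ mulmx1.
      by move=> <-; rewrite vE !mxE; apply: eq_bigr => b _; rewrite mxE.
    apply/matrixP => i j; rewrite !ord1 !mxE.
    rewrite (eq_bigr (fun l => (l == k)%:R * v 0 l -
      \sum_a B a k * ((l == J a)%:R * v 0 l))); last first.
      move=> l _; rewrite !mxE mulrBl mulr_suml; congr (_ - _).
      by apply: eq_bigr => a _; rewrite mulrA.
    rewrite sumrB (bigD1 k) //= eqxx mul1r big1 => [|l /negPf ->]; last by rewrite mul0r.
    rewrite addr0 exchange_big /= vE mxE -sumrB big1 // => a _.
    rewrite -mulr_sumr (bigD1 (J a)) //= eqxx mul1r big1 => [|l /negPf ->]; last by rewrite mul0r.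
    by rewrite addr0 -vE vJ mulrC subrr.
(* The Jacobian matrix of the [h k], completed in the columns J so as to be the identity at x.
   Generically it sends the transpose of G to that of B, so num / den is the transpose of G. *)
pose M : 'M[{mpoly C[n]}]_n :=
  \matrix_(k, l) ((h k)^`M(l) + \sum_a (B a k)%:MP_[n] * (l == J a)%:R).
pose BT : 'M[{mpoly C[n]}]_(n, 2) := \matrix_(k, a) (B a k)%:MP_[n].
pose num := \adj M *m BT; pose den := \det M.
have Mx : map_mx (meval (x 0)) M = 1%:M.
  apply/matrixP => k l; rewrite !mxE mevalD [X in _ + X]raddf_sum.
  have [_ /rowP/(_ l)] := hP k; rewrite !mxE => ->.
  rewrite eq_sym [X in _ + X](eq_bigr (fun a => B a k * (l == J a)%:R)) ?subrK // => a _.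
  by rewrite /= mevalM mevalC rmorph_nat.
have denx : den.@[x 0] = 1 by rewrite -[LHS]det_map_mx Mx det1.
have numx k a : (num k a).@[x 0] = B a k.
  have : map_mx (meval (x 0)) num = map_mx (meval (x 0)) BT.
    rewrite map_mxM map_mx_adj Mx.
    by rewrite -[\adj _]mul1mx mul_mx_adj det1 mul1mx.
  by move=> /matrixP/(_ k a); rewrite !mxE => ->; rewrite mevalC.
have denf0 : pullback f den != 0.
  apply/eqP => /vanishE/(_ _ Xx) /eqP.
  by rewrite denx oner_eq0.
have numf k a : pullback f (num k a) = G a k * pullback f den.
  have MG : map_mx (pullback f) M *m G^T = map_mx (pullback f) BT.
    apply/matrixP => k' a'; rewrite !mxE.
    rewrite (eq_bigr (fun l => G a' l * pullback f ((h k')^`M(l)) +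
      \sum_b pullback f (B b k')%:MP * ((l == J b)%:R * G a' l))); last first.
      move=> l _; rewrite !mxE rmorphD [X in _ + X]rmorph_sum mulrDl [_ * G _ _]mulrC; congr (_ + _).
      by rewrite mulr_suml; apply: eq_bigr => b _; rewrite rmorphM rmorph_nat mulrA.
    rewrite big_split /= tangentG ?add0r; last by apply/vanishE; case: (hP k').
    rewrite exchange_big /= (bigD1 a') //= [X in _ + X]big1 ?addr0.
      rewrite -mulr_sumr (bigD1 (J a')) //= eqxx mul1r big1 => [|l /negPf ->]; last by rewrite mul0r.
      by move/matrixP/(_ a' a'): GJ; rewrite !mxE eqxx => ->; rewrite addr0 mulr1.
    move=> b ba; rewrite -mulr_sumr (bigD1 (J b)) //= eqxx mul1r big1 => [|l /negPf ->]; last by rewrite mul0r.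
    by move/matrixP/(_ a' b): GJ; rewrite !mxE eq_sym (negPf ba) => ->; rewrite addr0 mulr0.
  have : map_mx (pullback f) num = pullback f den *: G^T.
    rewrite map_mxM -MG mulmxA map_mx_adj mul_adj_mx det_map_mx.
    by rewrite mul_scalar_mx.
  by move=> /matrixP/(_ k a); rewrite !mxE mulrC.
pose num' := row_mx (\row_k ('X_k * den)) (mxvec num^T) 0.
(* This is a relation on X itself, and at x, where den is 1, it takes the value of p. *)
pose q := homogenization num' den p.
have num'E (L : fieldType) (phi : {rmorphism C -> L}) (y : 'rV[L]_n) (D : 'M[L]_(2, n)) :
    (forall k a, mmap phi (y 0) (num k a) = D a k * mmap phi (y 0) den) ->
    forall i, mmap phi (y 0) (num' i) = row_mx y (mxvec D) 0 i * mmap phi (y 0) den.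
  move=> hD i; rewrite /num'; case: (splitP i) => k ik.
    rewrite (_ : i = lshift _ k) ?row_mxEl; last exact/val_inj.
    by rewrite mxE rmorphM /= mmapX mmap1U.
  rewrite (_ : i = rshift _ k) ?row_mxEr; last exact/val_inj.
  by case: (mxvec_indexP k) => a l; rewrite !mxvecE mxE.
have qf : pullback f q = 0.
  rewrite /pullback (@homogenizationE _ _ _ _ _ num' den p (f 0) (f' 0)); last exact: num'E numf.
  by rewrite [X in _ * X]fp mulr0.
have := (vanishE q).2 qf x Xx; rewrite /meval.
rewrite (@homogenizationE _ _ _ _ _ num' den p (x 0) (row_mx x (mxvec B) 0)).
  by rewrite [mmap _ _ den]denx expr1n mul1r.
by apply: num'E => k a; rewrite [mmap _ _ den]denx mulr1; apply: numx.
Qed.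

(** The closed set to be tested against the Gauss graph. It covers the whole Grassmannian: a plane
    outside the chart J has no basis normalized on J and meets the condition vacuously. *)
Definition satisfies_relations (x : 'rV[C]_n) (T : {vspace 'rV[C]_n}) : Prop :=
  \dim T = 2%N /\ forall B, colsub J B = 1%:M -> T = row_vspace B ->
    forall p, pullback f' p = 0 -> p.@[row_mx x (mxvec B) 0] = 0.

Lemma relations_closed : grass_closed 2 satisfies_relations.
Proof.
split=> [x T [] //|J'].
pose PY : 'rV[{mpoly C[n + 2 * n]}]_(n + 2 * n) := \row_i 'X_i.
pose PB : 'M_(2, n) := vec_mx (rsubmx PY).
pose den := \det (colsub J PB); pose num := \adj (colsub J PB) *m PB.
pose num' := row_mx (\row_k (lsubmx PY 0 k * den)) (mxvec num) 0.
have evY (y : 'rV[C]_(n + 2 * n)) : map_mx (meval (y 0)) PY = y.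
  by apply/rowP => i; rewrite !mxE mevalXU.
have evB (y : 'rV[C]_(n + 2 * n)) : map_mx (meval (y 0)) PB = vec_mx (rsubmx y).
  by rewrite map_vec_mx map_rsubmx evY.
have evD (y : 'rV[C]_(n + 2 * n)) :
    map_mx (meval (y 0)) (colsub J PB) = colsub J (vec_mx (rsubmx y)).
  by rewrite map_mxsub evB.
have evden (y : 'rV[C]_(n + 2 * n)) : den.@[y 0] = \det (colsub J (vec_mx (rsubmx y))).
  by rewrite -evD det_map_mx.
have evhom (y : 'rV[C]_(n + 2 * n)) (B : 'M[C]_(2, n)) p :
    \adj (colsub J (vec_mx (rsubmx y))) *m vec_mx (rsubmx y) = den.@[y 0] *: B ->
    (homogenization num' den p).@[y 0] =
    den.@[y 0] ^+ msize p * p.@[row_mx (lsubmx y) (mxvec B) 0].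
  move=> hB; apply: (@homogenizationE _ _ idfun) => i.
  rewrite -!/(meval _ _) /num'; case: (splitP i) => k ik.
    rewrite (_ : i = lshift _ k) ?row_mxEl; last exact/val_inj.
    by rewrite mxE mevalM !mxE mevalXU.
  rewrite (_ : i = rshift _ k) ?row_mxEr; last exact/val_inj.
  case: (mxvec_indexP k) => a l; rewrite !mxvecE.
  have : map_mx (meval (y 0)) num = den.@[y 0] *: B by rewrite map_mxM map_mx_adj evD evB.
  by move=> /matrixP/(_ a l); rewrite !mxE mulrC.
(* A plane of the chart J' is renormalized on the columns J by Cramer's rule; the factor [den] makes
   the equation trivial outside the chart J. *)
exists (fun P => (exists a b, P = PB a (J' b) - (a == b)%:R) \/
  (exists p, pullback f' p = 0 /\ P = den * homogenization num' den p)) => y.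
rewrite /grass_chart; set By := vec_mx (rsubmx y).
have EB : map_mx (meval (y 0)) PB = By := evB y; split.
  move=> [BJ' [_ rel]] P [[a [b ->]]|[p [fp ->]]].
    rewrite mevalB rmorph_nat; have /matrixP/(_ a b) := BJ'; rewrite -EB !mxE => ->.
    by rewrite subrr.
  rewrite mevalM; have [->|d0] := eqVneq den.@[y 0] 0; first by rewrite mul0r.
  have uD : colsub J By \in unitmx by rewrite unitmxE -evden unitfE.
  pose B := invmx (colsub J By) *m By.
  rewrite (evhom y B) ?rel ?mulr0 //.
  - by rewrite colsub_mul mulVmx.
  - by rewrite row_vspace_mul // unitmx_inv.
  - rewrite /B /invmx uD -scalemxAl scalerA -/By -evden divff // scale1r //.
move=> hS; have BJ' : colsub J' By = 1%:M.
  apply/matrixP => a b; have := hS _ (or_introl (ex_intro _ a (ex_intro _ b erefl))).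
  rewrite mevalB rmorph_nat => /eqP; rewrite subr_eq0 => /eqP.
  by rewrite -EB !mxE.
split=> //; split; first exact: dim_row_vspace BJ'.
move=> B BJ /esym/row_vspace_sub[W BW] p fp.
have WD : W *m colsub J By = 1%:M by rewrite -colsub_mul -BW.
have uD : colsub J By \in unitmx by case: (mulmx1_unit WD).
have d0 : den.@[y 0] != 0 by rewrite evden -unitfE -unitmxE.
have := hS _ (or_intror (ex_intro _ p (conj fp erefl))).
rewrite mevalM (evhom y B); last first.
  rewrite BW (_ : W = invmx (colsub J By)); last first.
    by rewrite -[W]mulmx1 -(mulmxV uD) mulmxA WD mul1mx.
  by rewrite /invmx uD -scalemxAl scalerA evden divff ?scale1r // -evden.
move/eqP; rewrite !mulf_eq0 expf_eq0 (negPf d0) andbF /=.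
by move/eqP.
Qed.

Lemma nash_relations p : pullback f' p = 0 ->
  vanishing_ideal (grass_chart J (nash_modification 2 X)) p.
Proof.
move=> fp y [BJ nash]; have [|y' U [Xy tan dimU]|_ rel] := nash satisfies_relations.
- exact: relations_closed.
- by split=> // B BJ' UB; apply: gauss_specialize; rewrite -?UB.
have := rel _ BJ erefl p fp.
by rewrite vec_mxK hsubmxK.
Qed.
End NashChart.

Definition detZ (g h : Z2) : int := g 0 0 * h 0 1 - g 0 1 * h 0 0.

Lemma unitmx2 (F : fieldType) (M : 'M[F]_2) :
  M 0 0 * M 1 1 - M 0 1 * M 1 0 != 0 -> M \in unitmx.
Proof.
set D := _ - _ => D0; pose N : 'M[F]_2 := \matrix_(i, j)
  ((if i == 0 then if j == 0 then M 1 1 else - M 0 1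
    else if j == 0 then - M 1 0 else M 0 0) / D).
suff : M *m N = 1%:M by case/mulmx1_unit.
apply/matrixP => i j; rewrite !mxE big_ord_recl big_ord1 (_ : lift ord0 ord0 = 1); last exact/val_inj.
by case: (ord2P i) => ->; case: (ord2P j) => ->; rewrite !mxE /=; move: D0; rewrite /D => D0; field.
Qed.

(** * The Nash step on scalars and exponents *)

Section ToricStep.
Variables (R : realType) (n : nat).
Local Notation C := R[i].
Local Notation K := (ratfun R).
Local Notation X := (@ratfunX R).
Variables (d : 'rV[C * Z2]_n) (J : 'I_2 -> 'I_n).
Hypothesis cJ : forall a, (d 0 (J a)).1 != 0.
Hypothesis detJ : detZ (d 0 (J 0)).2 (d 0 (J 1)).2 != 0.

Let Gam : 'M[C]_(2, n) := \matrix_(b, k) ((d 0 k).2 0 b)%:~R.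

Let GamJ : colsub J Gam \in unitmx.
Proof.
apply: unitmx2; rewrite !mxE -!rmorphM -rmorphB intr_eq0; move: detJ; rewrite /detZ.
by apply: contraNneq => e; apply/eqP; rewrite -[RHS]e; ring.
Qed.

Let Delta : 'M[C]_(2, n) := invmx (colsub J Gam) *m Gam.

(** The normalized basis of the tangent plane. The plane is spanned by the images of the coordinates
    under x_b d/dx_b, and normalizing on J replaces the exponents by their coordinates [Delta] in
    the basis formed by the exponents of index J. *)
Definition nash_data : 'M[C * Z2]_(2, n) :=
  \matrix_(a, k) ((d 0 k).1 / (d 0 (J a)).1 * Delta a k, (d 0 k).2 - (d 0 (J a)).2).

Definition nash_row : 'rV[C * Z2]_(n + 2 * n) := row_mx d (mxvec nash_data).

Section Evaluation.
Variables (L : fieldType) (phi : {rmorphism C -> L}) (y : 'I_2 -> L).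
Hypothesis y0 : forall j, y j != 0.
Let f := map_mx (toric_coord phi y) d.
Let B := map_mx (toric_coord phi y) nash_data.
Let A : 'M[L]_(2, n) := \matrix_(b, k) (((d 0 k).2 0 b)%:~R * f 0 k).
Let W : 'M[L]_2 := \matrix_(a, b) (phi (invmx (colsub J Gam) a b) / f 0 (J a)).

Lemma nash_data_mul : B = W *m A.
Proof.
apply/matrixP => a k; rewrite !mxE /toric_coord !rmorphM /= monomialB //.
rewrite rmorph_sum mulr_sumr mulr_suml; apply: eq_bigr => b _.
rewrite !mxE rmorphM rmorph_int fmorphV /toric_coord.
by field; rewrite fmorph_eq0 cJ monomial_neq0.
Qed.

Lemma nash_data_norm : colsub J B = 1%:M.
Proof.
apply/matrixP => a b; rewrite 2!mxE [nash_data _ _]mxE [RHS]mxE /toric_coord /=.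
have -> : Delta a (J b) = (a == b)%:R.
  have : colsub J Delta = 1%:M by rewrite colsub_mul mulVmx.
  by move=> /matrixP/(_ a b); rewrite !mxE.
case: eqP => [->|_]; last by rewrite mulr0 rmorph0 mul0r.
by rewrite subrr monomial0 mulr1 mulr1 divff // rmorph1.
Qed.

Lemma nash_data_unit : W \in unitmx.
Proof.
have : W *m colsub J A = 1%:M by rewrite -colsub_mul -nash_data_mul nash_data_norm.
by case/mulmx1_unit.
Qed.

Lemma nash_data_row_vspace : row_vspace B = row_vspace A.
Proof. by rewrite nash_data_mul row_vspace_mul // nash_data_unit. Qed.

Lemma nash_data_tangent p : pullback (map_mx (toric_coord (@ratfunC R) X) d) p = 0 ->
  forall a, \sum_k B a k * mmap phi (f 0) (p^`M(k)) = 0.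
Proof.
move=> fp a; rewrite nash_data_mul.
under eq_bigr do rewrite mxE mulr_suml.
rewrite exchange_big big1 //= => b _.
under eq_bigr do rewrite -mulrA.
rewrite -mulr_sumr; under eq_bigr do rewrite mxE.
by rewrite (euler_relation phi b y0 fp) mulr0.
Qed.
End Evaluation.

(** By Cramer's rule the entries of [Delta] are quotients of determinants of exponents, so a
    coefficient vanishes exactly when two exponents are dependent. *)
Lemma support_nash_row g : support nash_row g <->
  [\/ support d g,
      exists h, [/\ support d h, detZ h (d 0 (J 1)).2 != 0 & g = h - (d 0 (J 0)).2]
    | exists h, [/\ support d h, detZ (d 0 (J 0)).2 h != 0 & g = h - (d 0 (J 1)).2]].
Proof.
have DJ : (detZ (d 0 (J 0)).2 (d 0 (J 1)).2)%:~R != 0 :> C by rewrite intr_eq0.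
have GD b k : ((d 0 k).2 0 b)%:~R =
    ((d 0 (J 0)).2 0 b)%:~R * Delta 0 k + ((d 0 (J 1)).2 0 b)%:~R * Delta 1 k :> C.
  have : colsub J Gam *m Delta = Gam by rewrite mulKVmx.
  move=> /matrixP/(_ b k); rewrite !mxE big_ord_recl big_ord1 (_ : lift ord0 ord0 = 1);
    last exact/val_inj.
  by rewrite !mxE => <-.
have Delta0 k : Delta 0 k != 0 <-> detZ (d 0 k).2 (d 0 (J 1)).2 != 0.
  rewrite -(intr_eq0 C) (_ : _%:~R = Delta 0 k * (detZ (d 0 (J 0)).2 (d 0 (J 1)).2)%:~R).
    by rewrite mulf_eq0 (negPf DJ) orbF.
  by rewrite /detZ !rmorphB !rmorphM /= !(GD _ k); ring.
have Delta1 k : Delta 1 k != 0 <-> detZ (d 0 (J 0)).2 (d 0 k).2 != 0.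
  rewrite -(intr_eq0 C) (_ : (detZ _ (d 0 k).2)%:~R = Delta 1 k * (detZ (d 0 (J 0)).2 (d 0 (J 1)).2)%:~R).
    by rewrite mulf_eq0 (negPf DJ) orbF.
  by rewrite /detZ !rmorphB !rmorphM /= !(GD _ k); ring.
have coefE a k : (d 0 k).1 / (d 0 (J a)).1 * Delta a k != 0 =
    ((d 0 k).1 != 0) && (Delta a k != 0).
  by rewrite !mulf_eq0 invr_eq0 (negPf (cJ a)) orbF negb_or.
split.
  move=> [i []]; rewrite /nash_row; case: (splitP i) => k ik.
    rewrite (_ : i = lshift _ k) ?row_mxEl; last exact/val_inj.
    by move=> ck gk; apply: Or31; exists k.
  rewrite (_ : i = rshift _ k) ?row_mxEr; last exact/val_inj.
  case: (mxvec_indexP k) => a l; rewrite mxvecE mxE /= coefE => /andP[cl dl] <-.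
  case: (ord2P a) dl => -> dl; [apply: Or32 | apply: Or33]; exists (d 0 l).2; split=> //.
  - by exists l.
  - exact/Delta0.
  - by exists l.
  - exact/Delta1.
move=> [[k [ck gk]]|[_ [[k [ck <-]] dk ->]]|[_ [[k [ck <-]] dk ->]]].
- by exists (lshift _ k); rewrite /nash_row row_mxEl.
- exists (rshift _ (mxvec_index 0 k)); rewrite /nash_row row_mxEr mxvecE mxE /= coefE ck.
  by split=> //; apply/Delta0.
- exists (rshift _ (mxvec_index 1 k)); rewrite /nash_row row_mxEr mxvecE mxE /= coefE ck.
  by split=> //; apply/Delta1.
Qed.
End ToricStep.

Section ToricCharts.
Variable R : realType.
Local Notation C := R[i].
Local Notation K := (ratfun R).
Local Notation X := (@ratfunX R).

Record toric_chart (U : affine_chart R) (d : 'rV[C * Z2]_(adim U)) : Prop := ToricChart {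
  toric_coords : coords U = map_mx (toric_coord (@ratfunC R) X) d;
  toric_vanish : forall p, vanishing_ideal (@points R U) p <-> pullback (coords U) p = 0;
  toric_points : forall t, torus t -> @points R U (map_mx (toric_coord idfun t) d);
  toric_spanning : spanning d
}.

(** The directions of the torus orbit exhaust the tangent space at a torus point, which is therefore
    a plane. *)
Lemma gauss_graph_torus (U : affine_chart R) d (J : 'I_2 -> 'I_(adim U)) t :
  toric_chart d -> (forall a, (d 0 (J a)).1 != 0) ->
  detZ (d 0 (J 0)).2 (d 0 (J 1)).2 != 0 -> torus t ->
  gauss_graph 2 (@points R U) (map_mx (toric_coord idfun t) d)
    (row_vspace (map_mx (toric_coord idfun t) (nash_data d J))).
Proof.
move=> [cE vE pE sp] cJ detJ tt; split; first exact: pE.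
  move=> v; split.
    move=> /row_vspaceP[w ->] p /vE; rewrite cE => fp.
    under eq_bigr do rewrite mxE mulr_suml.
    rewrite exchange_big big1 //= => a _; under eq_bigr do rewrite -mulrA.
    rewrite -mulr_sumr; have := @nash_data_tangent R _ d J cJ C idfun t tt p fp a.
    by move=> e; rewrite [X in _ * X]e mulr0.
  move=> h; rewrite nash_data_row_vspace //; apply/row_vspaceP.
  have [|w wE] := @tangent_weights R _ d sp t tt v.
    by move=> p fp; apply: h; apply/vE; rewrite cE.
  exists (\row_b w b); apply/rowP => k; rewrite wE !mxE mulr_sumr; apply: eq_bigr => b _.
  by rewrite !mxE mulrCA [RHS]mulrCA; congr (_ * _); rewrite mulrC.
by apply: dim_row_vspace (nash_data_norm _ _ _ _).
Qed.

Lemma toric_nash_step (X0 U : affine_chart R) k d (J : 'I_2 -> 'I_(adim U)) :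
  nash_chart X0 k U -> toric_chart d -> (forall a, (d 0 (J a)).1 != 0) ->
  detZ (d 0 (J 0)).2 (d 0 (J 1)).2 != 0 ->
  exists U' (d' : 'rV[C * Z2]_(adim U')), [/\ nash_chart X0 k.+1 U', toric_chart d' &
    forall g, support d' g <-> [\/ support d g,
      exists h, [/\ support d h, detZ h (d 0 (J 1)).2 != 0 & g = h - (d 0 (J 0)).2]
    | exists h, [/\ support d h, detZ (d 0 (J 0)).2 h != 0 & g = h - (d 0 (J 1)).2]]].
Proof.
move=> nU tU cJ detJ; have [cE vE pE sp] := tU.
pose G := map_mx (toric_coord (@ratfunC R) X) (nash_data d J).
pose X' := grass_chart J (nash_modification 2 (@points R U)).
pose f' := row_mx (coords U) (mxvec G).
have f'E : f' = map_mx (toric_coord (@ratfunC R) X) (nash_row d J).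
  by rewrite /f' cE /nash_row map_row_mx map_mxvec.
have pE' t : torus t -> X' (map_mx (toric_coord idfun t) (nash_row d J)).
  move=> tt; rewrite /nash_row map_row_mx map_mxvec /X' /grass_chart row_mxKr row_mxKl mxvecK.
  split; first exact: nash_data_norm.
  by move=> Z _; apply; apply: gauss_graph_torus.
(* One inclusion holds because the chart contains the torus points, the other because relations
   persist on the closure. *)
have vE' p : vanishing_ideal X' p <-> pullback f' p = 0.
  split.
    by move=> vp; rewrite f'E; apply/pullback_torus => t tt; apply/vp/pE'.
  apply: nash_relations => //.
    move=> q; rewrite cE => fq a; apply: nash_data_tangent => //; exact: ratfunX_neq0.
  apply: nash_data_norm => //; exact: ratfunX_neq0.
have sE g := support_nash_row cJ detJ g.
exists (AffineChart X' f'), (nash_row d J); split=> //; first exact: NashChartS.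
split=> // H sH HS; apply: sp => // g gd; apply: HS; apply/sE; exact: Or31.
Qed.
End ToricCharts.

(** * Values of the monomials *)

Lemma primitive_completion (a0 a1 : int) : (a0, a1) != (0, 0) ->
  exists d l0 l1 m0 m1 : int, [/\ 0 < d, a0 = d * l0, a1 = d * l1 & l0 * m1 - l1 * m0 = 1].
Proof.
move=> a_neq0; have [u [v uv]] := Bezoutz a0 a1; pose d := gcdz a0 a1.
have d0 : 0 < d.
  rewrite lt_def andbT; apply: contra a_neq0.
  by rewrite gcdz_eq0 xpair_eqE.
have /dvdzP[l0 l0E] := dvdz_gcdl a0 a1; have /dvdzP[l1 l1E] := dvdz_gcdr a0 a1.
rewrite -/d in l0E l1E uv; clearbody d.
exists d, l0, l1, (- v), u; split; rewrite // ?[d * _]mulrC //.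
by apply: (mulfI (lt0r_neq0 d0)); rewrite mulr1 -[RHS]uv l0E l1E; ring.
Qed.

(** The first non-zero form is a positive multiple of a primitive form L, which is completed to a
    unimodular pair (L, M). If a second form remains, it equals kappa M on the kernel of L: the sign
    of kappa is moved into M, and for kappa = 0 only L matters. *)
Lemma lex_normal_form (a0 a1 b0 b1 : int) : exists o l0 l1 m0 m1,
  `|l0 * m1 - l1 * m0| = 1 /\ forall x y : int,
    nonneg OrderLex (a0 * x + a1 * y, b0 * x + b1 * y) =
    nonneg o (l0 * x + l1 * y, m0 * x + m1 * y).
Proof.
have [[-> ->]|a_neq0] := eqVneq (a0, a1) (0, 0).
  have [[-> ->]|b_neq0] := eqVneq (b0, b1) (0, 0).
    by exists OrderTrivial, 1, 0, 0, 1; split=> // x y /=; lia.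
  have [d [l0 [l1 [m0 [m1 [d0 -> -> dt]]]]]] := primitive_completion b_neq0.
  exists OrderFirst, l0, l1, m0, m1; split=> [|x y]; first by rewrite dt.
  by rewrite /= !mul0r addr0 ltxx eqxx -!mulrA -mulrDr /= pmulr_rge0.
have [d [l0 [l1 [m0 [m1 [d0 -> -> dt]]]]]] := primitive_completion a_neq0.
pose kappa := l0 * b1 - l1 * b0.
have lev (x y : int) : 0 < d -> l0 * x + l1 * y = 0 ->
    b0 * x + b1 * y = kappa * (m0 * x + m1 * y).
  move=> _ lxy; transitivity ((b0 * x + b1 * y) * (l0 * m1 - l1 * m0)).
    by rewrite dt mulr1.
  transitivity (kappa * (m0 * x + m1 * y) + (b0 * m1 - b1 * m0) * (l0 * x + l1 * y)).
    by rewrite /kappa; ring.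
  by rewrite lxy mulr0 addr0.
exists (if kappa == 0 then OrderFirst else OrderLex), l0, l1,
  (if kappa < 0 then - m0 else m0), (if kappa < 0 then - m1 else m1).
split; first by case: ifP => _; lia.
move=> x y; rewrite /= -!mulrA -mulrDr pmulr_rgt0 // mulf_eq0 (gt_eqF d0) /=.
have := lev x y d0; set L := l0 * x + l1 * y; set B := b0 * x + b1 * y.
move=> hB; case: (ltgtP kappa 0) => k0 /=.
- have -> : - m0 * x + - m1 * y = - (m0 * x + m1 * y) by ring.
  by case: eqVneq => // L0; rewrite hB // nmulr_rge0 // oppr_ge0.
- by case: eqVneq => // L0; rewrite hB // pmulr_rge0.
- by case: eqVneq => L0; rewrite ?orbF; [rewrite hB // k0 mul0r lexx orbT L0 lexx|rewrite le_eqVlt eq_sym (negPf L0)].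
Qed.

(** * The valuation ring and the signs of the values of monomials *)

Section ValuationRing.
Variables (R : realType) (Gam : porderZmodType) (hGam : ordered_group Gam).
Local Notation C := R[i].
Local Notation K := (ratfun R).
Local Notation X := (@ratfunX R).
Variable nu : K -> option Gam.
Hypothesis hnu : valuation nu.
Hypothesis hnuC : forall c : C, c != 0 -> nu (ratfunC c) = Some 0.

Definition val_ring x : Prop := vle (Some 0) (nu x).
Definition val_max x : Prop := vlt (Some 0) (nu x).

Let le_tr := @le_trans _ Gam.

Lemma ordered_addr_ge0 (g h : Gam) : 0 <= g -> 0 <= h -> 0 <= g + h.
Proof.
move=> g0 h0; apply: le_trans h0 _.
by have := hGam.2 0 g h g0; rewrite add0r.
Qed.

Lemma nu_some x : x != 0 -> exists g, nu x = Some g.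
Proof.
case e : (nu x) => [g|]; first by exists g.
by move/(valuation_infty hnu): e => ->; rewrite eqxx.
Qed.

Lemma nu0 : nu 0 = None.
Proof. exact/(valuation_infty hnu). Qed.

Lemma nu1 : nu 1 = Some 0.
Proof. by rewrite -(hnuC (oner_neq0 _)) rmorph1. Qed.

Lemma val_ring_const c : val_ring (ratfunC c).
Proof.
have [->|c0] := eqVneq c 0; first by rewrite /val_ring rmorph0 nu0.
by rewrite /val_ring hnuC //= lexx.
Qed.

Lemma val_ringM x y : val_ring x -> val_ring y -> val_ring (x * y).
Proof.
rewrite /val_ring (valuationM hnu); case: (nu x) (nu y) => [g|] [h|] //=.
exact: ordered_addr_ge0.
Qed.

Lemma val_ringD x y : val_ring x -> val_ring y -> val_ring (x + y).
Proof.
rewrite /val_ring => hx hy; have := valuationD hnu x y.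
rewrite /vmin; case: ifP => _; case: (nu (x + y)) => [k|//].
  by move: hx; case: (nu x) => //= g; apply: le_tr.
by move: hy; case: (nu y) => //= g; apply: le_tr.
Qed.

Lemma val_ring_subring : subring val_ring.
Proof.
split=> [|x y hx hy|]; [by rewrite /val_ring nu1 /=| |exact: val_ringM].
apply: val_ringD => //; rewrite -mulN1r; apply: val_ringM => //.
by rewrite -(rmorphN1 (@ratfunC R)); apply: val_ring_const.
Qed.

Lemma val_maxW x : val_max x -> val_ring x.
Proof. by move=> /andP[]. Qed.

Lemma val_maxP x : val_max x <-> val_ring x /\ nu x <> Some 0.
Proof.
rewrite /val_max /vlt; split; first by move=> /andP[? /eqP ne]; split=> // e; apply: ne.
by move=> [? ne]; apply/andP; split=> //; apply/eqP => e; apply: ne.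
Qed.

Lemma val_unit x : val_ring x -> ~ val_max x -> nu x = Some 0.
Proof. by move=> Vx nP; apply: contrapT => ne; apply: nP; apply/val_maxP. Qed.

Lemma val_ringV x : nu x = Some 0 -> nu x^-1 = Some 0.
Proof.
move=> x0; have xn0 : x != 0 by apply/eqP => e; move: x0; rewrite e nu0.
have := valuationM hnu x x^-1; rewrite divff // nu1 x0.
by case: (nu x^-1) => //= g [->]; rewrite add0r.
Qed.

Lemma val_local_pair : local_pair val_ring val_max.
Proof.
have max_mul a x : val_ring a -> val_max x -> val_max (a * x).
  move=> Va Px; have [Vx nx] := (val_maxP x).1 Px; apply/val_maxP; split.
    exact: val_ringM.
  move=> e; apply: nx; move: Va Vx e; rewrite /val_ring (valuationM hnu).
  case: (nu a) (nu x) => [g|] [h|] //= g0 h0 [e]; congr Some; apply/le_anti; rewrite h0 andbT.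
  by rewrite -e; have := hGam.2 0 g h g0; rewrite add0r.
split; first exact: val_ring_subring.
- split.
  + exact: val_maxW.
  + by rewrite /val_max nu0.
  + move=> x y Px Py; apply/val_maxP; split; first by apply: val_ringD; apply: val_maxW.
    move=> e.
    have := valuationD hnu x y; rewrite e /vmin.
    have [Vx nx] := (val_maxP x).1 Px; have [Vy ny] := (val_maxP y).1 Py.
    have absurd z : val_ring z -> nu z <> Some 0 -> vle (nu z) (Some 0) -> False.
      rewrite /val_ring; case: (nu z) => //= g g0 ng gle; apply: ng.
      by congr Some; apply/le_anti; rewrite gle g0.
    by case: ifP => _; apply: absurd.
  + exact: max_mul.
- by rewrite /val_max nu1 /vlt eqxx andbF.
- by move=> x Vx nP; rewrite /val_ring (val_ringV (val_unit Vx nP)) /=.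
Qed.

Lemma nu_exprz x (v : Gam) (n : int) : nu x = Some v -> nu (x ^ n) = Some (v *~ n).
Proof.
move=> xv; have nat_case (m : nat) : nu (x ^+ m) = Some (v *+ m).
  elim: m => [|m IH]; first by rewrite expr0 mulr0n nu1.
  by rewrite exprS (valuationM hnu) xv IH mulrS.
case: n => m; first exact: nat_case.
have xm : x ^+ m.+1 != 0 by apply/eqP => e; have := nat_case m.+1; rewrite e nu0.
have := valuationM hnu (x ^+ m.+1) (x ^+ m.+1)^-1.
rewrite divff // nu1 nat_case NegzE mulrNz -exprnN.
case: (nu (x ^- m.+1)) => //= g [e]; congr Some.
by apply: (addrI (v *+ m.+1)); rewrite -e -pmulrn subrr.
Qed.

Lemma nu_monomial (v : 'I_2 -> Gam) : (forall j, nu (X j) = Some (v j)) ->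
  forall g, nu (monomial X g) = Some (v 0 *~ g 0 0 + v 1 *~ g 0 1).
Proof.
move=> hv g; rewrite /monomial big_ord_recl big_ord1 (valuationM hnu).
rewrite (nu_exprz _ (hv _)) (nu_exprz _ (hv _)) /= (_ : lift ord0 ord0 = 1) //.
exact/val_inj.
Qed.

Lemma value_groupD g h : value_group nu g -> value_group nu h -> value_group nu (g + h).
Proof. by move=> [x xg] [y yh]; exists (x * y); rewrite (valuationM hnu) xg yh. Qed.

Lemma value_groupMz g (n : int) : value_group nu g -> value_group nu (g *~ n).
Proof. by move=> [x xg]; exists (x ^ n); apply: nu_exprz. Qed.

Lemma value_group0 : value_group nu 0.
Proof. by exists 1; apply: nu1. Qed.

Section Model.
Variable phi : Gam -> R^o * R^o.
Hypothesis hphi : value_group_model nu phi.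

Let phiD g h : value_group nu g -> value_group nu h -> phi (g + h) = phi g + phi h.
Proof. by case: hphi => H _ _; apply: H. Qed.

Let phi0 : phi 0 = 0.
Proof.
have := phiD value_group0 value_group0; rewrite addr0 => /eqP.
by rewrite -subr_eq0 opprD addNKr oppr_eq0 => /eqP.
Qed.

Let phiMz g (n : int) : value_group nu g -> phi (g *~ n) = phi g *~ n.
Proof.
move=> vg; have nat_case (m : nat) : phi (g *+ m) = phi g *+ m.
  elim: m => [|m IH]; first by rewrite !mulr0n phi0.
  by rewrite !mulrS phiD ?IH // pmulrn; apply: value_groupMz.
case: n => m; first exact: nat_case.
rewrite NegzE !mulrNz -!pmulrn; apply: (addrI (phi g *+ m.+1)).
rewrite subrr -nat_case -phiD ?subrr // ?pmulrn; first exact: value_groupMz.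
by rewrite -mulrNz; apply: value_groupMz.
Qed.

Definition lex_ge0 (a b : R) : bool := (0 < a) || ((a == 0) && (0 <= b)).

(** Monotonicity of [phi] gives one direction, and totality of the order supplies the other. *)
Lemma phi_ge0 g : value_group nu g -> (0 <= g) = lex_ge0 (phi g).1 (phi g).2.
Proof.
move=> vg; have [_ phi_lt _] := hphi; have v0 := value_group0.
have [tot _] := hGam.
have [->|g0] := eqVneq g 0; first by rewrite phi0 lexx /lex_ge0 eqxx lexx orbT.
have [gpos|gneg] := boolP (0 <= g).
  have : 0 < g by rewrite lt_def g0.
  move=> /(phi_lt _ _ v0 vg); rewrite phi0 ltEprodlexi /= /lex_ge0 => /andP[].
  rewrite le_eqVlt => /predU1P[<-|->//]; rewrite lexx eqxx /= => /ltW ->.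
  by rewrite orbT.
have : g < 0 by rewrite lt_def eq_sym g0; case/orP: (tot g 0) => // h; rewrite h in gneg.
move=> /(phi_lt _ _ vg v0); rewrite phi0 ltEprodlexi /= /lex_ge0 => /andP[le0 h].
apply/esym/negP; case/orP => [lt0|/andP[/eqP e ge0]].
  by move: le0; rewrite leNgt lt0.
by move: h; rewrite e lexx /= ltNge ge0.
Qed.

Hypothesis hslope : forall lambda : R, irrational lambda ->
  omap phi (nu (X 0)) <> omap (fun g => lambda *: phi g) (nu (X 1)).

(** Commensurable reals are integral multiples of one positive real, which does not affect signs. *)
Lemma lex_rational_slope (r0 r1 : R) : (r1 = 0 \/ rational (r0 / r1)) ->
  exists a0 a1 : int, forall x y : int,
    lex_ge0 (r0 * x%:~R + r1 * y%:~R) 0 = nonneg OrderLex (a0 * x + a1 * y, 0 * x + 0 * y).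
Proof.
move=> slope; suff [rho [a0 [a1 [rho0 -> ->]]]] : exists rho (a0 a1 : int),
    [/\ 0 < rho, r0 = rho * a0%:~R & r1 = rho * a1%:~R].
  exists a0, a1 => x y; rewrite /lex_ge0 /= !mul0r addr0 lexx !andbT.
  rewrite -!mulrA -mulrDr pmulr_rgt0 // mulf_eq0 (gt_eqF rho0) /=.
  by rewrite -!rmorphM -rmorphD /= ltr0z intr_eq0.
have [r10|r10] := eqVneq r1 0.
  have [r00|r00] := eqVneq r0 0; first by exists 1, 0, 0; rewrite r10 r00 !mulr0.
  exists `|r0|, (if 0 <= r0 then 1 else -1), 0; rewrite r10 mulr0 normr_gt0; split=> //.
  by case: ifP => h; [rewrite mulr1 ger0_norm | rewrite rmorphN1 mulrN1 ltr0_norm ?opprK // ltNge h].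
case: slope => [e|/rationalP[p [q e]]]; first by rewrite e eqxx in r10.
(* With denominator 0 the quotient is 0, so r0 = 0. *)
have [q0|q0] := posnP q.
  exists `|r1|, 0, (if 0 <= r1 then 1 else -1); rewrite mulr0 normr_gt0; split=> //.
    by rewrite -(divfK r10 r0) e q0 invr0 mulr0 mul0r.
  by case: ifP => h; [rewrite mulr1 ger0_norm | rewrite rmorphN1 mulrN1 ltr0_norm ?opprK // ltNge h].
have qR : q%:R != 0 :> R by rewrite pnatr_eq0 -lt0n.
exists (`|r1| / q%:R), (if 0 <= r1 then p else - p), (if 0 <= r1 then q%:Z else - q%:Z).
have r0E : r0 = r1 / q%:R * p%:~R by rewrite -[LHS](divfK r10) e mulrC mulrA mulrAC.
split; first by rewrite divr_gt0 ?normr_gt0 // ltr0n.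
  rewrite r0E; case: ifP => h; first by rewrite ger0_norm.
  by rewrite ltr0_norm ?ltNge ?h // rmorphN /=; ring.
case: ifP => h; first by rewrite ger0_norm // divfK.
by rewrite ltr0_norm ?ltNge ?h // rmorphN /= mulrN mulNr mulNr divfK // opprK.
Qed.

(** In each model the values of x_1 and x_2 give integral linear forms up to a positive factor: they
    are commensurable in Q, integral componentwise in Z^2, and commensurable in Z + beta Z by the
    hypothesis on slopes. *)
Theorem value_mode : exists o (l0 l1 m0 m1 : int), `|l0 * m1 - l1 * m0| = 1 /\
  forall g, vle (Some 0) (nu (monomial X g)) =
    nonneg o (l0 * g 0 0 + l1 * g 0 1, m0 * g 0 0 + m1 * g 0 1).
Proof.
have /choice[v vE] : forall j, exists g, nu (X j) = Some g.
  by move=> j; apply: nu_some; apply: ratfunX_neq0.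
have vv j : value_group nu (v j) by exists (X j).
have image j : exists2 g, value_group nu g & phi g = phi (v j) by exists (v j).
suff [a0 [a1 [b0 [b1 sgn]]]] : exists a0 a1 b0 b1 : int, forall x y : int,
    lex_ge0 ((phi (v 0)).1 * x%:~R + (phi (v 1)).1 * y%:~R)
            ((phi (v 0)).2 * x%:~R + (phi (v 1)).2 * y%:~R) =
    nonneg OrderLex (a0 * x + a1 * y, b0 * x + b1 * y).
  have [o [l0 [l1 [m0 [m1 [dt H]]]]]] := lex_normal_form a0 a1 b0 b1.
  exists o, l0, l1, m0, m1; split=> // g; rewrite -H -sgn (nu_monomial vE) /= phi_ge0.
    rewrite phiD ?phiMz //; try exact: value_groupMz.
    case: (phi (v 0)) (phi (v 1)) => [p q] [p' q'].
    by rewrite -!scaler_int /=; congr lex_ge0; rewrite /GRing.scale /=; ring.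
  by apply: value_groupD; apply: value_groupMz.
have zero2 (r0 r1 : R) : (r1 = 0 \/ rational (r0 / r1)) -> phi (v 0) = (r0, 0) ->
    phi (v 1) = (r1, 0) -> exists a0 a1 b0 b1 : int, forall x y : int,
    lex_ge0 ((phi (v 0)).1 * x%:~R + (phi (v 1)).1 * y%:~R)
            ((phi (v 0)).2 * x%:~R + (phi (v 1)).2 * y%:~R) =
    nonneg OrderLex (a0 * x + a1 * y, b0 * x + b1 * y).
  move=> slope -> ->; have [a0 [a1 H]] := lex_rational_slope slope.
  by exists a0, a1, 0, 0 => x y; rewrite -H /= !mul0r addr0.
case: hphi => _ _ [hQ|hZ|[beta [_ _ hB]]].
- have [q0 e0] := hQ _ (image 0); have [q1 e1] := hQ _ (image 1).
  apply: (zero2 (ratr q0) (ratr q1)) => //; right.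
  by exists (q0 / q1) => //; rewrite fmorph_div.
- have [a0 [b0 e0]] := (hZ _).1 (image 0); have [a1 [b1 e1]] := (hZ _).1 (image 1).
  exists a0, a1, b0, b1 => x y; rewrite e0 e1 /lex_ge0 /=.
  by rewrite -!rmorphM -!rmorphD /= ltr0z intr_eq0 ler0z.
- have [a0 [b0 e0]] := (hB _).1 (image 0); have [a1 [b1 e1]] := (hB _).1 (image 1).
  move: e0 e1; set r0 := _ + _; set r1 := _ + _ => e0 e1.
  apply: (zero2 r0 r1) => //.
  have [->|r10] := eqVneq r1 0; first by left.
  right; apply: contrapT => irr; have := @hslope (r0 / r1) irr.
  rewrite !vE /= e0 e1; apply; congr Some.
  have -> : (r0 / r1) *: ((r1, 0) : R^o * R^o) = (r0 / r1 * r1, r0 / r1 * 0) by [].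
  by rewrite mulr0 divfK.
Qed.
End Model.
End ValuationRing.

(** * Local uniformization *)

Section Coordinates.
Variables l0 l1 m0 m1 : int.
Hypothesis unimodular : `|l0 * m1 - l1 * m0| = 1.

Definition lattice_coord (g : Z2) : int * int :=
  (l0 * g 0 0 + l1 * g 0 1, m0 * g 0 0 + m1 * g 0 1).

Lemma lattice_coordB g h : lattice_coord (g - h) = lattice_coord g - lattice_coord h.
Proof. by rewrite /lattice_coord !mxE; apply: pair_ext; rewrite !pairE /=; ring. Qed.

Lemma lattice_coordD g h : lattice_coord (g + h) = lattice_coord g + lattice_coord h.
Proof. by rewrite /lattice_coord !mxE; apply: pair_ext; rewrite !pairE /=; ring. Qed.

Lemma lattice_coord0 : lattice_coord 0 = 0.
Proof. by rewrite -(subrr 0) lattice_coordB subrr. Qed.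

Lemma lattice_coordMz g n : lattice_coord (g *~ n) = lattice_coord g *~ n.
Proof.
by apply: pair_ext; rewrite !pairE -scaler_int intz /lattice_coord !mxE /=; ring.
Qed.

Lemma lattice_coord_det g h :
  (det2 (lattice_coord g) (lattice_coord h) != 0) = (detZ g h != 0).
Proof.
have -> : det2 (lattice_coord g) (lattice_coord h) = (l0 * m1 - l1 * m0) * detZ g h.
  by rewrite /det2 /lattice_coord /detZ /=; ring.
by rewrite mulf_eq0 negb_or -normr_eq0 unimodular oner_eq0.
Qed.

Lemma lattice_coord_surj e : exists g, lattice_coord g = e.
Proof.
pose D := l0 * m1 - l1 * m0; have DD : D * D = 1.
  by rewrite -expr2 -real_normK ?num_real // unimodular.
exists (\row_j (if j == 0 then D * (m1 * e.1 - l1 * e.2) else D * (l0 * e.2 - m0 * e.1))).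
rewrite /lattice_coord !mxE /=; apply: pair_ext => /=.
  transitivity (D * D * e.1); last by rewrite DD mul1r.
  by rewrite /D; ring.
transitivity (D * D * e.2); last by rewrite DD mul1r.
by rewrite /D; ring.
Qed.

Lemma lattice_coord_inj : injective lattice_coord.
Proof.
move=> g h /eqP; rewrite -subr_eq0 -lattice_coordB; set k := g - h => /eqP k0.
apply/eqP; rewrite -subr_eq0 -/k; apply/eqP/rowP => j; rewrite mxE.
have e (k' : Z2) : detZ k k' = 0.
  by apply/eqP/negPn; rewrite -lattice_coord_det k0 /det2 /= !mul0r subrr eqxx.
have := e (delta_mx 0 1); have := e (delta_mx 0 0); rewrite /detZ !mxE /=.
by case: (ord2P j) => ->; lia.
Qed.

Section ChartSequence.
Variables (R : realType) (o : order_mode).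
Local Notation C := R[i].

Definition support_in_coord n (d : 'rV[C * Z2]_n) (s : seq (int * int)) : Prop :=
  forall h, h \in s <-> exists g, support d g /\ lattice_coord g = h.

(** At each step J selects coordinates that carry the two vectors of the minimal base. *)
Lemma chart_sequence (X0 : affine_chart R) (d0 : 'rV[C * Z2]_(adim X0)) s :
  toric_chart d0 -> support_in_coord d0 s -> admissible o s ->
  forall k, exists U (d : 'rV[C * Z2]_(adim U)),
    [/\ nash_chart X0 k U, toric_chart d & support_in_coord d (nash_seq o s k)].
Proof.
move=> t0 s0 adm; elim=> [|k [U [d [nU tU sU]]]].
  by exists X0, d0; split=> //; apply: NashChart0.
have [ps qs det _ _] := minbaseP o (nash_seq_admissible k adm).1.
rewrite nash_seqS /nash_step; set p := (minbase _ _).1 in ps det *.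
set q := (minbase _ _).2 in qs det *.
have [_ [[k1 [c1 <-]] pE]] := (sU p).1 ps; have [_ [[k2 [c2 <-]] qE]] := (sU q).1 qs.
pose J (a : 'I_2) := if a == 0 then k1 else k2.
have [||U' [d' [nU' tU' sU']]] := toric_nash_step (J := J) nU tU.
- by move=> a; rewrite /J; case: ifP.
- by rewrite -lattice_coord_det pE qE.
exists U', d'; split=> // h; rewrite nash_exponentsP; split.
  case=> [/sU[g [gd gh]]|[/sU[g [gd gh]] dt]|[/sU[g [gd gh]] dt]].
  - by exists g; split=> //; apply/sU'; apply: Or31.
  - exists (g - (d 0 k1).2); rewrite lattice_coordB gh pE addrK; split=> //.
    by apply/sU'; apply: Or32; exists g; split=> //; rewrite -lattice_coord_det gh qE.
  - exists (g - (d 0 k2).2); rewrite lattice_coordB gh qE addrK; split=> //.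
    by apply/sU'; apply: Or33; exists g; split=> //; rewrite -lattice_coord_det gh pE.
move=> [g' [/sU' sg <-]]; case: sg => [gd|[g [gd dt ->]]|[g [gd dt ->]]].
- by apply: Or31; apply/sU; exists g'.
- apply: Or32; rewrite lattice_coordB pE subrK -qE lattice_coord_det; split=> //.
  by apply/sU; exists g.
- apply: Or33; rewrite lattice_coordB qE subrK -pE lattice_coord_det; split=> //.
  by apply/sU; exists g.
Qed.
End ChartSequence.
End Coordinates.

Section Surface.
Variables (R : realType) (r : nat) (gamma : 'I_r -> Z2).
Local Notation C := R[i].
Hypothesis hgamma : monomial_exponents gamma.

Definition surface_data : 'rV[C * Z2]_r := \row_i (1, gamma i).

Lemma support_surface g : support surface_data g <-> exists i, gamma i = g.
Proof.
by split=> [[i [_]]|[i <-]]; [rewrite mxE /= => <-; exists i |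
  exists i; rewrite mxE oner_eq0].
Qed.

Lemma surface_chart : @toric_chart R (toric_surface R gamma) surface_data.
Proof.
have cE : coords (toric_surface R gamma) =
    map_mx (toric_coord (@ratfunC R) (@ratfunX R)) surface_data.
  by apply/rowP => i; rewrite !mxE /toric_coord rmorph1 mul1r.
have pE t : torus t -> exists t' : 'I_2 -> C, (forall j, t' j != 0) /\
    map_mx (toric_coord idfun t) surface_data = \row_i monomial t' (gamma i).
  by move=> tt; exists t; split=> //; apply/rowP => i; rewrite !mxE /toric_coord mul1r.
split=> //.
- move=> p; rewrite cE; split=> [h|/pullback_torus h].
    by apply/pullback_torus => t /pE tt; apply: h => q; apply.
  move=> x; apply => _ [t [tt ->]].
  have := h t tt; congr (meval _ _ = 0); apply/funext => i.
  by rewrite !mxE /toric_coord mul1r.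
- by move=> t /pE tt q; apply.
- move=> H sH HS g; have [c ->] := hgamma.2 g.
  elim/big_ind: _ => [|x y|i _]; first by case: sH.
    exact: subgroupD.
  rewrite -[c i]intz scaler_int; apply: subgroupMz => //; apply: HS.
  by apply/support_surface; exists i.
Qed.
End Surface.

Section Independence.
Variable R : realType.
Local Notation C := R[i].
Local Notation K := (ratfun R).
Local Notation X := (@ratfunX R).

(** Independence of the exponents makes distinct monomials in u and w distinct Laurent monomials. *)
Lemma monomials_independent (g1 g2 : Z2) : detZ g1 g2 != 0 ->
  forall p : {poly {poly C}},
    eval2 (@ratfunC R) (monomial X g1) (monomial X g2) p = 0 -> p = 0.
Proof.
move=> dt p; set u := monomial X g1; set w := monomial X g2.
pose N := \max_(i < size p) size (p`_i)%R.
have pN i : (size (p`_i)%R <= N)%N.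
  have [ip|pi] := ltnP i (size p); last by rewrite nth_default ?size_poly0.
  exact: (leq_bigmax (Ordinal ip)).
pose idx := [seq (i, j) | i <- iota 0 (size p), j <- iota 0 N].
pose e (ij : nat * nat) : Z2 := g1 *+ ij.2 + g2 *+ ij.1.
have -> : eval2 (@ratfunC R) u w p =
    \sum_(ij <- idx) ratfunC p`_ij.1`_ij.2 * monomial X (e ij).
  rewrite /eval2 /= /horner_eval (@horner_coef_wide _ (size p)) ?size_poly //.
  rewrite big_allpairs_dep /= -val_enum_ord big_map big_enum /=; apply: eq_bigr => i _.
  rewrite coef_map /= /eval1 /= /horner_eval (@horner_coef_wide _ N); last first.
    exact: leq_trans (size_poly _ _) (pN i).
  rewrite mulr_suml -val_enum_ord big_map big_enum /=; apply: eq_bigr => j _.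
  rewrite coef_map /= /e monomialD ?monomialMn ?mulrA //; exact: ratfunX_neq0.
move=> /laurent_ratfun0 /laurent_torus0 h.
apply/polyP => i; apply/polyP => j; rewrite !coef0.
have [ip|pi] := ltnP i (size p); last by rewrite [p`_i]nth_default ?coef0.
have [jN|Nj] := ltnP j N; last by rewrite nth_default //; apply: leq_trans (pN i) Nj.
have ij : (i, j) \in idx by apply/allpairsP; exists (i, j); rewrite !mem_iota.
have uidx : uniq idx.
  by apply: allpairs_uniq; rewrite ?iota_uniq // => -[? ?] [? ?] _ _ [-> ->].
have := h (e (i, j)).
rewrite (eq_bigl (fun ij' => ij' == (i, j))); last first.
  move=> [i' j']; apply/eqP/eqP => [|[-> ->]//].
  rewrite /e /= => E.
  have E0 : g1 *+ j' + g2 *+ i' - (g1 *+ j + g2 *+ i) = 0 by rewrite E subrr.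
  have mulnE (g : Z2) (m : nat) k : (g *+ m) 0 k = g 0 k * m%:Z.
    by rewrite mulmxnE -mulr_natr natz.
  move/rowP: E0 => E0; have := E0 0; have := E0 1; rewrite !mxE !mulnE.
  move: dt; rewrite /detZ; set a := g1 0 0; set b := g1 0 1.
  set c := g2 0 0; set f := g2 0 1 => dt E1 E2.
  have /eqP : (a * f - b * c) * (j'%:Z - j%:Z) = 0.
    transitivity (f * (a * j'%:Z + c * i'%:Z - (a * j%:Z + c * i%:Z)) -
      c * (b * j'%:Z + f * i'%:Z - (b * j%:Z + f * i%:Z))); first by ring.
    by rewrite E1 E2 !mulr0 subrr.
  have /eqP : (a * f - b * c) * (i'%:Z - i%:Z) = 0.
    transitivity (a * (b * j'%:Z + f * i'%:Z - (b * j%:Z + f * i%:Z)) -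
      b * (a * j'%:Z + c * i'%:Z - (a * j%:Z + c * i%:Z))); first by ring.
    by rewrite E1 E2 !mulr0 subrr.
  rewrite !mulf_eq0 (negPf dt) /= !subr_eq0 => /eqP[->] /eqP[->] //.
by rewrite -big_filter filter_pred1_uniq // big_seq1.
Qed.
End Independence.

Section CoordinateRing.
Variable R : realType.
Local Notation C := R[i].
Local Notation K := (ratfun R).

Lemma pullback_min (S : K -> Prop) n (f : 'rV[K]_n) :
  subring S -> (forall c, S (ratfunC c)) -> (forall k, S (f 0 k)) ->
  forall p, S (pullback f p).
Proof.
move=> rS Sc Sf p; rewrite /pullback /mmap; apply: subring_sum => // m.
have [S1 _ SM] := rS; apply: (SM) => //; rewrite /mmap1.
by elim/big_ind: _ => [//|x y Sx Sy|k _]; [apply: SM | apply: subringX].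
Qed.

Lemma coord_ring_subring (U : affine_chart R) : subring (coord_ring U).
Proof.
split.
- by exists 1; rewrite rmorph1.
- by move=> _ _ [p ->] [q ->]; exists (p - q); rewrite rmorphB.
- by move=> _ _ [p ->] [q ->]; exists (p * q); rewrite rmorphM.
Qed.

Lemma coord_ring_const (U : affine_chart R) c : coord_ring U (ratfunC c).
Proof. by exists c%:MP; rewrite /pullback mmapC. Qed.

Lemma coord_ring_coord (U : affine_chart R) k : coord_ring U (coords U 0 k).
Proof. by exists 'X_k; rewrite /pullback mmapX mmap1U. Qed.
End CoordinateRing.

(** * Regularity at the center *)

Section Uniformization.
Variables (R : realType) (Gam : porderZmodType) (hGam : ordered_group Gam).
Local Notation C := R[i].
Local Notation K := (ratfun R).
Local Notation X := (@ratfunX R).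
Variable nu : K -> option Gam.
Hypothesis hnu : valuation nu.
Hypothesis hnuC : forall c : C, c != 0 -> nu (ratfunC c) = Some 0.

Let V := val_ring nu.
Let P := val_max nu.
Let VP : local_pair V P := val_local_pair hGam hnu hnuC.
Let rV : subring V. Proof. by case: VP. Qed.

Lemma regular_at_centerP (A : K -> Prop) : subring A -> (forall x, A x -> V x) ->
  regular_local_ring (local_ring V P A) (local_max V P A) -> regular_at_center nu A.
Proof.
move=> rA AV; have unitP b : A b -> ~ center nu A b <-> unit_of V P b.
  move=> Ab; split=> [h|[_ h]]; last by move=> [_ /h].
  by split; [apply: AV | move=> Pb; apply: h].
have e1 : localization A (center nu A) = local_ring V P A.
  apply/funext => x; apply/propext; split=> -[a [b [Aa Ab cb ->]]]; exists a, b.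
    by split=> //; apply/unitP.
  by split=> //; apply/unitP.
have e2 : localization_max_ideal A (center nu A) = local_max V P A.
  have [_ [_ _ _ PM] _ _] := VP.
  apply/funext => x; apply/propext; split.
    move=> [a [b [[Aa Pa] Ab /(unitP b Ab) Ub ->]]]; split; first by exists a, b.
    by rewrite mulrC; apply: PM => //; case: (unit_inv VP Ub).
  move=> [[a [b [Aa Ab Ub ->]]] Px]; exists a, b; split=> //; last exact/unitP.
  split=> //; rewrite -[a](divfK (unit_neq0 VP Ub)) mulrC; apply: PM => //.
  exact: AV.
by rewrite /regular_at_center e1 e2.
Qed.

Variables l0 l1 m0 m1 : int.
Hypothesis unimodular : `|l0 * m1 - l1 * m0| = 1.
Local Notation psi := (lattice_coord l0 l1 m0 m1).
Variable o : order_mode.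
Hypothesis nu_sign : forall g, vle (Some 0) (nu (monomial X g)) = nonneg o (psi g).

Let X0 := @ratfunX_neq0 R.

Lemma null_unit g : null o (psi g) -> unit_of V P (monomial X g).
Proof.
move=> /andP[h1 h2]; have Vg : V (monomial X g) by rewrite /V /val_ring nu_sign.
have Vg' : V (monomial X (- g)).
  by rewrite /V /val_ring nu_sign -sub0r lattice_coordB lattice_coord0 sub0r.
split=> // Pg; case: VP => _ [_ _ _ PM] nP1 _; apply: nP1.
have := PM _ _ Vg' Pg; rewrite -monomialD // addNr monomial0 //.
Qed.

(** The coordinate ring and C[u, w] have the same localization at the center, although neither need
    contain the other. *)
Lemma regular_of_smooth (U : affine_chart R) (d : 'rV[C * Z2]_(adim U)) s :
  toric_chart d -> support_in_coord l0 l1 m0 m1 d s -> (forall h, h \in s -> nonneg o h) ->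
  smooth_exponents o s ->
  centered nu (coord_ring U) /\ regular_at_center nu (coord_ring U).
Proof.
move=> [cE _ _ sp] sd nn [e1 [e2 [det12 nn1 nn2 gen inv]]].
set A := coord_ring U; have rA : subring A := coord_ring_subring U.
have Vc c : V (ratfunC c) by apply: val_ring_const.
have coordE k : coords U 0 k = ratfunC (d 0 k).1 * monomial X (d 0 k).2 by rewrite cE mxE.
have AV x : A x -> V x.
  move=> [p ->]; apply: pullback_min => // k; rewrite coordE.
  have [->|ck] := eqVneq (d 0 k).1 0; first by rewrite rmorph0 mul0r; apply: subring0.
  case: rV => _ _; apply=> //; rewrite /V /val_ring nu_sign; apply: nn; apply/sd.
  by exists (d 0 k).2; split=> //; exists k.
split=> //; apply: regular_at_centerP => //.
have [g1 g1E] := lattice_coord_surj unimodular e1.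
have [g2 g2E] := lattice_coord_surj unimodular e2.
set u := monomial X g1; set w := monomial X g2.
have Vu : V u by rewrite /V /val_ring nu_sign g1E.
have Vw : V w by rewrite /V /val_ring nu_sign g2E.
pose B := bivariate (@ratfunC R) u w.
have rB : subring B := bivariate_subring _ u w.
have BV x : B x -> V x by apply: bivariate_min.
have rOA := local_ring_subring VP rA; have rOB := local_ring_subring VP rB.
have AO := local_ring_base VP rA; have BO := local_ring_base VP rB.
have AB x : local_ring V P A x -> local_ring V P B x.
  apply: local_ring_trans => // _ [p ->]; apply: pullback_min => // [c|k].
    by apply: BO; apply: bivariate_const.
  rewrite coordE; have [->|ck] := eqVneq (d 0 k).1 0.
    by rewrite rmorph0 mul0r; apply: subring0.
  have ks : psi (d 0 k).2 \in s by apply/sd; exists (d 0 k).2; split=> //; exists k.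
  have [i [j [kE hi hj]]] := gen _ ks.
  have -> : (d 0 k).2 = g1 *~ i + g2 *~ j.
    apply: (lattice_coord_inj unimodular).
    by rewrite lattice_coordD !lattice_coordMz g1E g2E.
  have [_ _ OM] := rOB; apply: (OM); first by apply: BO; apply: bivariate_const.
  (* Negative powers occur only for null exponents, whose monomials are units. *)
  have power g z : local_ring V P B (monomial X g) -> 0 <= z \/ null o (psi g) ->
      local_ring V P B (monomial X g ^ z).
    move=> Og; case: z => n; first by move=> _; apply: subringX.
    case=> [//|/null_unit[_ nP]]; rewrite NegzE -exprnN -exprVn.
    by apply: subringX => //; apply: local_ring_inv.
  rewrite monomialD // !monomialMz //; apply: OM; apply: power; rewrite ?g1E ?g2E //.
    by apply: BO; apply: bivariate_fst.
  by apply: BO; apply: bivariate_snd.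
have BA x : local_ring V P B x -> local_ring V P A x.
  have sA g : psi g \in s -> A (monomial X g).
    move=> /sd[g' [[k [ck gk]] /(lattice_coord_inj unimodular) <-]].
    have -> : monomial X g' = ratfunC (d 0 k).1^-1 * coords U 0 k.
      by rewrite coordE gk mulrA -rmorphM mulVf // rmorph1 mul1r.
    case: rA => _ _; apply; [exact: coord_ring_const|exact: coord_ring_coord].
  have [_ _ OM] := rOA.
  (* The exponents whose monomial is invertible in the local ring of A: a subgroup that contains the
     null exponents of [s]. *)
  pose H h := forall g, psi g = h -> local_ring V P A (monomial X g) /\
    local_ring V P A (monomial X (- g)).
  have sH : subgroup H.
    split.
      move=> g; rewrite -(lattice_coord0 l0 l1 m0 m1) => /(lattice_coord_inj unimodular) ->.
      by rewrite oppr0 monomial0; split; apply: AO; case: rA.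
    move=> h1 h2 Hx Hy g gE; have [gx gxE] := lattice_coord_surj unimodular h1.
    have [gy gyE] := lattice_coord_surj unimodular h2.
    have -> : g = gx - gy.
      by apply: (lattice_coord_inj unimodular); rewrite lattice_coordB gE gxE gyE.
    have [Ox Ox'] := Hx _ gxE; have [Oy Oy'] := Hy _ gyE.
    by rewrite opprB !monomialD //; split; apply: OM.
  have [|h1 h2] := inv H sH.
    move=> h /[dup] gs /sd[g [gd gh]]; rewrite -gh in gs *.
    move=> gnull g' /(lattice_coord_inj unimodular) ->.
    have Og : local_ring V P A (monomial X g).
      by apply: AO; apply: sA; apply/sd; exists g.
    split=> //; rewrite monomialN //; apply: local_ring_inv => //.
    by case: (null_unit gnull).
  apply: local_ring_trans => //; apply: bivariate_min => //.
  - by move=> c; apply: AO; apply: coord_ring_const.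
  - by case: h1 => [h|/(_ _ g1E)[]//]; apply: AO; apply: sA; rewrite g1E.
  - by case: h2 => [h|/(_ _ g2E)[]//]; apply: AO; apply: sA; rewrite g2E.
have OE : local_ring V P A = local_ring V P B.
  by apply/funext => x; apply/propext; split; [apply: AB | apply: BA].
rewrite /local_max OE; apply: regular_bivariate => //.
- by move=> p; have [rs e] := closed_field_poly_normal p; exists rs.
- apply: monomials_independent; rewrite -(lattice_coord_det unimodular) g1E g2E.
  by rewrite -normr_eq0 det12 oner_eq0.
- exact: eval3_dependence.
Qed.
End Uniformization.

Theorem theorem0p1 (R : realType) (r : nat) (gamma : 'I_r -> 'rV[int]_2)
    (hgamma : monomial_exponents gamma)
    (Gam : porderZmodType) (hGam : ordered_group Gam)
    (nu : ratfun R -> option Gam)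
    (hnu : valuation nu)
    (hnuC : forall c : R[i], c != 0 -> nu (ratfunC c) = Some 0)
    (hcentered : centered nu (coord_ring (toric_surface R gamma)))
    (phi : Gam -> R^o * R^o) (hphi : value_group_model nu phi)
    (hslope : forall lambda : R, irrational lambda ->
       omap phi (nu (ratfunX R 0)) <>
       omap (fun g => lambda *: phi g) (nu (ratfunX R 1))) :
  exists k : nat, center_nonsingular nu (toric_surface R gamma) k.
Proof.
have [o [l0 [l1 [m0 [m1 [unimod sgn]]]]]] := value_mode hGam hnu hnuC hphi hslope.
have tX := surface_chart R hgamma.
pose psi := lattice_coord l0 l1 m0 m1.
pose s := [seq psi (gamma i) | i : 'I_r].
have s0 : support_in_coord l0 l1 m0 m1 (surface_data R gamma) s.
  move=> h; split=> [/mapP[i _ ->]|[g [/support_surface[i <-] <-]]].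
    by exists (gamma i); split=> //; apply/support_surface; exists i.
  by apply: map_f; rewrite mem_enum.
have adm : admissible o s.
  split.
    move=> H [H0 HB] Hs h; have [g <-] := lattice_coord_surj unimod h.
    apply: (toric_spanning tX (H := fun g => H (psi g))).
      by split; [rewrite /psi lattice_coord0 | move=> x y Hx Hy; rewrite /psi lattice_coordB; apply: HB].
    by move=> g' g's; apply: Hs; apply/s0; exists g'.
  move=> _ /mapP[i _ ->]; rewrite -sgn; apply: hcentered.
  by exists 'X_i; rewrite /pullback mmapX mmap1U mxE.
have [k smooth] := nash_seq_smooth adm.
have [U [d [nU tU sU]]] := chart_sequence unimod tX s0 adm k.
have [_ nn] := nash_seq_admissible k adm.
have [cen reg] := regular_of_smooth hGam hnu hnuC unimod sgn tU sU nn smooth.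
by exists k, U.
Qed.
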